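(* There is a data structure in the Word RAM model of computation that maintains a $0$-$1$-weighted rooted forest $(F,w)$ with $n$ vertices under the operations \textsf{cut}, \textsf{update-weight} and \textsf{tree-sum}, with total running time $\mathcal{O}(m+n)$ for any sequence of $m$ operations.
   Context: A $0$-$1$-weighted rooted forest $(F,w)$ is a rooted forest $F$ with weights $w\colon V(F)\to\{0,1\}\subseteq\mathbb{Z}$. Operations: $\textsf{cut}(v)$ deletes the edge between $v$ and its parent (legal only if $v$ is not a root); $\textsf{update-weight}(v,x)$ with $x\in\{0,1\}$ sets $w(v)\gets x$; $\textsf{tree-sum}(v)$ returns the sum of weights of all vertices in the tree of the current forest containing $v$. The Word RAM has words of $\Theta(\log n)$ bits with constant-time arithmetic, bitwise operations, comparisons and indirect addressing. The running time includes initialization. *)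

(* Defs.v *)
From mathcomp Require Import all_boot.
From Stdlib Require Import PeanoNat.

Set Implicit Arguments.
Unset Strict Implicit.
Unset Printing Implicit Defensive.

(* Abstract data type: 0-1-weighted rooted forest on vertices 0..n-1.        *)
(* par v = Some u : u is the parent of v;  par v = None : v is a root.       *)

Definition up (par : nat -> option nat) (v : nat) : nat := odflt v (par v).

Definition anc (par : nat -> option nat) (k v : nat) : nat := iter k (up par) v.

(* par describes a rooted forest on {0,..,n-1}: parents are vertices and
   every vertex reaches a root by following parents (acyclicity). *)
Definition forest (n : nat) (par : nat -> option nat) : Prop :=
  (forall v u, v < n -> par v = Some u -> u < n) /\
  (forall v, v < n -> exists k, par (anc par k v) = None).

(* the root of the tree containing v (n steps suffice in a forest on n vertices) *)
Definition root_of (n : nat) (par : nat -> option nat) (v : nat) : nat :=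
  anc par n v.

Definition tree_sum (n : nat) (par : nat -> option nat) (wt : nat -> bool)
    (v : nat) : nat :=
  \sum_(u < n | root_of n par u == root_of n par v) (wt u : nat).

Inductive op : Type :=
| Cut (v : nat)
| UpdateWeight (v : nat) (x : bool)
| TreeSum (v : nat).

Definition cut_par (par : nat -> option nat) (v : nat) : nat -> option nat :=
  fun u => if u == v then None else par u.

Definition set_wt (wt : nat -> bool) (v : nat) (x : bool) : nat -> bool :=
  fun u => if u == v then x else wt u.

Fixpoint legal_seq (n : nat) (par : nat -> option nat) (ops : seq op) : Prop :=
  match ops with
  | [::] => True
  | Cut v :: ops' => v < n /\ par v <> None /\ legal_seq n (cut_par par v) ops'
  | UpdateWeight v _ :: ops' => v < n /\ legal_seq n par ops'
  | TreeSum v :: ops' => v < n /\ legal_seq n par ops'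
  end.

Fixpoint answers (n : nat) (par : nat -> option nat) (wt : nat -> bool)
    (ops : seq op) : seq nat :=
  match ops with
  | [::] => [::]
  | Cut v :: ops' => answers n (cut_par par v) wt ops'
  | UpdateWeight v x :: ops' => answers n par (set_wt wt v x) ops'
  | TreeSum v :: ops' => tree_sum n par wt v :: answers n par wt ops'
  end.

Definition is_query (o : op) : bool := if o is TreeSum _ then true else false.

(* Word RAM with word size w: memory cells indexed by nat, holding words     *)
(* (naturals < 2^w), zero-initialised; constant-time arithmetic (mod 2^w),   *)
(* bitwise operations, comparisons, indirect addressing, input/output.       *)

Inductive instr : Type :=
| IConst (d k : nat)
| IAdd (d a b : nat)
| ISub (d a b : nat)
| IMul (d a b : nat)
| IDiv (d a b : nat)       (* mem[d] := mem[a] / mem[b]  (0 if mem[b] = 0) *)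
| IMod (d a b : nat)
| IAnd (d a b : nat)
| IOr  (d a b : nat)
| IXor (d a b : nat)
| IShl (d a b : nat)
| IShr (d a b : nat)
| ILt  (d a b : nat)
| IEq  (d a b : nat)
| ILoad (d a : nat)
| IStore (a s : nat)
| IJz (a l : nat)
| IJmp (l : nat)
| IRead (d : nat)
| IWrite (s : nat)
| IHalt.

Record config : Type := Config {
  pc : nat;
  mem : nat -> nat;
  inp : seq (nat * nat * nat);
  consumed : nat;
  out : seq nat
}.

Definition upd (m : nat -> nat) (a x : nat) : nat -> nat :=
  fun i => if i == a then x else m i.

Definition end_rec : nat * nat * nat := (3, 0, 0).

Definition step (w : nat) (P : seq instr) (c : config) : option config :=
  let M := mem c in
  let W := 2 ^ w in
  let bin d f a b := Some (Config (pc c).+1 (upd M d (f (M a) (M b) %% W))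
                                  (inp c) (consumed c) (out c)) in
  match nth IHalt P (pc c) with
  | IConst d k => Some (Config (pc c).+1 (upd M d (k %% W)) (inp c) (consumed c) (out c))
  | IAdd d a b => bin d addn a b
  | ISub d a b => bin d (fun x y => x + (W - y %% W)) a b
  | IMul d a b => bin d muln a b
  | IDiv d a b => bin d divn a b
  | IMod d a b => bin d modn a b
  | IAnd d a b => bin d Nat.land a b
  | IOr d a b => bin d Nat.lor a b
  | IXor d a b => bin d Nat.lxor a b
  | IShl d a b => bin d (fun x y => x * 2 ^ y) a b
  | IShr d a b => bin d (fun x y => x %/ 2 ^ y) a b
  | ILt d a b => bin d (fun x y => nat_of_bool (x < y)) a b
  | IEq d a b => bin d (fun x y => nat_of_bool (x == y)) a b
  | ILoad d a => Some (Config (pc c).+1 (upd M d (M (M a))) (inp c) (consumed c) (out c))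
  | IStore a s => Some (Config (pc c).+1 (upd M (M a) (M s)) (inp c) (consumed c) (out c))
  | IJz a l => Some (Config (if M a == 0 then l else (pc c).+1) M (inp c) (consumed c) (out c))
  | IJmp l => Some (Config l M (inp c) (consumed c) (out c))
  | IRead d =>
      let '(x, y, z) := head end_rec (inp c) in
      Some (Config (pc c).+1 (upd (upd (upd M d x) d.+1 y) d.+2 z)
                   (behead (inp c)) (consumed c).+1 (out c))
  | IWrite s => Some (Config (pc c).+1 M (inp c) (consumed c) (rcons (out c) (M s)))
  | IHalt => None   (* also reached when pc is outside the program *)
  end.

Definition halted (w : nat) (P : seq instr) (c : config) : bool :=
  if step w P c is None then true else false.

Definition run (w : nat) (P : seq instr) (t : nat) (c : config) : config :=
  iter t (fun c' => odflt c' (step w P c')) c.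

(* Input encoding.  Record 0: (n,0,0).  Records 1..n: for vertex v,          *)
(* (parent of v, or n if v is a root; weight of v; 0).  Then one record per  *)
(* operation: cut(v) = (0,v,0), update-weight(v,x) = (1,v,x),                *)
(* tree-sum(v) = (2,v,0); finally the end marker (3,0,0).                   *)

Definition enc_op (o : op) : nat * nat * nat :=
  match o with
  | Cut v => (0, v, 0)
  | UpdateWeight v x => (1, v, nat_of_bool x)
  | TreeSum v => (2, v, 0)
  end.

Definition encode (n : nat) (par : nat -> option nat) (wt : nat -> bool)
    (ops : seq op) : seq (nat * nat * nat) :=
  (n, 0, 0) :: [seq (odflt n (par v), nat_of_bool (wt v), 0) | v <- iota 0 n]
    ++ map enc_op ops ++ [:: end_rec].

Definition init_config (input : seq (nat * nat * nat)) : config :=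
  Config 0 (fun _ => 0) input 0 [::].

(* Main.v *)
(* Hang all trees below a virtual root and number the vertices in preorder, so
   that the subtree of a vertex x is an interval [x, R x) of positions.  Cutting x
   marks its interval, and two vertices are in the same tree iff they lie in the
   same marked intervals.  Positions are grouped into blocks of B ~ log n, and the
   part of a tree inside a block is a "piece".  The piece of a position is found in
   O(1) from bit masks: if some marked interval starting in the block contains the
   position, the innermost one determines the piece; otherwise the last end of a
   marked interval entering the block from the left does.  Each tree keeps the
   circular list of its pieces ordered by position, and each piece the label of its
   tree, under which the sum of weights is stored.

   Cutting x splits at most two pieces (in the blocks of x and of R x); the new tree
   consists of a contiguous segment of the list.  Walking along the segment and its
   complement simultaneously, the smaller one is relabelled and summed with a table
   of population counts.  Since a tree with p pieces splits into p1 + p2 <= p + 2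
   pieces, p - 2 is superadditive, and starting from O(n / log n) pieces all cuts
   together cost O(n). *)
Require Import Defs.
From mathcomp Require Import all_boot zify.
From Stdlib Require Import Lia.
From Stdlib Require PeanoNat.

Set Implicit Arguments.
Unset Strict Implicit.
Unset Printing Implicit Defensive.

(** * A structured language and its compiler *)

Inductive binop := Add | Sub | Mul | Div | Mod | And | Shl | Lt | Eq.

Inductive expr :=
| Const (k : nat)
| Var (x : nat)
| Entry (i : nat) (e : expr)
| Bin (o : binop) (e1 e2 : expr).

Inductive cmd :=
| Skip
| Assign (x : nat) (e : expr)
| Store (i : nat) (e1 e2 : expr)
| Seq (c1 c2 : cmd)
| If (e : expr) (c1 c2 : cmd)
| While (e : expr) (c : cmd)
| Read (x : nat)
| Write (e : expr).

Record state := State {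
  var : nat -> nat;
  arr : nat -> nat -> nat;
  pending : seq (nat * nat * nat);
  nread : nat;
  output : seq nat }.

Definition eval_binop (o : binop) (x y : nat) : nat :=
  match o with
  | Add => x + y | Sub => x - y | Mul => x * y | Div => x %/ y | Mod => x %% y
  | And => Nat.land x y | Shl => x * 2 ^ y | Lt => x < y | Eq => x == y
  end.

Fixpoint eval (e : expr) (s : state) : nat :=
  match e with
  | Const k => k
  | Var x => var s x
  | Entry i e => arr s i (eval e s)
  | Bin o e1 e2 => eval_binop o (eval e1 s) (eval e2 s)
  end.

Definition upd_array (a : nat -> nat -> nat) (i x y : nat) : nat -> nat -> nat :=
  fun j => if j == i then upd (a j) x y else a j.

Definition set_var (s : state) (x y : nat) : state :=
  State (upd (var s) x y) (arr s) (pending s) (nread s) (output s).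

Definition set_entry (s : state) (i x y : nat) : state :=
  State (var s) (upd_array (arr s) i x y) (pending s) (nread s) (output s).

Definition read_record (s : state) (x : nat) : state :=
  let '(a, b, c) := head end_rec (pending s) in
  State (upd (upd (upd (var s) x a) x.+1 b) x.+2 c) (arr s) (behead (pending s))
    (nread s).+1 (output s).

Definition write_answer (s : state) (y : nat) : state :=
  State (var s) (arr s) (pending s) (nread s) (rcons (output s) y).

Lemma pow_expn a b : PeanoNat.Nat.pow a b = a ^ b.
Proof. by elim: b => //= b ->; rewrite expnS. Qed.

Lemma land_leql a b : Nat.land a b <= a.
Proof. by apply/leP/PeanoNat.Nat.land_le_l. Qed.

(* [due c] is the number of answers that must have been written by the time [c]
   records have been read. *)
Section Execution.

Variables (w : nat) (due : nat -> nat).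

Definition addressable (a : nat) : bool := 32 * a + 96 <= 2 ^ w.

Definition binop_safe (o : binop) (x y : nat) : bool :=
  match o with
  | Add => x + y < 2 ^ w | Sub => y <= x | Mul => x * y < 2 ^ w
  | Shl => x * 2 ^ y < 2 ^ w | _ => true
  end.

Fixpoint safe (e : expr) (s : state) : bool :=
  match e with
  | Const k => k < 2 ^ w
  | Var x => true
  | Entry i e => safe e s && addressable (eval e s)
  | Bin o e1 e2 => [&& safe e1 s, safe e2 s & binop_safe o (eval e1 s) (eval e2 s)]
  end.

Definition timely (s : state) : Prop := due (nread s) <= size (output s).

(* The cost index counts loop iterations only: between two iterations every
   machine instruction is executed at most once. *)
Inductive exec : cmd -> state -> nat -> state -> Prop :=
| ExecSkip s : exec Skip s 0 s
| ExecAssign s x e : safe e s -> exec (Assign x e) s 0 (set_var s x (eval e s))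
| ExecStore s i e1 e2 : safe e1 s -> safe e2 s -> addressable (eval e1 s) ->
    exec (Store i e1 e2) s 0 (set_entry s i (eval e1 s) (eval e2 s))
| ExecSeq s1 s2 s3 t1 t2 c1 c2 : exec c1 s1 t1 s2 -> exec c2 s2 t2 s3 ->
    exec (Seq c1 c2) s1 (t1 + t2) s3
| ExecThen s s' t e c1 c2 : safe e s -> eval e s != 0 -> exec c1 s t s' ->
    exec (If e c1 c2) s t s'
| ExecElse s s' t e c1 c2 : safe e s -> eval e s = 0 -> exec c2 s t s' ->
    exec (If e c1 c2) s t s'
| ExecExit s e c : safe e s -> eval e s = 0 -> exec (While e c) s 0 s
| ExecLoop s1 s2 s3 t1 t2 e c : safe e s1 -> eval e s1 != 0 -> exec c s1 t1 s2 ->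
    exec (While e c) s2 t2 s3 -> exec (While e c) s1 (t1 + t2).+1 s3
| ExecRead s x : timely (read_record s x) -> exec (Read x) s 0 (read_record s x)
| ExecWrite s e : safe e s -> exec (Write e) s 0 (write_answer s (eval e s)).

Definition binop_instr (o : binop) : nat -> nat -> nat -> instr :=
  match o with
  | Add => IAdd | Sub => ISub | Mul => IMul | Div => IDiv | Mod => IMod
  | And => IAnd | Shl => IShl | Lt => ILt | Eq => IEq
  end.

(* Cells 0-31 hold variables, cells 32-63 temporaries, and entry x of array i
   sits at address 64 + 32 x + i. *)
Definition address_code (i t : nat) : seq instr :=
  [:: IConst t.+1 32; IMul t t t.+1; IConst t.+1 (64 + i); IAdd t t t.+1].

Fixpoint compile_expr (e : expr) (t : nat) : seq instr :=
  match e with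
  | Const k => [:: IConst t k]
  | Var x => [:: IConst t.+1 0; IAdd t x t.+1]
  | Entry i e => compile_expr e t ++ address_code i t ++ [:: ILoad t t]
  | Bin o e1 e2 => compile_expr e1 t ++ compile_expr e2 t.+1 ++ [:: binop_instr o t t t.+1]
  end.

Fixpoint wf_expr (e : expr) (t : nat) : bool :=
  match e with
  | Const _ => t < 64
  | Var x => (x < 32) && (t.+1 < 64)
  | Entry i e => [&& i < 32, t.+1 < 64 & wf_expr e t]
  | Bin _ e1 e2 => [&& t.+1 < 64, wf_expr e1 t & wf_expr e2 t.+1]
  end.

Fixpoint code_size (c : cmd) : nat :=
  match c with
  | Skip => 0
  | Assign x e => size (compile_expr e 32) + 2
  | Store i e1 e2 => size (compile_expr e1 32) + (4 + (size (compile_expr e2 33) + 1))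
  | Seq c1 c2 => code_size c1 + code_size c2
  | If e c1 c2 => size (compile_expr e 32) + (1 + (code_size c1 + (1 + code_size c2)))
  | While e c => size (compile_expr e 32) + (1 + (code_size c + 1))
  | Read x => 1
  | Write e => size (compile_expr e 32) + 1
  end.

Fixpoint compile (c : cmd) (p : nat) : seq instr :=
  match c with
  | Skip => [::]
  | Assign x e => compile_expr e 32 ++ [:: IConst 33 0; IAdd x 32 33]
  | Store i e1 e2 =>
      compile_expr e1 32 ++ address_code i 32 ++ compile_expr e2 33 ++ [:: IStore 32 33]
  | Seq c1 c2 => compile c1 p ++ compile c2 (p + code_size c1)
  | If e c1 c2 =>
      let p1 := p + size (compile_expr e 32) + 1 in
      let p2 := p1 + code_size c1 + 1 in
      compile_expr e 32 ++ [:: IJz 32 p2] ++ compile c1 p1 ++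
        [:: IJmp (p2 + code_size c2)] ++ compile c2 p2
  | While e c =>
      let p1 := p + size (compile_expr e 32) + 1 in
      compile_expr e 32 ++ [:: IJz 32 (p1 + code_size c + 1)] ++ compile c p1 ++ [:: IJmp p]
  | Read x => [:: IRead x]
  | Write e => compile_expr e 32 ++ [:: IWrite 32]
  end.

Fixpoint wf_cmd (c : cmd) : bool :=
  match c with
  | Skip => true
  | Assign x e => (x < 32) && wf_expr e 32
  | Store i e1 e2 => [&& i < 32, wf_expr e1 32 & wf_expr e2 33]
  | Seq c1 c2 => wf_cmd c1 && wf_cmd c2
  | If e c1 c2 => [&& wf_expr e 32, wf_cmd c1 & wf_cmd c2]
  | While e c => wf_expr e 32 && wf_cmd c
  | Read x => x < 30
  | Write e => wf_expr e 32
  end.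

Lemma size_compile c p : size (compile c p) = code_size c.
Proof.
elim: c p => //= [x e|i e1 e2|c1 IH1 c2 IH2|e c1 IH1 c2 IH2|e c IH|e] p;
  by rewrite !size_cat /= ?size_cat /= ?size_cat /= ?IH ?IH1 ?IH2.
Qed.

Section Machine.

Variable P : seq instr.
Hypothesis word_gt : 128 < 2 ^ w.

Definition on_time (c : config) : Prop := due (consumed c) <= size (out c).

Inductive steps : config -> nat -> config -> Prop :=
| StepsRefl c : on_time c -> steps c 0 c
| StepsStep c1 c2 c3 t : on_time c1 -> step w P c1 = Some c2 -> steps c2 t c3 ->
    steps c1 t.+1 c3.

Lemma steps_trans c1 c2 c3 t1 t2 :
  steps c1 t1 c2 -> steps c2 t2 c3 -> steps c1 (t1 + t2) c3.
Proof.
elim=> {c1 c2 t1} [c _|c1 c2 c2' t1 ot st _ IH] //= s23.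
by rewrite addSn; apply: StepsStep ot st (IH s23).
Qed.

Lemma steps1 c c' : on_time c -> on_time c' -> step w P c = Some c' -> steps c 1 c'.
Proof. by move=> ot ot' st; apply: StepsStep ot st (StepsRefl ot'). Qed.

Lemma steps_on_time c t c' : steps c t c' -> on_time c'.
Proof. by elim. Qed.

Lemma steps_run c t c' : steps c t c' ->
  run w P t c = c' /\ forall t', t' <= t -> on_time (run w P t' c).
Proof.
elim=> {c c' t} [c ot|c1 c2 c3 t ot st _ [r IH]]; first by split=> // -[].
have runS t' : run w P t'.+1 c1 = run w P t' c2 by rewrite /run iterSr st.
by split=> [|[//|t'] le_t']; rewrite runS //; apply: IH.
Qed.

Definition code_at (p : nat) (code : seq instr) : Prop :=
  exists pre post, P = pre ++ code ++ post /\ size pre = p.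

Lemma code_at_cat p a b : code_at p (a ++ b) -> code_at p a /\ code_at (p + size a) b.
Proof.
move=> [pre [post [PE <-]]]; split.
  by exists pre, (b ++ post); rewrite PE -!catA.
by exists (pre ++ a), post; rewrite PE -!catA size_cat.
Qed.

Lemma code_at_cons p i b : code_at p (i :: b) -> nth IHalt P p = i /\ code_at p.+1 b.
Proof.
move=> [pre [post [PE <-]]]; split; first by rewrite PE nth_cat ltnn subnn.
by exists (pre ++ [:: i]), post; rewrite PE -!catA size_cat addn1.
Qed.

Definition bounded (m : nat -> nat) : Prop := forall a, m a < 2 ^ w.

Definition agree (t : nat) (m m' : nat -> nat) : Prop :=
  forall a, (a < t) || (64 <= a) -> m' a = m a.

Lemma agree_trans t m1 m2 m3 : agree t m1 m2 -> agree t m2 m3 -> agree t m1 m3.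
Proof. by move=> A1 A2 a a_in; rewrite A2 ?A1. Qed.

Lemma agree_leq t t' m m' : t <= t' -> agree t' m m' -> agree t m m'.
Proof. by move=> le_t A a a_in; apply: A; lia. Qed.

Record represents (s : state) (m : nat -> nat) : Prop := Represents {
  rep_bounded : bounded m;
  rep_var : forall x, x < 32 -> m x = var s x;
  rep_arr : forall i x, i < 32 -> m (64 + 32 * x + i) = arr s i x;
  rep_pending : forall r, r \in pending s -> [/\ r.1.1 < 2 ^ w, r.1.2 < 2 ^ w & r.2 < 2 ^ w] }.

Lemma represents_agree s m m' t : 32 <= t -> bounded m' -> represents s m -> agree t m m' ->
  represents s m'.
Proof.
move=> t32 bm' [_ mV mA mI] A; split=> // [x lx|i x li]; rewrite A;
  [exact: mV | lia | exact: mA | lia].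
Qed.

Lemma bounded_upd m d x : bounded m -> x < 2 ^ w -> bounded (upd m d x).
Proof. by move=> bm lx a; rewrite /upd; case: ifP. Qed.

Definition conf (p : nat) (m : nat -> nat) (s : state) : config :=
  Config p m (pending s) (nread s) (output s).

Lemma eval_binop_lt o x y : x < 2 ^ w -> y < 2 ^ w -> binop_safe o x y ->
  eval_binop o x y < 2 ^ w.
Proof.
case: o => //= lx _ _.
- by apply: leq_ltn_trans (leq_subr _ _) lx.
- by apply: leq_ltn_trans (leq_div _ _) lx.
- by apply: leq_ltn_trans (leq_mod _ _) lx.
- by apply: leq_ltn_trans (land_leql _ _) lx.
- by apply: leq_ltn_trans (leq_b1 _) _; lia.
- by apply: leq_ltn_trans (leq_b1 _) _; lia.
Qed.

Lemma binop_step o d a b p m s : nth IHalt P p = binop_instr o d a b -> bounded m ->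
  binop_safe o (m a) (m b) -> timely s ->
  steps (conf p m s) 1 (conf p.+1 (upd m d (eval_binop o (m a) (m b))) s) /\
  bounded (upd m d (eval_binop o (m a) (m b))).
Proof.
move=> Pp bm sf tm; have lt := eval_binop_lt (bm a) (bm b) sf.
split; last exact: bounded_upd.
apply: steps1 => //; rewrite /step Pp /=.
case: o Pp sf lt => /= _ sf lt; rewrite ?pow_expn; try by rewrite modn_small.
rewrite (modn_small (bm b)) (_ : _ + _ = m a - m b + 2 ^ w); last by have := bm b; lia.
by rewrite modnDr modn_small.
Qed.

Lemma const_step d k p m s : nth IHalt P p = IConst d k -> bounded m -> k < 2 ^ w -> timely s ->
  steps (conf p m s) 1 (conf p.+1 (upd m d k) s) /\ bounded (upd m d k).
Proof.
move=> Pp bm lk tm; split; last exact: bounded_upd.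
by apply: steps1 => //; rewrite /step Pp pow_expn modn_small.
Qed.

Lemma address_steps i t p m s : code_at p (address_code i t) -> bounded m -> timely s ->
  addressable (m t) -> i < 32 ->
  exists m', [/\ steps (conf p m s) 4 (conf (p + 4) m' s), m' t = 64 + 32 * m t + i,
    bounded m' & forall a, a != t -> a != t.+1 -> m' a = m a].
Proof.
rewrite /address_code /addressable => /code_at_cons[P0 /code_at_cons[P1]].
move=> /code_at_cons[P2 /code_at_cons[P3 _]] bm tm ad li.
have neS : (t == t.+1) = false by lia.
have [|S0 b0] := const_step P0 bm _ tm; first lia.
have [|S1 b1] := binop_step (o := Mul) P1 b0 _ tm; first by rewrite /upd /= neS eqxx; lia.
have [|S2 b2] := const_step P2 b1 _ tm; first lia.
have [|S3 b3] := binop_step (o := Add) P3 b2 _ tm; first by rewrite /upd /= neS !eqxx; lia.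
move: S1 b1 S2 b2 S3 b3; rewrite /upd /= !eqxx neS => S1 b1 S2 b2 S3 b3.
eexists; split; first by rewrite addn4; exact: steps_trans S0 (steps_trans S1 (steps_trans S2 S3)).
- by rewrite /= eqxx; lia.
- exact: b3.
- by move=> a /negbTE na /negbTE naS; rewrite /= na naS.
Qed.

Definition evaluates (s : state) (e : expr) : Prop := forall t p m,
  code_at p (compile_expr e t) -> wf_expr e t -> 32 <= t -> represents s m -> safe e s ->
  timely s ->
  exists m', [/\ steps (conf p m s) (size (compile_expr e t))
                   (conf (p + size (compile_expr e t)) m' s),
    m' t = eval e s, bounded m' & agree t m m'].

Lemma agree_upd t m x : 32 <= t < 64 -> agree t m (upd m t x).
Proof. by move=> lt a a_in; rewrite /upd; case: eqP => // ?; lia. Qed.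

Lemma const_evaluates s k : evaluates s (Const k).
Proof.
move=> t p m /code_at_cons[Pp _] /= lt t32 Rm lk tm; exists (upd m t k).
have [S b] := const_step Pp (rep_bounded Rm) lk tm.
rewrite addn1; split=> //; first by rewrite /upd eqxx.
by apply: agree_upd; rewrite t32.
Qed.

Lemma var_evaluates s x : evaluates s (Var x).
Proof.
move=> t p m /code_at_cons[P0 /code_at_cons[P1 _]] /andP[lx lt] t32 Rm _ tm /=.
have [|S0 b0] := const_step P0 (rep_bounded Rm) _ tm; first lia.
have [|S1 b1] := binop_step (o := Add) P1 b0 _ tm.
  by rewrite /upd /= eqxx addn0; case: ifP => _; [lia | exact: rep_bounded Rm _].
exists (upd (upd m t.+1 0) t (eval_binop Add (upd m t.+1 0 x) (upd m t.+1 0 t.+1))).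
split=> //.
- by rewrite addn2; exact: steps_trans S0 S1.
- by rewrite /upd /= !eqxx addn0 (rep_var Rm lx) ifF //; apply/eqP; lia.
- by move=> a a_in; rewrite /upd; do 2![case: eqP => [|_]; first lia].
Qed.

Lemma entry_evaluates s i e : evaluates s e -> evaluates s (Entry i e).
Proof.
move=> IH t p m /code_at_cat[C0 /(code_at_cat (a := address_code i t))[C1 /code_at_cons[P2 _]]].
move=> /and3P[li lt wf] t32 Rm /andP[sf ad] tm.
have [m1 [S1 E1 b1 A1]] := IH _ _ _ C0 wf t32 Rm sf tm.
have [|//|m2 [S2 E2 b2 A2]] := address_steps C1 b1 tm; first by rewrite E1.
have A12 : agree t m m2 by apply: agree_trans A1 _ => a a_in; apply: A2; lia.
have R2 := represents_agree t32 b2 Rm A12.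
have m2t : m2 (m2 t) = arr s i (eval e s) by rewrite E2 E1 (rep_arr R2).
exists (upd m2 t (arr s i (eval e s))); split.
- rewrite !size_cat /= !addnA; apply: steps_trans (steps_trans S1 S2) _.
  by apply: steps1 => //; rewrite /step P2 /= m2t addn1.
- by rewrite /upd eqxx.
- by apply: bounded_upd => //; rewrite -m2t.
- by apply: agree_trans A12 _; apply: agree_upd; lia.
Qed.

Lemma bin_evaluates s o e1 e2 : evaluates s e1 -> evaluates s e2 -> evaluates s (Bin o e1 e2).
Proof.
move=> IH1 IH2 t p m /code_at_cat[C1 /code_at_cat[C2 /code_at_cons[P3 _]]].
move=> /and3P[lt wf1 wf2] t32 Rm /and3P[sf1 sf2 sfo] tm.
have [m1 [S1 E1 b1 A1]] := IH1 _ _ _ C1 wf1 t32 Rm sf1 tm.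
have [|m2 [S2 E2 b2 A2]] := IH2 _ _ _ C2 wf2 _ (represents_agree t32 b1 Rm A1) sf2 tm.
  exact: leqW.
have E1' : m2 t = eval e1 s by rewrite A2 // leqnn.
have [|S3 b3] := binop_step P3 b2 _ tm; first by rewrite E1' E2.
exists (upd m2 t (eval_binop o (m2 t) (m2 t.+1))); split=> //.
- rewrite !size_cat /= !addnA; apply: steps_trans (steps_trans S1 S2) _.
  by rewrite addn1.
- by rewrite /upd eqxx E1' E2.
- apply: agree_trans A1 (agree_trans (agree_leq (leqnSn t) A2) _).
  by apply: agree_upd; lia.
Qed.

Lemma compile_expr_evaluates s e : evaluates s e.
Proof.
by elim: e => *; [exact: const_evaluates | exact: var_evaluates | exact: entry_evaluates |
  exact: bin_evaluates].
Qed.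

Lemma evaluate_then s e t rest p m : code_at p (compile_expr e t ++ rest) -> wf_expr e t ->
  32 <= t -> represents s m -> safe e s -> timely s ->
  exists m', [/\ steps (conf p m s) (size (compile_expr e t))
                   (conf (p + size (compile_expr e t)) m' s),
    m' t = eval e s, represents s m', agree t m m' &
    code_at (p + size (compile_expr e t)) rest].
Proof.
move=> /code_at_cat[C Cr] wf t32 Rm sf tm.
have [m' [S E b A]] := compile_expr_evaluates C wf t32 Rm sf tm.
by exists m'; split=> //; apply: represents_agree A.
Qed.

Definition simulated (c : cmd) (s : state) (tau : nat) (s' : state) : Prop := forall p m,
  code_at p (compile c p) -> wf_cmd c -> represents s m -> timely s ->
  exists t m', [/\ t <= code_size c * tau.+1,
    steps (conf p m s) t (conf (p + code_size c) m' s') & represents s' m'].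

Lemma assign_simulated s x e : safe e s -> simulated (Assign x e) s 0 (set_var s x (eval e s)).
Proof.
move=> sf p m C /andP[lx wf] Rm tm.
have [m1 [S1 E1 R1 _ /code_at_cons[P2 /code_at_cons[P3 _]]]] :=
  evaluate_then C wf (leqnn _) Rm sf tm.
have [|S2 b2] := const_step P2 (rep_bounded R1) _ tm; first lia.
have [|S3 b3] := binop_step (o := Add) P3 b2 _ tm.
  by rewrite /upd /= addn0; apply: rep_bounded R1 _.
exists (size (compile_expr e 32) + (1 + 1)),
  (upd (upd m1 33 0) x (eval_binop Add (upd m1 33 0 32) (upd m1 33 0 33))).
split; first by rewrite muln1.
  rewrite -[code_size _]/(size (compile_expr e 32) + 2) [p + _]addnA addn2.
  exact: steps_trans S1 (steps_trans S2 S3).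
split=> //= [y ly|i y li|]; last exact: rep_pending R1.
  rewrite /upd /= E1 addn0; case: eqP => // _; case: eqP => [|_]; [lia | exact: rep_var R1 _ ly].
by rewrite /upd; do 2![case: eqP => [|_]; first lia]; rewrite (rep_arr R1).
Qed.

Lemma store_simulated s i e1 e2 : safe e1 s -> safe e2 s -> addressable (eval e1 s) ->
  simulated (Store i e1 e2) s 0 (set_entry s i (eval e1 s) (eval e2 s)).
Proof.
move=> sf1 sf2 ad p m C /and3P[li wf1 wf2] Rm tm.
have [m1 [S1 E1 R1 _]] := evaluate_then C wf1 (leqnn _) Rm sf1 tm.
move=> /(code_at_cat (a := address_code i 32))[C2 C3].
have [|//|m2 [S2 E2 b2 A2]] := address_steps C2 (rep_bounded R1) tm; first by rewrite E1.
have R2 : represents s m2.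
  by apply: (@represents_agree s m1 m2 32) => // a a_in; apply: A2; lia.
have [//|m3 [S3 E3 R3 A3 /code_at_cons[P4 _]]] := evaluate_then C3 wf2 _ R2 sf2 tm.
have m3_32 : m3 32 = 64 + 32 * eval e1 s + i by rewrite A3 // E2 E1.
exists (code_size (Store i e1 e2)), (upd m3 (m3 32) (m3 33)); split; first by rewrite muln1.
  rewrite /= !addnA; apply: steps_trans (steps_trans (steps_trans S1 S2) S3) _.
  by apply: steps1 => //; rewrite /step P4 /= addn1.
split=> [|y ly|k y lk|]; last exact: rep_pending R3.
- by apply: bounded_upd (rep_bounded R3) (rep_bounded R3 _).
- by rewrite m3_32 /upd; case: eqP => [|_]; [lia | exact: rep_var R3 _ ly].
rewrite m3_32 E3 /= /upd_array /upd; case: (k =P i) => [->|ne].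
  by rewrite eqn_add2r eqn_add2l eqn_pmul2l // (rep_arr R3).
by case: eqP => [|_]; [lia | rewrite (rep_arr R3)].
Qed.

Lemma seq_simulated s1 s2 s3 t1 t2 c1 c2 : simulated c1 s1 t1 s2 -> simulated c2 s2 t2 s3 ->
  simulated (Seq c1 c2) s1 (t1 + t2) s3.
Proof.
move=> IH1 IH2 p m /code_at_cat[C1 C2] /andP[wf1 wf2] Rm tm; rewrite size_compile in C2.
have [u1 [m1 [l1 S1 R1]]] := IH1 _ _ C1 wf1 Rm tm.
have [u2 [m2 [l2 S2 R2]]] := IH2 _ _ C2 wf2 R1 (steps_on_time S1).
exists (u1 + u2), m2; split=> //; last by rewrite /= addnA; apply: steps_trans S1 S2.
by rewrite /=; nia.
Qed.

Lemma then_simulated s s' t e c1 c2 : safe e s -> eval e s != 0 -> simulated c1 s t s' ->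
  simulated (If e c1 c2) s t s'.
Proof.
move=> sf nz IH p m C /and3P[wf wf1 _] Rm tm.
have [m1 [S1 E1 R1 _ /code_at_cons[P2 /code_at_cat[C3 /code_at_cons[P4 _]]]]] :=
  evaluate_then C wf (leqnn _) Rm sf tm.
rewrite -addn1 in C3 P4; rewrite size_compile in P4.
have [u [m2 [lu S3 R2]]] := IH _ _ C3 wf1 R1 tm.
have tm' := steps_on_time S3.
exists (size (compile_expr e 32) + (1 + (u + 1))), m2; split=> //; first by rewrite /=; nia.
apply: steps_trans S1 (steps_trans (steps1 _ _ _) (steps_trans S3 (steps1 _ _ _))) => //.
  by rewrite /step P2 /= E1 (negbTE nz) addn1.
by rewrite /step P4 /= !addnA.
Qed.

Lemma else_simulated s s' t e c1 c2 : safe e s -> eval e s = 0 -> simulated c2 s t s' ->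
  simulated (If e c1 c2) s t s'.
Proof.
move=> sf z IH p m C /and3P[wf _ wf2] Rm tm.
have [m1 [S1 E1 R1 _ /code_at_cons[P2 /code_at_cat[_ /code_at_cons[_ C4]]]]] :=
  evaluate_then C wf (leqnn _) Rm sf tm.
rewrite -addn1 -addn1 size_compile in C4.
have [u [m2 [lu S3 R2]]] := IH _ _ C4 wf2 R1 tm.
exists (size (compile_expr e 32) + (1 + u)), m2; split=> //; first by rewrite /=; nia.
rewrite !addnA in S3 *; rewrite -addnA; apply: steps_trans S1 (steps_trans (steps1 _ _ _) S3) => //.
by rewrite /step P2 /= E1 z.
Qed.

Lemma exit_simulated s e c : safe e s -> eval e s = 0 -> simulated (While e c) s 0 s.
Proof.
move=> sf z p m C /andP[wf _] Rm tm.
have [m1 [S1 E1 R1 _ /code_at_cons[P2 _]]] := evaluate_then C wf (leqnn _) Rm sf tm.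
exists (size (compile_expr e 32) + 1), m1; split=> //; first by rewrite /=; nia.
apply: steps_trans S1 (steps1 _ _ _) => //.
by rewrite /step P2 /= E1 z !addnA.
Qed.

Lemma loop_simulated s1 s2 s3 t1 t2 e c : safe e s1 -> eval e s1 != 0 ->
  simulated c s1 t1 s2 -> simulated (While e c) s2 t2 s3 ->
  simulated (While e c) s1 (t1 + t2).+1 s3.
Proof.
move=> sf nz IH1 IH2 p m C wfw Rm tm; have /andP[wf wfc] := wfw.
have [m1 [S1 E1 R1 _ /code_at_cons[P2 /code_at_cat[C3 /code_at_cons[P4 _]]]]] :=
  evaluate_then C wf (leqnn _) Rm sf tm.
rewrite -addn1 in C3 P4; rewrite size_compile in P4.
have [u2 [m2 [l2 S3 R2]]] := IH1 _ _ C3 wfc R1 tm.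
have tm2 := steps_on_time S3.
have [u3 [m3 [l3 S5 R3]]] := IH2 p m2 C wfw R2 tm2.
exists (size (compile_expr e 32) + (1 + (u2 + (1 + u3)))), m3; split=> //.
  by move: l2 l3; rewrite /=; nia.
apply: steps_trans S1 (steps_trans (steps1 _ _ _)
  (steps_trans S3 (steps_trans (steps1 _ _ _) S5))) => //.
  by rewrite /step P2 /= E1 (negbTE nz) addn1.
by rewrite /step P4.
Qed.

Lemma read_simulated s x : timely (read_record s x) -> simulated (Read x) s 0 (read_record s x).
Proof.
case: s => v a i c u; rewrite /read_record /=; case Ei: (head end_rec i) => [[x0 y0] z0] tm'.
move=> p m /code_at_cons[Pp _] lx [bm mV mA mI] tm; rewrite /= in lx mV mA mI.
have [l0 l1 l2] : [/\ x0 < 2 ^ w, y0 < 2 ^ w & z0 < 2 ^ w].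
  case: i Ei mI {tm tm'} => [|r i] /= => [[<- <- <-] _|-> mI]; first by split; lia.
  exact: mI _ (mem_head _ _).
exists 1, (upd (upd (upd m x x0) x.+1 y0) x.+2 z0); split=> //.
  by apply: steps1 => //; rewrite /step Pp /= Ei addn1.
split=> [|y ly|k y lk|r r_in] /=.
- by do 3!apply: bounded_upd => //.
- by rewrite /upd; do 3!case: eqP => // _; apply: mV.
- by rewrite /upd; do 3![case: eqP => [|_]; first lia]; apply: mA.
- by apply: mI; apply: mem_behead.
Qed.

Lemma write_simulated s e : safe e s -> simulated (Write e) s 0 (write_answer s (eval e s)).
Proof.
move=> sf p m C wf Rm tm.
have [m1 [S1 E1 [b1 mV mA mI] _ /code_at_cons[P2 _]]] := evaluate_then C wf (leqnn _) Rm sf tm.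
exists (size (compile_expr e 32) + 1), m1; split; [by rewrite muln1 | | by split].
apply: steps_trans S1 (steps1 _ _ _) => //; first by rewrite /on_time /= size_rcons; apply: leqW.
by rewrite /step P2 /= E1 addnA addn1.
Qed.

Lemma skip_simulated s : simulated Skip s 0 s.
Proof. by move=> p m _ _ Rm tm; exists 0, m; rewrite addn0; split=> //; apply: StepsRefl. Qed.

Lemma compile_simulates c s tau s' : exec c s tau s' -> simulated c s tau s'.
Proof.
elim=> *; [exact: skip_simulated | exact: assign_simulated | exact: store_simulated |
  apply: seq_simulated; eassumption | exact: then_simulated | exact: else_simulated |
  exact: exit_simulated | apply: loop_simulated; eassumption | exact: read_simulated |
  exact: write_simulated].
Qed.

End Machine.

Lemma halted_run P t t' c : halted w P (run w P t c) -> t <= t' -> run w P t' c = run w P t c.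
Proof.
rewrite /halted => stop /subnK <-; rewrite /run iterD -/(run w P t c).
by elim: (t' - t) => //= _ ->; case: (step _ _ _) stop.
Qed.

Lemma compile_correct c s tau s' m (P := compile c 0) (c0 := conf 0 m s) :
  128 < 2 ^ w -> wf_cmd c -> exec c s tau s' -> represents s m -> timely s ->
  exists t, [/\ t <= code_size c * tau.+1, halted w P (run w P t c0),
    out (run w P t c0) = output s' & forall t', on_time (run w P t' c0)].
Proof.
move=> word_gt wf X rep tm; have code : code_at P 0 P by exists [::], [::]; rewrite cats0.
have [t [m' [t_le S _]]] := compile_simulates word_gt X code wf rep tm.
have [runE on_time_run] := steps_run S.
have stop : halted w P (run w P t c0) by rewrite runE /halted /step nth_default // size_compile.
exists t; split=> // [|t']; first by rewrite runE.
by case: (leqP t' t) => [/on_time_run//|/ltnW/(halted_run stop)->]; apply: on_time_run.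
Qed.

End Execution.

(** * Frames and cost-counting preconditions *)

Fixpoint assigned (c : cmd) : seq nat :=
  match c with
  | Assign x _ => [:: x]
  | Read x => [:: x; x.+1; x.+2]
  | Seq c1 c2 | If _ c1 c2 => assigned c1 ++ assigned c2
  | While _ c => assigned c
  | _ => [::]
  end.

Fixpoint stored (c : cmd) : seq nat :=
  match c with
  | Store i _ _ => [:: i]
  | Seq c1 c2 | If _ c1 c2 => stored c1 ++ stored c2
  | While _ c => stored c
  | _ => [::]
  end.

Fixpoint reads (c : cmd) : bool :=
  match c with
  | Read _ => true
  | Seq c1 c2 | If _ c1 c2 => reads c1 || reads c2
  | While _ c => reads c
  | _ => false
  end.

Fixpoint writes (c : cmd) : bool :=
  match c with
  | Write _ => true
  | Seq c1 c2 | If _ c1 c2 => writes c1 || writes c2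
  | While _ c => writes c
  | _ => false
  end.

Record unchanged (c : cmd) (s s' : state) : Prop := Unchanged {
  same_var : forall x, x \notin assigned c -> var s' x = var s x;
  same_arr : forall i, i \notin stored c -> arr s' i = arr s i;
  same_input : ~~ reads c -> pending s' = pending s /\ nread s' = nread s;
  same_output : ~~ writes c -> output s' = output s }.

Lemma unchanged_refl c s : unchanged c s s.
Proof. by split. Qed.

Lemma unchanged_trans c s1 s2 s3 : unchanged c s1 s2 -> unchanged c s2 s3 -> unchanged c s1 s3.
Proof.
move=> U V; split=> [x nx|i ni|nr|nw].
- by rewrite (same_var V) ?(same_var U).
- by rewrite (same_arr V) ?(same_arr U).
- by have [-> ->] := same_input V nr; apply: same_input U nr.
- by rewrite (same_output V) ?(same_output U).
Qed.

Lemma unchanged_sub c c' s s' : {subset assigned c <= assigned c'} ->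
  {subset stored c <= stored c'} -> (reads c -> reads c') -> (writes c -> writes c') ->
  unchanged c s s' -> unchanged c' s s'.
Proof.
move=> sA sS sR sW [uA uS uR uW].
split=> [x nx|i ni|nr|nw];
  [apply: uA | apply: uS | apply: uR | apply: uW];
  by [apply: contra nx => /sA | apply: contra ni => /sS | apply: contra nr | apply: contra nw].
Qed.

Lemma unchanged_seql c1 c2 s s' : unchanged c1 s s' -> unchanged (Seq c1 c2) s s'.
Proof.
by apply: unchanged_sub => [x|i| |] /=; rewrite ?mem_cat => ->.
Qed.

Lemma unchanged_seqr c1 c2 s s' : unchanged c2 s s' -> unchanged (Seq c1 c2) s s'.
Proof.
by apply: unchanged_sub => [x|i| |] /=; rewrite ?mem_cat => ->; rewrite orbT.
Qed.

Lemma unchanged_seq c1 c2 s1 s2 s3 : unchanged c1 s1 s2 -> unchanged c2 s2 s3 ->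
  unchanged (Seq c1 c2) s1 s3.
Proof. by move=> /(unchanged_seql c2) U1 /(unchanged_seqr c1); apply: unchanged_trans. Qed.

Lemma unchanged_while e c s s' : unchanged c s s' -> unchanged (While e c) s s'.
Proof. exact: unchanged_sub. Qed.

Lemma unchanged_assign x e s y : unchanged (Assign x e) s (set_var s x y).
Proof. by split=> // z; rewrite /= inE /upd => /negbTE->. Qed.

Lemma unchanged_assign_seq x e y c s s' : unchanged c (set_var s x y) s' ->
  unchanged (Seq (Assign x e) c) s s'.
Proof. exact: unchanged_seq (unchanged_assign x e s y). Qed.

Lemma unchanged_store i e1 e2 s x y : unchanged (Store i e1 e2) s (set_entry s i x y).
Proof. by split=> // j; rewrite /= inE /upd_array => /negbTE->. Qed.

Lemma unchanged_read x s : unchanged (Read x) s (read_record s x).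
Proof.
rewrite /read_record; case: (head _ _) => [[a b] c]; split=> // y /=.
by rewrite !inE !negb_or /upd => /and3P[/negbTE-> /negbTE-> /negbTE->].
Qed.

Lemma unchanged_write e s y : unchanged (Write e) s (write_answer s y).
Proof. by split. Qed.

Section Preconditions.

Variables (w : nat) (due : nat -> nat).
Local Notation exec := (exec w due).
Local Notation safe := (safe w).

Lemma exec_unchanged c s t s' : exec c s t s' -> unchanged c s s'.
Proof.
elim=> {c s t s'} [s|s x e _|s i e1 e2 _ _ _|s1 s2 s3 t1 t2 c1 c2 _ U1 _ U2|
  s s' t e c1 c2 _ _ _ U|s s' t e c1 c2 _ _ _ U|s e c _ _|s1 s2 s3 t1 t2 e c _ _ _ U1 _ U2|
  s x _|s e _]; try exact: unchanged_refl.
- exact: unchanged_assign.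
- exact: unchanged_store.
- exact: unchanged_seq U1 U2.
- by apply: unchanged_sub U => [x|i| |] /=; rewrite ?mem_cat => ->.
- by apply: unchanged_sub U => [x|i| |] /=; rewrite ?mem_cat => ->; rewrite orbT.
- exact: unchanged_trans (unchanged_while e U1) U2.
- exact: unchanged_read.
- exact: unchanged_write.
Qed.

Definition wp (c : cmd) (s : state) (T : nat) (Q : state -> Prop) : Prop :=
  exists t s', [/\ t <= T, exec c s t s' & Q s'].

Lemma wp_mono c s T T' (Q Q' : state -> Prop) : wp c s T Q -> T <= T' ->
  (forall s', unchanged c s s' -> Q s' -> Q' s') -> wp c s T' Q'.
Proof.
move=> [t [s' [lt X Qs]]] lT QQ'; exists t, s'; split=> //; first exact: leq_trans lT.
by apply: QQ' Qs; apply: exec_unchanged X.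
Qed.

Lemma wp_seq c1 c2 s T1 T2 Q :
  wp c1 s T1 (fun s' => wp c2 s' T2 Q) -> wp (Seq c1 c2) s (T1 + T2) Q.
Proof.
move=> [t1 [s1 [l1 X1 [t2 [s2 [l2 X2 Qs]]]]]].
by exists (t1 + t2), s2; split; [exact: leq_add | exact: ExecSeq X1 X2 |].
Qed.

Lemma wp_then c1 c2 s T1 T2 (Q1 Q : state -> Prop) : wp c1 s T1 Q1 ->
  (forall s', unchanged c1 s s' -> Q1 s' -> wp c2 s' T2 Q) -> wp (Seq c1 c2) s (T1 + T2) Q.
Proof. by move=> X1 X2; apply: wp_seq; apply: wp_mono X1 (leqnn _) X2. Qed.

Lemma wp_then0 c1 c2 s T (Q1 Q : state -> Prop) : wp c1 s 0 Q1 ->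
  (forall s', unchanged c1 s s' -> Q1 s' -> wp c2 s' T Q) -> wp (Seq c1 c2) s T Q.
Proof. exact: wp_then. Qed.

Lemma wp_seq0 c1 c2 s T Q :
  wp c1 s 0 (fun s' => wp c2 s' T Q) -> wp (Seq c1 c2) s T Q.
Proof. exact: wp_seq. Qed.

Lemma wp_skip s T (Q : state -> Prop) : Q s -> wp Skip s T Q.
Proof. by move=> Qs; exists 0, s; split=> //; apply: ExecSkip. Qed.

Lemma wp_assign s x e v T (Q : state -> Prop) :
  safe e s -> eval e s = v -> Q (set_var s x v) -> wp (Assign x e) s T Q.
Proof. by move=> sf <- Qs; eexists 0, _; split; [| exact: ExecAssign |]. Qed.

Lemma wp_store s i e1 e2 a v T (Q : state -> Prop) :
  [&& safe e1 s, safe e2 s & addressable w a] -> eval e1 s = a -> eval e2 s = v ->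
  Q (set_entry s i a v) -> wp (Store i e1 e2) s T Q.
Proof.
by move=> /and3P[sf1 sf2 ad] E1 E2 Qs; subst a v; eexists 0, _; split; [| exact: ExecStore |].
Qed.

Lemma wp_if s e (b : bool) c1 c2 T Q : safe e s -> (eval e s != 0) = b ->
  (b -> wp c1 s T Q) -> (~~ b -> wp c2 s T Q) -> wp (If e c1 c2) s T Q.
Proof.
move=> sf <- wp1 wp2; case: (eval e s =P 0) wp1 wp2 => [E _|/eqP E] /=.
  by move=> /(_ isT)[t [s' [lt X Qs]]]; exists t, s'; split=> //; apply: ExecElse.
by move=> /(_ isT)[t [s' [lt X Qs]]] _; exists t, s'; split=> //; apply: ExecThen.
Qed.

Lemma wp_read s x T (Q : state -> Prop) :
  timely due (read_record s x) -> Q (read_record s x) -> wp (Read x) s T Q.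
Proof. by move=> tm Qs; eexists 0, _; split; [| exact: ExecRead |]. Qed.

Lemma wp_write s e T (Q : state -> Prop) :
  safe e s -> Q (write_answer s (eval e s)) -> wp (Write e) s T Q.
Proof. by move=> sf Qs; eexists 0, _; split; [| exact: ExecWrite |]. Qed.

(* The invariant carries the remaining iteration budget. *)
Lemma wp_while (Inv : nat -> state -> Prop) e c s0 (Q : state -> Prop) :
  (forall k s, unchanged (While e c) s0 s -> Inv k s -> [/\ safe e s, eval e s = 0 -> Q s &
     eval e s != 0 -> exists t, wp c s t (fun s' => exists k', k' + t < k /\ Inv k' s')]) ->
  forall k, Inv k s0 -> wp (While e c) s0 k Q.
Proof.
move=> step; suff main k s : unchanged (While e c) s0 s -> Inv k s -> wp (While e c) s k Q.
  by move=> k; apply: main; apply: unchanged_refl.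
elim/ltn_ind: k s => k IH s U Is; have [sf exit loop] := step _ _ U Is.
case: (eval e s =P 0) => [E|/eqP E].
  by exists 0, s; split=> //; [apply: ExecExit | apply: exit].
have [t [t1 [s1 [l1 X1 [k' [lk Ik']]]]]] := loop E.
have U1 := unchanged_trans U (unchanged_while e (exec_unchanged X1)).
have [|t2 [s2 [l2 X2 Q2]]] := IH k' _ s1 U1 Ik'; first by apply: leq_ltn_trans lk; apply: leq_addr.
exists (t1 + t2).+1, s2; split=> //; last exact: ExecLoop X1 X2.
by apply: leq_trans lk; rewrite ltnS addnC leq_add.
Qed.

End Preconditions.

Arguments wp_assign {w due s x e v T Q}.
Arguments wp_store {w due s i e1 e2 a v T Q}.
Arguments wp_if {w due s e b c1 c2 T Q}.

Declare Scope expr_scope.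
Delimit Scope expr_scope with X.
Bind Scope expr_scope with expr.
Notation "$ x" := (Var x) (at level 1, x at level 0, format "$ x") : expr_scope.
Notation "# k" := (Const k) (at level 1, k at level 0, format "# k") : expr_scope.
Notation "a + b" := (Bin Add a b) : expr_scope.
Notation "a - b" := (Bin Sub a b) : expr_scope.
Notation "a * b" := (Bin Mul a b) : expr_scope.
Notation "a %/ b" := (Bin Div a b) : expr_scope.
Notation "a %% b" := (Bin Mod a b) : expr_scope.
Notation "a < b" := (Bin Lt a b) : expr_scope.
Notation "a == b" := (Bin Eq a b) : expr_scope.
Notation "a && b" := (Bin And a b) : expr_scope.
Notation "a <<< b" := (Bin Shl a b) (at level 47) : expr_scope.
Notation "i '.[|' e ']'" := (Entry i e) (at level 2, format "i .[| e ]") : expr_scope.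
Notation "x <-- e" := (Assign x e) (at level 55).
Notation "i '.[=' e1 ']' '<--' e2" := (Store i e1 e2) (at level 55, e1 at level 50).
Notation "c1 ;; c2" := (Seq c1 c2) (at level 60, right associativity).

Definition For (i a n : nat) (c : cmd) : cmd :=
  i <-- #a;; While ($i < $n) (c;; i <-- ($i + #1)).

Ltac eval_simpl := rewrite /= /addressable /upd_array /upd /=.

Section Loops.

Variables (w : nat) (due : nat -> nat) (i a n m : nat) (c : cmd) (s0 : state).
Local Notation wp := (wp w due).
Variables (Inv : nat -> state -> Prop) (Phi : nat -> state -> nat).

Hypotheses (i_notin : i \notin assigned c) (n_notin : n \notin i :: assigned c).
Hypotheses (n_var : var s0 n = m) (a_le : a <= m) (m_lt : m < 2 ^ w).
Hypothesis Inv_set : forall k s x, Inv k s -> Inv k (set_var s i x).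

Lemma wp_for_amortized T : m - a + Phi a s0 <= T ->
  (forall k s x, Phi k (set_var s i x) = Phi k s) -> Inv a s0 ->
  (forall k s, unchanged (For i a n c) s0 s -> var s i = k -> a <= k < m -> Inv k s ->
     exists t, wp c s t (fun s' => Inv k.+1 s' /\ t + Phi k.+1 s' <= Phi k s)) ->
  wp (For i a n c) s0 T (Inv m).
Proof.
move=> T_ge Phi_set Inv0 body.
apply: wp_seq0; apply: (wp_assign (v := a)) => //; first exact: leq_ltn_trans m_lt.
have n_i : n != i by move: n_notin; rewrite inE negb_or => /andP[].
pose J B s := exists k, [/\ a <= k <= m, var s i = k, Inv k s & m - k + Phi k s <= B].
apply: (wp_while (Inv := J)) => [B s U [k [/andP[ak km] sk Is BE]]|]; last first.
  exists a; split; [by rewrite leqnn | by rewrite /= /upd eqxx | exact: Inv_set |].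
  by rewrite Phi_set.
have U0 : unchanged (For i a n c) s0 s := unchanged_assign_seq _ U.
have sn : var s n = m.
  by rewrite (same_var U0) //= inE mem_cat inE (negbTE n_i) orbF;
    move: n_notin; rewrite inE negb_or => /andP[].
split=> //=; rewrite sk sn; case: ltnP => // km' _.
  by rewrite (_ : m = k) //; apply/eqP; rewrite eqn_leq km'.
have [|t X] := body k s U0 sk _ Is; first by rewrite ak.
exists t; rewrite -[t]addn0; apply: wp_then X _ => s1 U1 [Is1 tPhi].
have s1i : var s1 i = k by rewrite (same_var U1).
apply: (wp_assign (v := k.+1)) => /=; rewrite ?s1i ?addn1 //; first by move: m_lt km'; lia.
exists (m - k.+1 + Phi k.+1 s1); split; first by move: BE; lia.
exists k.+1; split; [lia | by rewrite /= /upd eqxx | exact: Inv_set | by rewrite Phi_set].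
Qed.

End Loops.

Lemma wp_for w due i a n m c s0 (Inv : nat -> state -> Prop) T :
  i \notin assigned c -> n \notin i :: assigned c -> var s0 n = m -> a <= m -> m < 2 ^ w ->
  (forall k s x, Inv k s -> Inv k (set_var s i x)) -> m - a <= T -> Inv a s0 ->
  (forall k s, unchanged (For i a n c) s0 s -> var s i = k -> a <= k < m -> Inv k s ->
     wp w due c s 0 (Inv k.+1)) ->
  wp w due (For i a n c) s0 T (Inv m).
Proof.
move=> hi hn hm ha hw Inv_set hT Inv0 body.
apply: (wp_for_amortized (m := m) (Phi := fun _ _ => 0)); rewrite ?addn0 // => k s U si lk Is.
by exists 0; apply: wp_mono (body k s U si lk Is) (leqnn _) _.
Qed.

(** * Bit masks *)

Definition mask (m : nat) (f : nat -> bool) : nat := \sum_(i < m) f i * 2 ^ i.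

Definition top (m : nat) (f : nat -> bool) : nat := \max_(i < m | f i) i.+1.

Section Masks.

Implicit Types f g h : nat -> bool.

Lemma maskS m f : mask m.+1 f = mask m f + f m * 2 ^ m.
Proof. by rewrite /mask big_ord_recr. Qed.

Lemma mask_recl m f : mask m.+1 f = f 0 + 2 * mask m (fun i => f i.+1).
Proof.
rewrite /mask big_ord_recl muln1 big_distrr /=; congr (_ + _).
by apply: eq_bigr => i _; rewrite /bump expnS mulnCA.
Qed.

Lemma mask_lt m f : mask m f < 2 ^ m.
Proof.
elim: m => [|m IH]; first by rewrite /mask big_ord0.
by rewrite maskS expnS; case: (f m); lia.
Qed.

Lemma eq_mask m f g : (forall i, i < m -> f i = g i) -> mask m f = mask m g.
Proof. by move=> fg; apply: eq_bigr => i _; rewrite fg. Qed.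

Lemma mask0 m f : (forall i, i < m -> f i = false) -> mask m f = 0.
Proof. by move=> f0; apply: big1 => i _; rewrite f0. Qed.

Lemma maskT m : mask m xpredT = 2 ^ m - 1.
Proof.
elim: m => [|m IH]; first by rewrite /mask big_ord0.
by rewrite maskS IH expnS; have := expn_gt0 2 m; lia.
Qed.

Lemma maskID m f g : mask m f = mask m (fun i => f i && g i) + mask m (fun i => f i && ~~ g i).
Proof.
by rewrite /mask -big_split; apply: eq_bigr => i _ /=; case: (f i); case: (g i); rewrite ?addn0.
Qed.

Lemma mask1 m i : i < m -> mask m (fun j => j == i) = 2 ^ i.
Proof.
move=> li; rewrite /mask (bigD1 (Ordinal li)) //= eqxx mul1n big1 ?addn0 // => j.
by rewrite -val_eqE => /negbTE /= ->.
Qed.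

Lemma mask_set m f i : i < m -> f i = false ->
  mask m f + 2 ^ i = mask m (fun j => f j || (j == i)).
Proof.
move=> li fi; rewrite -(mask1 li) /mask -big_split; apply: eq_bigr => j _ /=.
by case: eqP => [->|_]; rewrite ?fi ?orbF ?mul0n ?addn0.
Qed.

Lemma mask_lo m f j : j <= m -> mask m (fun i => f i && (i < j)) = mask j f.
Proof.
elim: m => [|m IH]; first by case: j => // _; rewrite /mask !big_ord0.
rewrite leq_eqVlt => /orP[/eqP->|lj]; first by apply: eq_mask => i ->; rewrite andbT.
by rewrite maskS IH // ltnNge -ltnS lj andbF addn0.
Qed.

Lemma mask_mod m f j : j <= m -> mask m f %% 2 ^ j = mask j f.
Proof.
elim: m => [|m IH]; first by case: j => // _; rewrite modn_small // mask_lt.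
rewrite leq_eqVlt => /orP[/eqP->|lj]; first by rewrite modn_small ?mask_lt.
have -> : mask m.+1 f = f m * 2 ^ (m - j) * 2 ^ j + mask m f.
  by rewrite maskS addnC -mulnA -expnD subnK.
by rewrite modnMDl IH.
Qed.

Lemma leq_mask f i j : i <= j -> mask i f <= mask j f.
Proof. by move=> ij; rewrite -(mask_mod f ij) leq_mod. Qed.

Lemma mask_range m f i j : i <= j <= m ->
  mask j f - mask i f = mask m (fun o => f o && (i <= o < j)).
Proof.
move=> /andP[ij jm]; rewrite -(mask_lo f jm) (maskID _ _ (fun o => i <= o)).
have -> : mask m (fun o => (f o && (o < j)) && ~~ (i <= o)) = mask i f.
  rewrite -(mask_lo f (leq_trans ij jm)); apply: eq_mask => o _.
  by rewrite -ltnNge -andbA; congr (_ && _); lia.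
by rewrite addnK; apply: eq_mask => o _; rewrite -andbA [(i <= o) && _]andbC.
Qed.

Lemma mask_bit m f i : i < m -> (mask m f %/ 2 ^ i) %% 2 = f i.
Proof.
move=> li; rewrite modn_divl -expnS mask_mod // maskS addnC divnMDl ?expn_gt0 //.
by rewrite divn_small ?mask_lt // addn0.
Qed.

Lemma mask_half m f : mask m.+1 f %/ 2 = mask m (fun i => f i.+1).
Proof. by rewrite mask_recl; case: (f 0); lia. Qed.

Lemma mask_odd m f : mask m.+1 f %% 2 = f 0.
Proof. by rewrite mask_recl; case: (f 0); lia. Qed.

Lemma mask_land m f g : Nat.land (mask m f) (mask m g) = mask m (fun i => f i && g i).
Proof.
elim: m f g => [|m IH] f g; first by rewrite /mask !big_ord0.
rewrite !mask_recl -IH; set a := mask m _; set b := mask m _.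
have b2 (p : bool) x : p + 2 * x = (2 * x + PeanoNat.Nat.b2n p)%coq_nat by case: p => /=; lia.
apply: PeanoNat.Nat.bits_inj => -[|i]; rewrite PeanoNat.Nat.land_spec !b2.
  by rewrite !PeanoNat.Nat.testbit_0_r.
by rewrite !PeanoNat.Nat.testbit_succ_r PeanoNat.Nat.land_spec.
Qed.

Lemma top_le m f : top m f <= m.
Proof. by apply/bigmax_leqP => i _. Qed.

Lemma topS m f : top m.+1 f = if f m then m.+1 else top m f.
Proof.
rewrite /top big_mkcond big_ord_recr -big_mkcond /=; case: (f m); last by rewrite maxn0.
by apply/maxn_idPr/(leq_trans (top_le m f)).
Qed.

Lemma top_eq0 m f i : top m f = 0 -> i < m -> f i = false.
Proof.
move=> t0 li; apply/negP => fi; have /eqP := t0; rewrite -leqn0.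
by move/bigmax_leqP => /(_ (Ordinal li) fi).
Qed.

Lemma top0 m f : (forall i, i < m -> f i = false) -> top m f = 0.
Proof. by move=> f0; rewrite /top big_pred0 // => i; apply: f0. Qed.

Lemma top_gt0 m f i : i < m -> f i -> 0 < top m f.
Proof. by move=> li fi; rewrite lt0n; apply: contraTneq fi => /top_eq0->. Qed.

Lemma topP m f i : top m f = i.+1 <->
  [/\ i < m, f i & forall j, i < j < m -> f j = false].
Proof.
elim: m => [|m IH]; first by rewrite /top big_ord0; split=> [|[]].
rewrite topS; case fm: (f m); split.
- by case=> <-; split=> // j; lia.
- case=> li fi f0; congr _.+1; apply/eqP; rewrite eqn_leq -[i <= m]ltnS li andbT leqNgt.
  by apply/negP => im; move: fm; rewrite f0 // im /=.
- move=> /IH[li fi f0]; split=> // [|j]; first exact: ltnW.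
  by case: (j =P m) => [->//|ne lj]; apply: f0; lia.
- case=> li fi f0; apply/IH; split=> // [|j lj]; last by apply: f0; lia.
  by rewrite ltn_neqAle -ltnS li andbT; apply: contraTneq fi => ->; rewrite fm.
Qed.

Lemma mask_eq0 m f : (mask m f == 0) = (top m f == 0).
Proof.
elim: m => [|m IH]; first by rewrite /mask /top !big_ord0.
rewrite maskS topS; case: (f m); last by rewrite addn0.
by rewrite mul1n addn_eq0 expn_eq0 andbF.
Qed.

Lemma top_recl m f : top m.+1 f = if top m (fun i => f i.+1) is i.+1 then i.+2 else f 0.
Proof.
elim: m => [|m IH]; first by rewrite topS /top !big_ord0; case: (f 0).
by rewrite topS IH topS; case: (f m.+1).
Qed.

Definition top_table (K : nat) (t : nat -> nat) : Prop :=
  t 0 = 0 /\ forall i, 0 < i < 2 ^ K -> t i = (t (i %/ 2)).+1.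

Definition pop_table (K : nat) (t : nat -> nat) : Prop :=
  t 0 = 0 /\ forall i, 0 < i < 2 ^ K -> t i = t (i %/ 2) + i %% 2.

Lemma mask_lt_table K m f : m <= K -> mask m f < 2 ^ K.
Proof. by move=> mK; apply: leq_trans (mask_lt m f) _; rewrite leq_exp2l. Qed.

Lemma top_table_mask K t m f : top_table K t -> m <= K -> t (mask m f) = top m f.
Proof.
case=> t0 tS; elim: m f => [|m IH] f lm; first by rewrite /mask /top !big_ord0.
rewrite top_recl; case: (posnP (mask m.+1 f)) => [z|p].
  have := mask_half m f; have := mask_odd m f; rewrite z t0 div0n mod0n => <- z'.
  by rewrite -IH ?(ltnW lm) // -z' t0.
rewrite tS ?p ?mask_lt_table // mask_half IH ?(ltnW lm) //.
case E: (top m _) => //; move: p; rewrite mask_recl mask0 => [|i li]; last exact: top_eq0 E li.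
by case: (f 0).
Qed.

Lemma pop_table_mask K t m f : pop_table K t -> m <= K -> t (mask m f) = \sum_(i < m) f i.
Proof.
case=> t0 tS; elim: m f => [|m IH] f lm; first by rewrite /mask !big_ord0.
rewrite big_ord_recl -(IH (fun i => f i.+1)) ?(ltnW lm) // -mask_half.
case: (posnP (mask m.+1 f)) => [z|p].
  by have := mask_odd m f; rewrite z div0n mod0n t0 => <-.
by rewrite tS ?p ?mask_lt_table // mask_odd addnC.
Qed.

End Masks.

(** * Doubly linked rings *)

Definition linked (nx pv : nat -> nat) (a b : nat) : bool := (nx a == b) && (pv b == a).

Definition ring (nx pv : nat -> nat) (s : seq nat) : bool := cycle (linked nx pv) s.

Definition insert_next (nx : nat -> nat) (a b : nat) := upd (upd nx a b) b (nx a).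

Definition insert_prev (nx pv : nat -> nat) (a b : nat) := upd (upd pv b a) (nx a) b.

Definition cut_next (nx pv : nat -> nat) (a b : nat) := upd (upd nx (pv a) (nx b)) b a.

Definition cut_prev (nx pv : nat -> nat) (a b : nat) := upd (upd pv (nx b) (pv a)) a b.

Lemma path_linked_eq nx pv nx' pv' a s :
  {in belast a s, nx' =1 nx} -> {in s, pv' =1 pv} ->
  path (linked nx' pv') a s = path (linked nx pv) a s.
Proof.
elim: s a => //= b s IH a Enx Epv.
rewrite /linked Enx ?mem_head // Epv ?mem_head // -/(linked _ _ _ _); congr (_ && _).
by apply: IH => c cs; [apply: Enx | apply: Epv]; rewrite inE cs orbT.
Qed.

Lemma ring_eq nx pv nx' pv' s : {in s, nx' =1 nx} -> {in s, pv' =1 pv} ->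
  ring nx' pv' s = ring nx pv s.
Proof.
case: s => // a s Enx Epv; apply: path_linked_eq => c.
  by rewrite belast_rcons; apply: Enx.
by rewrite mem_rcons; apply: Epv.
Qed.

Lemma ring_catC nx pv s1 s2 : ring nx pv (s1 ++ s2) = ring nx pv (s2 ++ s1).
Proof. by rewrite /ring -(rot_cycle (size s1)) rot_size_cat. Qed.

Lemma ring_mem nx pv s a : ring nx pv s -> a \in s -> nx a \in s /\ pv a \in s.
Proof.
move=> r sa; have /andP[/eqP-> _] := next_cycle r sa; have /andP[_ /eqP->] := prev_cycle r sa.
by rewrite mem_next mem_prev.
Qed.

Lemma ring_nth nx pv s i : ring nx pv s -> i.+1 < size s ->
  nx (nth 0 s i) = nth 0 s i.+1 /\ pv (nth 0 s i.+1) = nth 0 s i.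
Proof.
case: s => // a s; rewrite /ring /= rcons_path => /andP[/(pathP 0) P _] lt.
by have /andP[/eqP-> /eqP->] := P i lt.
Qed.

Lemma ringP nx pv s : (forall i, i < size s ->
    nx (nth 0 s i) = nth 0 s (i.+1 %% size s) /\ pv (nth 0 s (i.+1 %% size s)) = nth 0 s i) ->
  ring nx pv s.
Proof.
case: s => // a s links; apply/(pathP 0) => i; rewrite size_rcons => li.
have [nxE pvE] := links i li.
have E1 : nth 0 (rcons s a) i = nth 0 (a :: s) (i.+1 %% size (a :: s)).
  rewrite nth_rcons /=; move: li; rewrite ltnS leq_eqVlt => /orP[/eqP->|li].
    by rewrite ltnn eqxx modnn.
  by rewrite li modn_small.
have E0 : nth 0 (a :: rcons s a) i = nth 0 (a :: s) i by rewrite -rcons_cons nth_rcons /= li.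
by rewrite E1 E0 /linked nxE pvE !eqxx.
Qed.

Lemma uniq_last_notin_belast (a : nat) s : uniq (a :: s) -> last a s \notin belast a s.
Proof. by rewrite lastI rcons_uniq => /andP[]. Qed.

Lemma ring_insert_head nx pv a s b : ring nx pv (a :: s) -> uniq (a :: s) -> b \notin a :: s ->
  ring (insert_next nx a b) (insert_prev nx pv a b) (a :: b :: s).
Proof.
rewrite /ring [uniq _]/= -rcons_uniq -mem_rcons /=.
case E: (rcons s a) => [|o t] /=; first by case: (s) E.
have aE : last o t = a by rewrite -(last_cons a) -E last_rcons.
move=> /andP[/andP[/eqP na _] lkd] uot bot.
have notb c : c \in o :: t -> (c == b) = false by move=> co; apply: contraNF bot => /eqP <-.
have ab : (a == b) = false by rewrite -aE notb ?mem_last.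
have ob : (o == b) = false by rewrite notb ?mem_head.
rewrite {1 2}/linked /insert_next /insert_prev /upd na ab (eq_sym b) ob !eqxx /=.
apply: etrans lkd; apply: path_linked_eq => c ct.
  rewrite notb ?(mem_belast ct) //; case: eqP => // ca.
  by have := uniq_last_notin_belast uot; rewrite aE -ca ct.
rewrite notb ?inE ?ct ?orbT //; case: eqP => // co.
by move: uot; rewrite /= -co ct.
Qed.

Lemma ring_insert nx pv s1 s2 a b : ring nx pv (s1 ++ a :: s2) ->
  uniq (s1 ++ a :: s2) -> b \notin s1 ++ a :: s2 ->
  ring (insert_next nx a b) (insert_prev nx pv a b) (s1 ++ a :: b :: s2).
Proof.
rewrite ![ring _ _ (s1 ++ _)]ring_catC uniq_catC mem_cat orbC -mem_cat.
exact: ring_insert_head.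
Qed.

Lemma ring_insert_other nx pv t a b : {in t, forall c, c \notin [:: a; b; nx a]} ->
  ring (insert_next nx a b) (insert_prev nx pv a b) t = ring nx pv t.
Proof.
move=> nt; apply: ring_eq => c /nt; rewrite !inE !negb_or =>
  /and3P[/negbTE na /negbTE nb /negbTE nn];
  by rewrite /insert_next /insert_prev /upd ?na ?nb ?nn.
Qed.

Lemma ring_close_segment nx pv nx' pv' x1 a x2 b :
  ring nx pv ((x1 :: a) ++ x2 :: b) -> uniq ((x1 :: a) ++ x2 :: b) ->
  (forall c, c != last x1 a -> c != last x2 b -> nx' c = nx c) ->
  (forall c, c != x1 -> c != x2 -> pv' c = pv c) ->
  linked nx' pv' (last x1 a) x1 -> ring nx' pv' (x1 :: a).
Proof.
rewrite cat_uniq /ring /= rcons_cat cat_path => /andP[Pa _] /and3P[ua].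
rewrite -[_ || _]/(has (mem (x1 :: a)) (x2 :: b)) => /hasPn dab _.
move=> nxE pvE link; rewrite rcons_path link andbT; apply: etrans Pa.
apply: path_linked_eq => c ca.
  apply: nxE; first by apply: contraTneq ca => ->; apply: uniq_last_notin_belast.
  by apply: contraTneq (mem_belast ca) => ->; apply: dab; apply: mem_last.
apply: pvE; first by apply: contraTneq ca => ->; case/andP: ua.
apply: contraTneq ca => ->; have := dab x2 (mem_head _ _).
by rewrite inE negb_or => /andP[].
Qed.

Lemma ring_cut nx pv x1 a x2 b : ring nx pv ((x1 :: a) ++ x2 :: b) ->
  uniq ((x1 :: a) ++ x2 :: b) ->
  [/\ pv x1 = last x2 b, nx (last x1 a) = x2,
      ring (cut_next nx pv x1 (last x1 a)) (cut_prev nx pv x1 (last x1 a)) (x1 :: a) &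
      ring (cut_next nx pv x1 (last x1 a)) (cut_prev nx pv x1 (last x1 a)) (x2 :: b)].
Proof.
move=> r u; have [nxE pvE] : nx (last x1 a) = x2 /\ pv x1 = last x2 b.
  move: (r); rewrite /ring /= rcons_cat cat_path /= rcons_path.
  by move=> /and4P[_ /andP[/eqP-> _] _ /andP[_ /eqP->]].
have [ne nel] : x1 != x2 /\ last x1 a != last x2 b.
  move: u; rewrite cat_uniq => /and3P[_ /hasPn d _]; split.
    by apply: contraNneq (d x2 (mem_head _ _)) => <-; apply: mem_head.
  by apply: contraNneq (d _ (mem_last _ _)) => <-; apply: mem_last.
split=> //; rewrite /cut_next /cut_prev nxE pvE.
  apply: (ring_close_segment r u) => [c n1 n2|c n1 n2|].
  - by rewrite /upd (negbTE n1) (negbTE n2).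
  - by rewrite /upd (negbTE n1) (negbTE n2).
  - by rewrite /linked /upd !eqxx.
rewrite ring_catC in r; rewrite uniq_catC in u.
apply: (ring_close_segment r u) => [c n1 n2|c n1 n2|].
- by rewrite /upd (negbTE n1) (negbTE n2).
- by rewrite /upd (negbTE n1) (negbTE n2).
- by rewrite /linked /upd (eq_sym (last x2 b)) (negbTE nel) (eq_sym x2) (negbTE ne) !eqxx.
Qed.

Lemma ring_cut_other nx pv t a b : {in t, forall c, c \notin [:: a; b; pv a; nx b]} ->
  ring (cut_next nx pv a b) (cut_prev nx pv a b) t = ring nx pv t.
Proof.
move=> nt; apply: ring_eq => c /nt; rewrite !inE !negb_or;
  move=> /and4P[/negbTE na /negbTE nb /negbTE np /negbTE nn];
  by rewrite /cut_next /cut_prev /upd ?na ?nb ?np ?nn.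
Qed.

Definition cyclic_sorted (s : seq nat) : Prop := exists n, sorted ltn (rot n s).

Lemma ring_sorted nx pv s t : ring nx pv s -> cyclic_sorted s -> sorted ltn t -> t =i s ->
  ring nx pv t.
Proof.
move=> r [n srt] srt_t ts; suff -> : t = rot n s by rewrite /ring rot_cycle.
by apply: irr_sorted_eq ltn_trans ltnn _ _ srt_t srt _ => k; rewrite mem_rot.
Qed.

Lemma sorted_split s a : sorted ltn s ->
  s = [seq y <- s | y < a] ++ [seq y <- s | a <= y].
Proof.
move=> srt; apply: (irr_sorted_eq ltn_trans ltnn) => [//||k]; last first.
  by rewrite mem_cat !mem_filter -andb_orl [a <= k]leqNgt orbN.
rewrite (sorted_pairwise ltn_trans) pairwise_cat -!(sorted_pairwise ltn_trans).
rewrite !(sorted_filter ltn_trans _ srt) !andbT.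
by apply/allrelP => u v; rewrite !mem_filter => /andP[ua _] /andP[av _]; apply: leq_trans ua av.
Qed.

Definition range_part (lo hi : nat) (s : seq nat) := [seq k <- s | lo <= k < hi].

Definition wrapped_part (lo hi : nat) (s : seq nat) :=
  [seq k <- s | hi <= k] ++ [seq k <- s | k < lo].

Lemma sorted_range lo hi s : lo <= hi -> sorted ltn s ->
  s = [seq k <- s | k < lo] ++ range_part lo hi s ++ [seq k <- s | hi <= k].
Proof.
move=> le srt; rewrite {1}(sorted_split lo srt); congr (_ ++ _).
rewrite {1}(sorted_split hi (sorted_filter ltn_trans _ srt)) -!filter_predI.
by congr (_ ++ _); apply: eq_filter => k /=; lia.
Qed.

Lemma range_wrapped_rot lo hi s : lo <= hi -> sorted ltn s ->
  exists n, range_part lo hi s ++ wrapped_part lo hi s = rot n s.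
Proof.
move=> le srt; exists (size [seq k <- s | k < lo]).
by rewrite {4}(sorted_range le srt) rot_size_cat catA.
Qed.

Lemma cyclic_sorted_range lo hi s : sorted ltn s -> cyclic_sorted (range_part lo hi s).
Proof. by move=> srt; exists 0; rewrite rot0 sorted_filter //; apply: ltn_trans. Qed.

Lemma cyclic_sorted_wrapped lo hi s : lo <= hi -> sorted ltn s ->
  cyclic_sorted (wrapped_part lo hi s).
Proof.
move=> le srt; exists (size [seq k <- s | hi <= k]).
rewrite rot_size_cat; suff -> : [seq k <- s | k < lo] ++ [seq k <- s | hi <= k] =
    [seq k <- s | (k < lo) || (hi <= k)] by rewrite sorted_filter //; apply: ltn_trans.
rewrite [RHS](sorted_split lo (sorted_filter ltn_trans _ srt)) -!filter_predI.
by congr (_ ++ _); apply: eq_filter => k /=; lia.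
Qed.

Lemma head_range_part lo hi s : sorted ltn s -> lo \in s -> lo < hi ->
  head 0 (range_part lo hi s) = lo.
Proof.
move=> srt lo_s lt; have : lo \in range_part lo hi s by rewrite mem_filter leqnn lt.
have : sorted ltn (range_part lo hi s) by rewrite sorted_filter //; apply: ltn_trans.
have : {in range_part lo hi s, forall k, lo <= k} by move=> k; rewrite mem_filter => /andP[/andP[]].
move: (range_part lo hi s) => t ge; rewrite (sorted_pairwise ltn_trans) => srt_t lo_t.
case/splitPr: lo_t srt_t ge => [[//|y t1] t2] /=; rewrite all_cat /= => /andP[/and3P[_ y_lo _] _].
by move=> /(_ y (mem_head _ _)); rewrite leqNgt y_lo.
Qed.

Lemma last_wrapped_part lo hi s home : sorted ltn s -> home \in s -> home < lo ->
  {in s, forall k, ~~ (home < k < lo)} -> last 0 (wrapped_part lo hi s) = home.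
Proof.
move=> srt home_s lt gap; rewrite /wrapped_part last_cat.
have : home \in [seq k <- s | k < lo] by rewrite mem_filter lt.
have : sorted ltn [seq k <- s | k < lo] by rewrite sorted_filter //; apply: ltn_trans.
have : {in [seq k <- s | k < lo], forall k, k <= home}.
  by move=> k; rewrite mem_filter => /andP[k_lo /gap]; rewrite k_lo andbT -leqNgt.
move: [seq k <- s | k < lo] => t le srt_t home_t.
case/splitPr: home_t srt_t le => t1 [|y t2]; first by rewrite last_cat.
rewrite (sorted_pairwise ltn_trans) pairwise_cat /= => /and3P[_ _ /andP[/andP[home_y _] _]].
by move=> /(_ y); rewrite mem_cat !inE eqxx !orbT leqNgt home_y => /(_ isT).
Qed.

Definition side (inward : bool) (lo hi : nat) (s : seq nat) :=
  if inward then range_part lo hi s else wrapped_part lo hi s.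

Section Sides.

Variables (lo hi : nat) (s : seq nat).
Hypothesis lo_le_hi : lo <= hi.

Lemma mem_side p k : (k \in side p lo hi s) = (k \in s) && ((lo <= k < hi) == p).
Proof.
case: p; rewrite /side /range_part /wrapped_part ?mem_cat !mem_filter; case: (k \in s) => /=; lia.
Qed.

Hypothesis srt : sorted ltn s.

Lemma side_rot p : exists n, side p lo hi s ++ side (~~ p) lo hi s = rot n s.
Proof.
case: p; first exact: range_wrapped_rot.
exists (size ([seq k <- s | k < lo] ++ range_part lo hi s)).
by rewrite [X in rot _ X](sorted_range lo_le_hi srt) catA rot_size_cat catA.
Qed.

Lemma cyclic_sorted_side p : cyclic_sorted (side p lo hi s).
Proof. by case: p; [apply: cyclic_sorted_range | apply: cyclic_sorted_wrapped]. Qed.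

End Sides.

Lemma sorted_insert s1 a b s2 : sorted ltn (s1 ++ a :: s2) -> a < b ->
  {in s1 ++ a :: s2, forall k, ~~ (a < k <= b)} -> sorted ltn (s1 ++ a :: b :: s2).
Proof.
rewrite !(sorted_pairwise ltn_trans) !pairwise_cat /= =>
  /and3P[/allrelP lt12 p1 /andP[/allP a2 p2]].
move=> ab gap; rewrite p1 p2 ab /= andbT; apply/and3P; split.
- apply/allrelP => y z y1; rewrite !inE => /or3P[/eqP->|/eqP->|z2].
  + by apply: lt12 => //; apply: mem_head.
  + by apply: ltn_trans ab; apply: lt12 => //; apply: mem_head.
  + by apply: lt12 => //; rewrite inE z2 orbT.
- exact/allP.
- apply/allP => k k2; have := gap k; rewrite mem_cat inE k2 !orbT => /(_ isT).
  by rewrite (a2 k k2) -ltnNge.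
Qed.

(** * Rings of labelled elements *)

Definition class_list (M : nat) (P : nat -> bool) (lab : nat -> nat) (c : nat) : seq nat :=
  [seq k <- iota 0 M | P k && (lab k == c)].

Definition class_rings (M : nat) (P : nat -> bool) (lab nx pv : nat -> nat) : Prop :=
  forall c, ring nx pv (class_list M P lab c).

Section ClassLists.

Variables (M : nat) (P : nat -> bool) (lab : nat -> nat).
Hypothesis P_lt : forall k, P k -> k < M.

Lemma mem_class_list c k : (k \in class_list M P lab c) = P k && (lab k == c).
Proof.
rewrite mem_filter mem_iota /= add0n andbC; case Pk: (P k) => /=; last by rewrite andbF.
by rewrite P_lt.
Qed.

Lemma sorted_class_list c : sorted ltn (class_list M P lab c).
Proof. by rewrite sorted_filter ?iota_ltn_sorted //; apply: ltn_trans. Qed.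

Lemma class_list_uniq c : uniq (class_list M P lab c).
Proof. by rewrite filter_uniq ?iota_uniq. Qed.

Lemma class_lists_disjoint c c' k : c != c' -> k \in class_list M P lab c ->
  k \notin class_list M P lab c'.
Proof. by rewrite !mem_class_list => cc' /andP[-> /eqP->]. Qed.

End ClassLists.

Record insertion (M : nat) (P : nat -> bool) (lab : nat -> nat) (p y : nat) (P' : nat -> bool) :
    Prop := Insertion {
  ins_bound : forall k, P k -> k < M;
  ins_new_bound : y < M;
  ins_pred : P p;
  ins_new : ~~ P y;
  ins_lt : p < y;
  ins_gap : forall k, P k -> lab k = lab p -> ~~ (p < k < y);
  ins_eq : forall k, P' k = P k || (k == y) }.

Section InsertInClass.

Variables (M : nat) (P : nat -> bool) (lab nx pv : nat -> nat) (p y : nat) (P' : nat -> bool).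
Hypothesis ins : insertion M P lab p y P'.

Local Notation lab' := (upd lab y (lab p)).

Let P_lt := ins_bound ins.
Let Pp := ins_pred ins.
Let Py := ins_new ins.
Let P'E := ins_eq ins.

Let P'_lt k : P' k -> k < M.
Proof. by rewrite P'E => /orP[/P_lt|/eqP->]; last exact: ins_new_bound ins. Qed.

Lemma class_list_insert : exists s1 s2, class_list M P lab (lab p) = s1 ++ p :: s2 /\
  class_list M P' lab' (lab p) = s1 ++ p :: y :: s2.
Proof.
have pC : p \in class_list M P lab (lab p) by rewrite mem_class_list // Pp eqxx.
have srt := sorted_class_list M P lab (lab p); have memC := mem_class_list lab P_lt (lab p).
case/splitPr: pC srt memC => s1 s2 srt memC; exists s1, s2; split=> //.
apply: irr_sorted_eq ltn_trans ltnn _ _ (sorted_class_list _ _ _ _) _ _ => [|k].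
  apply: sorted_insert (ins_lt ins) _ => // k; rewrite memC => /andP[Pk /eqP labk].
  have := ins_gap ins Pk labk; apply: contra => /andP[-> kb]; rewrite ltn_neqAle kb andbT.
  by apply: contraTneq Pk => ->.
rewrite mem_class_list // P'E /upd; have := memC k; rewrite !mem_cat !inE.
case: (k =P y) => [->|_] memk; first by rewrite eqxx !orbT.
by rewrite orbF /= -memk.
Qed.

Lemma class_list_insert_other c : c != lab p -> class_list M P' lab' c = class_list M P lab c.
Proof.
move=> nc; apply: eq_filter => k; rewrite P'E /upd; case: (k =P y) => [->|_]; last by rewrite orbF.
by rewrite (negbTE Py) [lab p == c]eq_sym (negbTE nc).
Qed.

Lemma size_class_list_insert :
  size (class_list M P' lab' (lab p)) = (size (class_list M P lab (lab p))).+1.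
Proof. by have [s1 [s2 [-> ->]]] := class_list_insert; rewrite !size_cat /= !addnS. Qed.

Lemma class_rings_insert : class_rings M P lab nx pv ->
  class_rings M P' lab' (insert_next nx p y) (insert_prev nx pv p y).
Proof.
move=> rings c; have memE := mem_class_list lab P_lt.
have pC : p \in class_list M P lab (lab p) by rewrite memE Pp eqxx.
have yC c' : y \notin class_list M P lab c' by rewrite memE (negbTE Py).
case: (c =P lab p) => [->|/eqP nc].
  have [s1 [s2 [CE C'E]]] := class_list_insert; rewrite C'E.
  by apply: ring_insert; rewrite -CE ?class_list_uniq.
rewrite class_list_insert_other // ring_insert_other // => k kc.
have [np _] := ring_mem (rings (lab p)) pC.
have kp := class_lists_disjoint P_lt nc kc.
rewrite !inE !negb_or; apply/and3P; split.
- by apply: contraNneq kp => ->.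
- by apply: contraTneq kc => ->; apply: yC.
- by apply: contraNneq kp => ->.
Qed.

End InsertInClass.

Section CutClass.

Variables (M : nat) (P : nat -> bool) (lab nx pv : nat -> nat) (c x : nat).
Hypotheses (P_lt : forall k, P k -> k < M) (cx : c != x) (x_unused : forall k, P k -> lab k != x).
Variables (lo hi : nat) (p : bool) (x1 : nat) (a : seq nat) (x2 : nat) (b : seq nat).
Hypothesis lo_le_hi : lo <= hi.
Hypothesis left_side : side p lo hi (class_list M P lab c) = x1 :: a.
Hypothesis right_side : side (~~ p) lo hi (class_list M P lab c) = x2 :: b.
Variable lab' : nat -> nat.
Hypothesis lab'E : forall k, lab' k = if k \in x1 :: a then x else lab k.

Let srt := sorted_class_list M P lab c.

Let rot_ab : exists n, (x1 :: a) ++ x2 :: b = rot n (class_list M P lab c).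
Proof. by rewrite -left_side -right_side; apply: side_rot. Qed.

Let uniq_ab : uniq ((x1 :: a) ++ x2 :: b).
Proof. by have [n ->] := rot_ab; rewrite rot_uniq; apply: class_list_uniq. Qed.

Let mem_ab k : (k \in x1 :: a) || (k \in x2 :: b) = P k && (lab k == c).
Proof. by rewrite -mem_cat; have [n ->] := rot_ab; rewrite mem_rot mem_class_list. Qed.

Let disjoint_ab k : k \in x1 :: a -> k \notin x2 :: b.
Proof. by rewrite -left_side -right_side !mem_side // => /andP[-> /eqP->]; case: p. Qed.

Lemma mem_cut_class_left : class_list M P lab' x =i x1 :: a.
Proof.
move=> k; rewrite mem_class_list // lab'E; have := mem_ab k.
case ka: (k \in x1 :: a) => /=; first by move=> /esym/andP[-> _]; rewrite eqxx.
by move=> _; case Pk: (P k) => //=; apply: negbTE; apply: x_unused.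
Qed.

Lemma mem_cut_class_right : class_list M P lab' c =i x2 :: b.
Proof.
move=> k; rewrite mem_class_list // lab'E; have := mem_ab k.
case ka: (k \in x1 :: a) => //= _.
by rewrite [x == c]eq_sym (negbTE cx) andbF (negbTE (disjoint_ab ka)).
Qed.

Lemma cut_class_other c' : c' != c -> c' != x -> class_list M P lab' c' = class_list M P lab c'.
Proof.
move=> nc nx'; apply: eq_filter => k; rewrite lab'E; case: ifP => // ka.
have := mem_ab k; rewrite ka /= => /esym/andP[-> /eqP->].
by rewrite [x == c']eq_sym (negbTE nx') [c == c']eq_sym (negbTE nc).
Qed.

Lemma size_cut_class : size (class_list M P lab' x) = size (x1 :: a) /\
  size (class_list M P lab' c) = size (x2 :: b).
Proof.
have /and3P[ua _ ub] : [&& uniq (x1 :: a), ~~ has (mem (x1 :: a)) (x2 :: b) & uniq (x2 :: b)].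
  by rewrite -cat_uniq.
split; apply: perm_size; apply: uniq_perm; rewrite ?class_list_uniq //.
  exact: mem_cut_class_left.
exact: mem_cut_class_right.
Qed.

Lemma class_rings_cut : class_rings M P lab nx pv -> class_rings M P lab'
  (cut_next nx pv x1 (last x1 a)) (cut_prev nx pv x1 (last x1 a)).
Proof.
move=> rings; have ring_ab : ring nx pv ((x1 :: a) ++ x2 :: b).
  by have [n ->] := rot_ab; rewrite /ring rot_cycle; apply: rings.
have [pvE nxE ring_a ring_b] := ring_cut ring_ab uniq_ab.
move=> c'; have srt' := sorted_class_list M P lab' c'.
case: (c' =P c) srt' => [-> srt'|/eqP nc].
  apply: ring_sorted ring_b _ srt' mem_cut_class_right.
  by rewrite -right_side; apply: cyclic_sorted_side.
case: (c' =P x) => [-> srt'|/eqP nx' _].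
  apply: ring_sorted ring_a _ srt' mem_cut_class_left.
  by rewrite -left_side; apply: cyclic_sorted_side.
rewrite cut_class_other // ring_cut_other // => k kc'.
have notab : k \notin (x1 :: a) ++ x2 :: b.
  rewrite mem_cat mem_ab; move: kc'; rewrite mem_class_list // => /andP[-> /eqP->].
  exact: nc.
have ne z : z \in (x1 :: a) ++ x2 :: b -> k != z by move=> zab; apply: contraNneq notab => ->.
by rewrite !inE !negb_or pvE nxE !ne // mem_cat ?mem_head ?mem_last ?orbT.
Qed.

End CutClass.

(** * The potential of relabelling the smaller half *)

(* A cut turns a class of p pieces into classes of p1 and p2 pieces with
   p1 + p2 <= p + 2, so p - 2 is superadditive and relabelling the smaller side
   costs O(log p) per unit of p - 2. *)
Definition phi (p : nat) : nat := (p - 2) * trunc_log 2 (p - 2).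

Lemma minn_mul_trunc_log a b : minn a b + (a * trunc_log 2 a + b * trunc_log 2 b) <=
  (a + b) * trunc_log 2 (a + b).
Proof.
wlog le : a b / a <= b => [wlog_le|].
  case/orP: (leq_total a b) => le; first exact: wlog_le.
  by rewrite minnC [a + b]addnC [X in _ + X]addnC; apply: wlog_le.
rewrite (minn_idPl le); case: (posnP a) => [->|a0]; first by rewrite !(add0n, mul0n).
have la : (trunc_log 2 a).+1 <= trunc_log 2 (a + b).
  by rewrite -trunc_log2_double //; apply: leq_trunc_log; lia.
have lb : trunc_log 2 b <= trunc_log 2 (a + b) by apply: leq_trunc_log; lia.
nia.
Qed.

Lemma phi_split p p1 p2 : 0 < p1 -> 0 < p2 ->
  (p1 + p2 <= p + 1) || [&& 1 < p1, 1 < p2 & p1 + p2 <= p + 2] ->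
  minn p1 p2 + (phi p1 + phi p2) <= phi p + 2.
Proof.
move=> p1_gt0 p2_gt0 bound; have := minn_mul_trunc_log (p1 - 2) (p2 - 2).
rewrite -/(phi p1) -/(phi p2) => split_le.
have le : (p1 - 2) + (p2 - 2) <= p - 2 by lia.
have : (p1 - 2 + (p2 - 2)) * trunc_log 2 (p1 - 2 + (p2 - 2)) <= phi p.
  by rewrite /phi; apply: leq_mul => //; apply: leq_trunc_log.
lia.
Qed.

Lemma sum_change2 (f g : nat -> nat) n a b : a < n -> b < n -> a != b ->
  (forall c, c != a -> c != b -> f c = g c) ->
  \sum_(0 <= c < n) f c + (g a + g b) = \sum_(0 <= c < n) g c + (f a + f b).
Proof.
move=> la lb ab fg; have split2 (h : nat -> nat) : \sum_(0 <= c < n) h c =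
    h a + h b + \sum_(i < n | (i != Ordinal la) && (i != Ordinal lb)) h i.
  by rewrite big_mkord (bigD1 (Ordinal la)) //= (bigD1 (Ordinal lb)) /= ?addnA // -val_eqE eq_sym.
rewrite !split2; set f' := \sum_(i < n | _) f i; set g' := \sum_(i < n | _) g i.
suff -> : f' = g' by lia.
by apply: eq_bigr => i /andP[na nb]; apply: fg; rewrite -val_eqE in na nb.
Qed.

Lemma size_gt1 (s : seq nat) a b : a \in s -> b \in s -> a != b -> 1 < size s.
Proof.
move=> sa sb ab; apply: (@uniq_leq_size _ [:: a; b]); first by rewrite /= inE ab.
by move=> k; rewrite !inE => /orP[] /eqP->.
Qed.

(** * The program *)

(* Indexed by vertices: parent, first child and next sibling (both shifted by one,
   0 is nil), position, initial weight.  By positions: position of the parent,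
   interval end, mask of the ancestors in the same block, and (at starts of blocks)
   masks of marks, of boundaries and of weights.  By nodes: mask of positions,
   successor and predecessor in the class, class label.  By labels: sum of weights.
   By masks: one plus the most significant bit, population count. *)
Notation aParent := 0 (only parsing).
Notation aChild := 1 (only parsing).
Notation aSibling := 2 (only parsing).
Notation aPos := 3 (only parsing).
Notation aWeight := 4 (only parsing).
Notation aUp := 5 (only parsing).
Notation aEnd := 6 (only parsing).
Notation aAnc := 7 (only parsing).
Notation aMark := 8 (only parsing).
Notation aBound := 9 (only parsing).
Notation aBits := 10 (only parsing).
Notation aPiece := 11 (only parsing).
Notation aNext := 12 (only parsing).
Notation aPrev := 13 (only parsing).
Notation aLabel := 14 (only parsing).
Notation aSum := 15 (only parsing).
Notation aTop := 16 (only parsing).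
Notation aPop := 17 (only parsing).

Notation vn := 0 (only parsing).
Notation vN := 1 (only parsing).
Notation vB := 2 (only parsing).
Notation vPow := 3 (only parsing).
Notation vI := 4 (only parsing).
Notation vRec0 := 5 (only parsing).
Notation vRec1 := 6 (only parsing).
Notation vRec2 := 7 (only parsing).
Notation vX := 8 (only parsing).
Notation vBlock := 9 (only parsing).
Notation vOff := 10 (only parsing).
Notation vMask := 11 (only parsing).
Notation vPiece := 12 (only parsing).
Notation vClass := 13 (only parsing).
Notation vEnd := 14 (only parsing).
Notation vEndBlock := 15 (only parsing).
Notation vEndOff := 16 (only parsing).
Notation vEndPiece := 17 (only parsing).
Notation vLo := 18 (only parsing).
Notation vHi := 19 (only parsing).
Notation vT := 20 (only parsing).
Notation vU := 21 (only parsing).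
Notation vFwd := 22 (only parsing).
Notation vBwd := 23 (only parsing).
Notation vFirst := 24 (only parsing).
Notation vLast := 25 (only parsing).
Notation vTotal := 26 (only parsing).
Notation vCur := 27 (only parsing).
Notation vMore := 28 (only parsing).
Notation vBlocks := 29 (only parsing).

Definition locate_cmd : cmd :=
  vOff <-- ($vX %% $vB);;
  vBlock <-- ($vX - $vOff);;
  vMask <-- (aAnc.[|$vX] && aMark.[|$vBlock]);;
  If ($vMask)
    (vPiece <-- (#2 * ($vBlock + (aTop.[|$vMask] - #1)) + #1))
    (vPiece <-- (#2 * ($vBlock + (aTop.[|aBound.[|$vBlock] %% (#1 <<< ($vOff + #1))] - #1)))).

Definition query_cmd : cmd := locate_cmd;; Write (aSum.[|aLabel.[|$vPiece]]).

Definition update_cmd : cmd :=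
  locate_cmd;;
  vClass <-- aLabel.[|$vPiece];;
  vT <-- ((aBits.[|$vBlock] %/ (#1 <<< $vOff)) %% #2);;
  aSum.[=$vClass] <-- (aSum.[|$vClass] + $vRec2 - $vT);;
  aBits.[=$vBlock] <-- (aBits.[|$vBlock] + ($vRec2 <<< $vOff) - ($vT <<< $vOff)).

Definition ends_cmd : cmd :=
  vEnd <-- aEnd.[|$vX];;
  vEndOff <-- ($vEnd %% $vB);;
  vEndBlock <-- ($vEnd - $vEndOff);;
  vLo <-- (#2 * $vX + #1);;
  vHi <-- (#2 * $vEnd);;
  vClass <-- aLabel.[|$vPiece].

Definition split_home_cmd : cmd :=
  If ($vBlock == $vEndBlock) (vT <-- $vEndOff) (vT <-- $vB);;
  vU <-- aPiece.[|$vPiece];;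
  vT <-- ($vU %% (#1 <<< $vT) - $vU %% (#1 <<< $vOff));;
  aPiece.[=$vLo] <-- $vT;;
  aPiece.[=$vPiece] <-- ($vU - $vT);;
  aMark.[=$vBlock] <-- (aMark.[|$vBlock] + (#1 <<< $vOff)).

Definition insert_cmd (p y : nat) : cmd :=
  vT <-- aNext.[|$p];;
  aNext.[=$p] <-- $y;;
  aNext.[=$y] <-- $vT;;
  aPrev.[=$y] <-- $p;;
  aPrev.[=$vT] <-- $y;;
  aLabel.[=$y] <-- $vClass.

Definition split_end_cmd : cmd :=
  vEndPiece <-- (#2 * ($vEndBlock + (aTop.[|aBound.[|$vEndBlock] %% (#1 <<< $vEndOff)] - #1)));;
  vU <-- aPiece.[|$vEndPiece];;
  vT <-- ($vU %% (#1 <<< $vEndOff));;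
  aPiece.[=$vEndPiece] <-- $vT;;
  aPiece.[=$vHi] <-- ($vU - $vT);;
  aBound.[=$vEndBlock] <-- (aBound.[|$vEndBlock] + (#1 <<< $vEndOff)).

Definition end_cmd : cmd :=
  If ($vBlock == $vEndBlock) Skip
    (If ((aBound.[|$vEndBlock] %/ (#1 <<< $vEndOff)) %% #2) Skip
       (split_end_cmd;; insert_cmd vEndPiece vHi)).

Definition locate_ends_cmd : cmd := locate_cmd;; ends_cmd.

Definition mark_cmd : cmd :=
  locate_ends_cmd;; split_home_cmd;; insert_cmd vPiece vLo;; end_cmd.

Definition inside (e : expr) : expr := ((#1 - (e < $vLo)) * (e < $vHi))%X.

(* Walks from both ends of the cut at once, so that the smaller side is found in
   time proportional to its size. *)
Definition walk_cmd : cmd :=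
  vFwd <-- $vLo;;
  vBwd <-- $vPiece;;
  While (inside (aNext.[|$vFwd]) * (#1 - inside (aPrev.[|$vBwd])))
    (vFwd <-- aNext.[|$vFwd];; vBwd <-- aPrev.[|$vBwd]).

Definition choose_cmd : cmd :=
  If (inside (aNext.[|$vFwd]))
    (vFirst <-- $vBwd;; vLast <-- $vPiece)
    (vFirst <-- $vLo;; vLast <-- $vFwd).

Definition relink_cmd : cmd :=
  vT <-- aPrev.[|$vFirst];;
  vU <-- aNext.[|$vLast];;
  aNext.[=$vT] <-- $vU;;
  aNext.[=$vLast] <-- $vFirst;;
  aPrev.[=$vU] <-- $vT;;
  aPrev.[=$vFirst] <-- $vLast.

Definition relabel_cmd : cmd :=
  vTotal <-- #0;;
  vCur <-- $vFirst;;
  vMore <-- #1;;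
  While ($vMore)
    (aLabel.[=$vCur] <-- $vX;;
     vT <-- ($vCur %/ #2);;
     vT <-- ($vT - $vT %% $vB);;
     vTotal <-- ($vTotal + aPop.[|aBits.[|$vT] && aPiece.[|$vCur]]);;
     vMore <-- (#1 - ($vCur == $vLast));;
     vCur <-- aNext.[|$vCur]).

Definition move_sum_cmd : cmd :=
  aSum.[=$vX] <-- $vTotal;;
  aSum.[=$vClass] <-- (aSum.[|$vClass] - $vTotal).

Definition find_side_cmd : cmd := walk_cmd;; choose_cmd.

Definition detach_cmd : cmd := relink_cmd;; relabel_cmd;; move_sum_cmd.

Definition cut_cmd : cmd := mark_cmd;; find_side_cmd;; detach_cmd.

Definition read_cmd : cmd :=
  Read vRec0;;
  vn <-- $vRec0;;
  vN <-- ($vn + #1);;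
  For vI 0 vn
    (Read vRec0;;
     aParent.[=$vI] <-- $vRec0;;
     aSibling.[=$vI] <-- aChild.[|$vRec0];;
     aChild.[=$vRec0] <-- ($vI + #1);;
     aWeight.[=$vI] <-- $vRec1);;
  aParent.[=$vn] <-- $vN.

Definition enter_child_cmd : cmd :=
  vU <-- ($vU - #1);;
  aChild.[=$vCur] <-- aSibling.[|$vU];;
  aPos.[=$vU] <-- $vT;;
  aUp.[=$vT] <-- aPos.[|$vCur];;
  vT <-- ($vT + #1);;
  vCur <-- $vU.

Definition leave_cmd : cmd :=
  aEnd.[=aPos.[|$vCur]] <-- $vT;;
  vCur <-- aParent.[|$vCur].

Definition preorder_cmd : cmd :=
  vT <-- #1;;
  vCur <-- $vn;;
  While ($vCur < $vN)
    (vU <-- aChild.[|$vCur];;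
     If ($vU) enter_child_cmd leave_cmd).

Definition block_size_cmd : cmd :=
  vB <-- #1;;
  vPow <-- #2;;
  While (#1 - ($vN < #2 * $vPow)) (vPow <-- (#2 * $vPow);; vB <-- ($vB + #1)).

Definition tables_cmd : cmd :=
  For vI 1 vPow
    (aTop.[=$vI] <-- (aTop.[|$vI %/ #2] + #1);;
     aPop.[=$vI] <-- (aPop.[|$vI %/ #2] + $vI %% #2)).

Definition blocks_cmd : cmd :=
  vBlocks <-- ($vN %/ $vB + #1);;
  For vI 0 vBlocks
    (vT <-- ($vI * $vB);;
     vU <-- (#2 * ((($vI + #1) %% $vBlocks) * $vB));;
     aBound.[=$vT] <-- #1;;
     aPiece.[=#2 * $vT] <-- ($vPow - #1);;
     aNext.[=#2 * $vT] <-- $vU;;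
     aPrev.[=$vU] <-- (#2 * $vT)).

Definition ancestors_cmd : cmd :=
  For vI 0 vN
    (aAnc.[=$vI] <-- ((#1 <<< ($vI %% $vB)) +
       (aUp.[|$vI] %/ $vB == $vI %/ $vB) * aAnc.[|aUp.[|$vI]])).

Definition weights_cmd : cmd :=
  For vI 0 vn
    (vX <-- aPos.[|$vI];;
     vOff <-- ($vX %% $vB);;
     vBlock <-- ($vX - $vOff);;
     aBits.[=$vBlock] <-- (aBits.[|$vBlock] + (aWeight.[|$vI] <<< $vOff));;
     aSum.[=#0] <-- (aSum.[|#0] + aWeight.[|$vI])).

Definition setup_cmd : cmd :=
  block_size_cmd;; tables_cmd;; blocks_cmd;; ancestors_cmd;; weights_cmd.

Definition init_cmd : cmd := read_cmd;; preorder_cmd;; setup_cmd.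

Definition cut_roots_cmd : cmd :=
  For vI 0 vn (If (aParent.[|$vI] == $vn) (vX <-- aPos.[|$vI];; cut_cmd) Skip).

Definition dispatch_cmd : cmd :=
  If ($vRec0 == #0) cut_cmd (If ($vRec0 == #1) update_cmd query_cmd).

Definition operation_cmd : cmd := vX <-- aPos.[|$vRec1];; dispatch_cmd.

Definition main_cmd : cmd :=
  Read vRec0;;
  While ($vRec0 < #3) (operation_cmd;; Read vRec0).

Definition forest_cmd : cmd := init_cmd;; cut_roots_cmd;; main_cmd.

Lemma wf_forest_cmd : wf_cmd forest_cmd.
Proof. by vm_compute. Qed.

(** * Marked intervals and pieces of blocks *)

Notation inner_node g := (2 * g + 1) (only parsing).
Notation outer_node g := (2 * g) (only parsing).

Lemma nodeE g : (inner_node g %/ 2 = g) * (odd (inner_node g) = true) *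
  ((outer_node g %/ 2 = g) * (odd (outer_node g) = false)).
Proof. by do !split; lia. Qed.

Lemma inner_neq_outer a b : (inner_node a == outer_node b) = false.
Proof. by apply/eqP; lia. Qed.

Lemma node_split k : k = if odd k then inner_node (k %/ 2) else outer_node (k %/ 2).
Proof. by case E: (odd k); lia. Qed.

Section Forest.

Variables (N B : nat) (R : nat -> nat).
Hypothesis B_gt0 : 0 < B.
Hypothesis R_bound : forall x, x < N -> x < R x <= N.
Hypothesis R_laminar : forall x y, x < N -> x <= y < R x -> R y <= R x.

Definition block (x : nat) : nat := x %/ B * B.
Definition offset (x : nat) : nat := x %% B.

Lemma block_le x : block x <= x. Proof. exact: leq_divM. Qed.

Lemma block_gt x : x < block x + B. Proof. by rewrite addnC -mulSn ltn_ceil. Qed.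

Lemma block_offset x : x = block x + offset x. Proof. exact: divn_eq. Qed.

Lemma offset_lt x : offset x < B. Proof. by rewrite ltn_mod. Qed.

Lemma block_add x i : i < B -> block (block x + i) = block x.
Proof. by move=> li; rewrite /block divnMDl // (divn_small li) addn0. Qed.

Lemma block_id x : block (block x) = block x.
Proof. by rewrite -{1}[block x]addn0 block_add. Qed.

Lemma leq_block x y : x <= y -> block x <= block y.
Proof. by move=> xy; rewrite leq_mul2r leq_div2r ?orbT. Qed.

Lemma ltn_block x y : block x < block y -> x < block y.
Proof.
rewrite {1}/block {1}/block ltn_mul2r => /andP[_ xy].
by apply: leq_trans (block_gt x) _; rewrite /block -mulSnr leq_mul2r xy orbT.
Qed.

Lemma block_eq x y : block x <= y < block x + B -> block y = block x.
Proof.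
by move=> xy; have -> : y = block x + (y - block x) by [lia]; rewrite block_add //; lia.
Qed.

Lemma eq_block_add x o : (block x + o == x) = (o == offset x).
Proof. by rewrite {2}[x]block_offset eqn_add2l. Qed.

Lemma block_offset0 x : offset x = 0 -> block x = x.
Proof. by move=> o0; rewrite [RHS]block_offset o0 addn0. Qed.

Definition covers (d y : nat) : bool := d <= y < R d.

(* A piece of a block is named by a node: [inner_node g] for the positions whose
   innermost marked interval starts at g inside the block, and [outer_node g] for
   the positions from g on that lie in no marked interval starting in the block, up
   to the next end [R d] of a marked interval entering the block from the left.
   [encloses d k] says that the interval of d contains the piece k. *)
Definition encloses (d k : nat) : bool :=
  (d < (if odd k then (k %/ 2).+1 else block (k %/ 2))) && (k %/ 2 < R d).

Implicit Type D : nat -> bool.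

Definition boundary D (g : nat) : bool :=
  (offset g == 0) || has (fun d => D d && (R d == g)) (iota 0 (block g)).

(* Some of these pieces may be empty. *)
Definition piece D (k : nat) : bool :=
  (k %/ 2 <= N) && (if odd k then D (k %/ 2) else boundary D (k %/ 2)).

Definition piece_of D (y : nat) : nat :=
  let b := block y in
  if top B (fun i => D (b + i) && covers (b + i) y) is i.+1 then inner_node (b + i)
  else outer_node (b + (top (offset y).+1 (fun e => boundary D (b + e))).-1).

Definition same_marks D (k k' : nat) : Prop := forall d, D d -> encloses d k = encloses d k'.

Lemma piece_le D k : piece D k -> k <= 2 * N + 1.
Proof. by case/andP => kN _; lia. Qed.

Lemma piece_lt D k : piece D k -> k < 2 * N + 2.
Proof. by move/piece_le; rewrite (addnS _ 1) ltnS. Qed.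

Lemma boundaryP D g :
  reflect (offset g = 0 \/ exists2 d, d < block g & D d /\ R d = g) (boundary D g).
Proof.
apply: (iffP orP) => [[/eqP->|/hasP[d]]|[->|[d ld [Dd Rd]]]]; [by left| |by left|right].
  by rewrite mem_iota => /andP[_ ld] /andP[Dd /eqP Rd]; right; exists d.
by apply/hasP; exists d; rewrite ?mem_iota ?Dd ?Rd ?eqxx //; lia.
Qed.

Lemma boundary_end D d g : d < block g -> D d -> R d = g -> boundary D g.
Proof. by move=> *; apply/boundaryP; right; exists d. Qed.

Lemma boundary_block D g : boundary D (block g).
Proof. by apply/boundaryP; left; rewrite /offset /block modnMl. Qed.

Section Marks.

Variable D : nat -> bool.
Hypothesis D_lt : forall d, D d -> d < N.

Variant piece_of_spec (y : nat) : nat -> Prop :=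
| PieceInner g of block g = block y & D g & covers g y &
    (forall d, D d -> g < d -> block d = block y -> covers d y = false) :
    piece_of_spec y (inner_node g)
| PieceOuter g of block g = block y & boundary D g & g <= y &
    (forall d, D d -> block d = block y -> covers d y = false) &
    (forall e, g < e <= y -> boundary D e = false) :
    piece_of_spec y (outer_node g).

Lemma piece_ofP y : piece_of_spec y (piece_of D y).
Proof.
have in_block d : block d = block y -> d = block y + (d - block y) /\ d - block y < B.
  by have := block_le d; have := block_gt d; lia.
have yB := offset_lt y; have Ey := block_offset y.
rewrite /piece_of; case E1: (top B _) => [|i]; last first.
  have [li /andP[Dg Cg] last] := (topP _ _ _).1 E1.
  apply: PieceInner Cg _; rewrite ?block_add //.
  move=> d Dd gd /in_block[dE dB]; have := last (d - block y).
  by rewrite -dE Dd /=; apply; lia.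
case E2: (top _ _) => [|e].
  by have := top_eq0 E2 (ltn0Sn _); rewrite addn0 boundary_block.
have [le Be last] := (topP _ _ _).1 E2; apply: PieceOuter Be _ _ _.
- by rewrite block_add //; lia.
- by rewrite /=; lia.
- by move=> d Dd /in_block[dE dB]; have := top_eq0 E1 dB; rewrite -dE Dd.
- move=> e' /= le'; have -> : e' = block y + (e' - block y) by lia.
  by apply: last; lia.
Qed.

Lemma block_piece_of y : block (piece_of D y %/ 2) = block y.
Proof. by case: piece_ofP => g bg *; rewrite nodeE. Qed.

Lemma piece_of_le y : piece_of D y %/ 2 <= y.
Proof. by case: piece_ofP => [g _ _ /andP[gy _] _|g _ _ gy _ _]; rewrite nodeE. Qed.

Lemma piece_piece_of y : y <= N -> piece D (piece_of D y).
Proof.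
move=> ly; rewrite /piece (leq_trans (piece_of_le y) ly).
by case: piece_ofP => g *; rewrite !nodeE.
Qed.

Lemma covers_piece_of y d : D d -> covers d y = encloses d (piece_of D y).
Proof.
move=> Dd; have := block_le y; have := block_le d; have := block_gt d; have := block_gt y => *.
case: piece_ofP => [g bg _ Cg inner|g bg _ gy none last]; rewrite /encloses !nodeE.
  rewrite /covers in Cg *; apply/idP/idP => cov.
    case: (leqP d g) => [|gd]; first lia.
    by have := inner d Dd gd; rewrite /covers cov; have := leq_block (ltnW gd);
       have := @leq_block d y; lia.
  have := R_laminar (D_lt Dd) (y := g); lia.
rewrite bg /covers; apply/idP/idP => cov.
  case: (ltnP d (block y)) => [|gd]; first by lia.
  have bd : block d = block y by apply: block_eq; lia.
  by have := none d Dd bd; rewrite /covers cov.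
case: (leqP (R d) y) => [Ry|]; last lia.
have := last (R d); rewrite (@boundary_end D d) //; [by lia|].
have -> : block (R d) = block y by apply: block_eq; have := block_le g; lia.
lia.
Qed.

Lemma piece_uniq k k' : piece D k -> piece D k' -> block (k %/ 2) = block (k' %/ 2) ->
  same_marks D k k' -> k = k'.
Proof.
wlog le : k k' / k %/ 2 <= k' %/ 2 => [IH|].
  case: (leqP (k %/ 2) (k' %/ 2)) => [|/ltnW] le P P' bb same; first exact: IH.
  by apply/esym/IH => // d Dd; rewrite same.
move=> /andP[_ P] /andP[_ P'] bb same; rewrite (node_split k) (node_split k').
move: P P' same bb le; rewrite /same_marks /encloses; move: (k %/ 2) (k' %/ 2) => g g'.
have g_block := block_le g.
case: (odd k); case: (odd k') => P P' same bb le.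
- have := same _ P'; have := same _ P; have := R_bound (D_lt P'); have := R_bound (D_lt P); lia.
- have := same _ P; have := R_bound (D_lt P); lia.
- have := same _ P'; have := R_bound (D_lt P'); lia.
- case: (ltngtP g g') le => // [lt _|-> //].
  case/boundaryP: P' => [/block_offset0|[d ld [Dd Rd]]]; first lia.
  by have := same _ Dd; rewrite Rd; lia.
Qed.

Lemma piece_of_eq k y : y <= N -> piece D k -> block (k %/ 2) = block y ->
  (forall d, D d -> covers d y = encloses d k) -> piece_of D y = k.
Proof.
move=> ly Pk bk cov; apply: piece_uniq => //; first exact: piece_piece_of.
  by rewrite block_piece_of bk.
by move=> d Dd; rewrite -covers_piece_of // cov.
Qed.

End Marks.

Section Cut.

Variables (D : nat -> bool) (x : nat).
Hypothesis D_lt : forall d, D d -> d < N.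
Hypotheses (x_lt : x < N) (x_new : D x = false).

Definition mark : nat -> bool := fun d => D d || (d == x).

(* The right end of the new interval splits the piece [end_piece] of its block,
   unless some marked interval already ends there. *)
Definition end_splits : bool := (block x != block (R x)) && ~~ boundary D (R x).

Definition end_piece : nat :=
  outer_node (block (R x) + (top (offset (R x)) (fun e => boundary D (block (R x) + e))).-1).

Local Notation home := (piece_of D x).
Local Notation lo := (inner_node x).
Local Notation hi := (outer_node (R x)).

Lemma mark_lt d : mark d -> d < N.
Proof. by case/orP => [|/eqP->//]; apply: D_lt. Qed.

Lemma boundary_mark g : boundary mark g = boundary D g || (end_splits && (g == R x)).
Proof.
apply/boundaryP/orP => [[g0|[d ld [/orP[Dd|/eqP dx] Rd]]]|[/boundaryP[g0|[d ld [Dd Rd]]]|]].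
- by left; apply/boundaryP; left.
- by left; apply: boundary_end ld Dd Rd.
- have gR : g = R x by rewrite -Rd dx.
  case E: (boundary D g); first by left.
  right; rewrite gR eqxx andbT; apply/andP; split; last by rewrite -gR E.
  by apply/eqP => bb; have := block_le x; move: ld; rewrite bb -gR dx; lia.
- by left.
- by right; exists d => //; rewrite /mark Dd.
- move=> /andP[/andP[bb _] /eqP->]; right; exists x; last by rewrite /mark eqxx orbT.
  by apply: ltn_block; rewrite ltn_neqAle bb leq_block //; have := R_bound x_lt; lia.
Qed.

Lemma piece_mark k : piece mark k = [|| piece D k, k == lo | end_splits && (k == hi)].
Proof.
have x_bound := R_bound x_lt; rewrite /piece; case O: (odd k).
  rewrite (_ : k == hi = false) ?andbF ?orbF; last by apply/eqP; lia.
  rewrite /mark andb_orr; congr (_ || _).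
  by apply/andP/eqP => [[_ /eqP]|->]; rewrite ?nodeE; [lia | split; lia].
rewrite boundary_mark (_ : k == lo = false); last by apply/eqP; lia.
rewrite andb_orr /=; congr (_ || _).
case: end_splits; rewrite /= ?andbF //.
by apply/andP/eqP => [[_ /eqP]|->]; rewrite ?nodeE; [lia | split; lia].
Qed.

Lemma lo_new : piece D lo = false.
Proof. by rewrite /piece !nodeE x_new andbF. Qed.

Lemma hi_new : end_splits -> piece D hi = false.
Proof. by move=> /andP[_ /negbTE E]; rewrite /piece !nodeE E andbF. Qed.

Lemma encloses_lo d : encloses d lo = covers d x.
Proof. by rewrite /encloses !nodeE /covers ltnS. Qed.

Lemma encloses_home d : D d -> encloses d home = covers d x.
Proof. by move=> Dd; rewrite (covers_piece_of D_lt). Qed.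

Lemma end_splits_block : end_splits -> x < block (R x) < R x.
Proof.
have x_bound := R_bound x_lt.
move=> /andP[bb E]; apply/andP; split.
  by apply: ltn_block; rewrite ltn_neqAle bb leq_block //; lia.
have := block_le (R x); rewrite leq_eqVlt => /orP[/eqP e|//].
by rewrite -e boundary_block in E.
Qed.

Lemma end_pieceP : end_splits -> exists g, [/\ end_piece = outer_node g,
  block g = block (R x), boundary D g, g < R x & forall e, g < e <= R x -> boundary D e = false].
Proof.
move=> sp; have := end_splits_block sp; have := block_offset (R x) => ER lR.
have oB := offset_lt (R x).
rewrite /end_piece; case E: (top _ _) => [|e].
  have := top_eq0 (i := 0) E; rewrite addn0 boundary_block => none.
  by have /none : 0 < offset (R x) by lia.
have [le Be last] := (topP _ _ _).1 E.
exists (block (R x) + e); split=> //; first by rewrite block_add //; lia.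
  lia.
move=> e' le'; case: (e' =P R x) => [->|ne]; first by case/andP: sp => _ /negbTE.
by have -> : e' = block (R x) + (e' - block (R x)); [lia | apply: last; lia].
Qed.

Lemma piece_end_piece : end_splits -> piece D end_piece.
Proof.
move=> sp; have [g [-> _ Bg gR _]] := end_pieceP sp; have x_bound := R_bound x_lt.
by rewrite /piece !nodeE Bg; lia.
Qed.

Lemma end_piece_lt : end_splits -> end_piece < hi.
Proof. by move=> sp; have [g [-> _ _ gR _]] := end_pieceP sp; lia. Qed.

Lemma encloses_end_piece d : end_splits -> D d -> encloses d end_piece = covers d x.
Proof.
move=> sp Dd; have [g [-> bg _ gR last]] := end_pieceP sp; rewrite /encloses !nodeE bg /covers.
have lR := end_splits_block sp; have := block_le g => bg'.
apply/idP/idP => cov; last by have := R_laminar (D_lt Dd) (y := x); lia.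
case: (leqP (R d) (R x)) => [Rd|Rd].
  have := last (R d); rewrite (@boundary_end D d) //; [lia|].
  have -> : block (R d) = block (R x) by apply: block_eq; have := block_gt (R x); lia.
  lia.
case: (leqP d x) => [|dx]; first lia.
by have := R_laminar x_lt (y := d); lia.
Qed.

Lemma encloses_hi d : end_splits -> D d -> encloses d hi = covers d x.
Proof.
move=> sp Dd; rewrite -encloses_end_piece //; have [g [-> bg _ gR last]] := end_pieceP sp.
rewrite /encloses !nodeE bg; case: (ltnP d (block (R x))) => //= ld; apply/idP/idP; first lia.
move=> cov; case: (leqP (R d) (R x)) => // Rd.
have := last (R d); rewrite (@boundary_end D d) //; [lia|].
have -> : block (R d) = block (R x).
  by apply: block_eq; have := block_gt (R x); have := block_le g; lia.
lia.
Qed.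

Lemma encloses_new_home : encloses x home = false.
Proof.
case: (piece_ofP D x) => g bg Dg; rewrite /encloses !nodeE.
  have gx : g != x by apply: contraTneq Dg => ->; rewrite x_new.
  by rewrite /covers; lia.
by rewrite bg; have := block_le x; lia.
Qed.

Lemma encloses_new_lo : encloses x lo.
Proof. by rewrite encloses_lo /covers; have := R_bound x_lt; lia. Qed.

Lemma encloses_new_hi : encloses x hi = false.
Proof. by rewrite /encloses !nodeE ltnn andbF. Qed.

Lemma encloses_new_end_piece : end_splits -> encloses x end_piece.
Proof.
move=> sp; have lR := end_splits_block sp; have [g [-> bg _ gR _]] := end_pieceP sp.
by rewrite /encloses !nodeE bg; lia.
Qed.

Lemma end_piece_neq_home : end_splits -> end_piece != home.
Proof.
by move=> sp; apply: contraTneq (encloses_new_end_piece sp) => ->; rewrite encloses_new_home.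
Qed.

(* Two nodes in the same old intervals can be separated by the new interval
   only if they lie in the class being cut. *)
Lemma separated k k' : same_marks D k k' -> encloses x k -> ~~ encloses x k' ->
  same_marks D k lo.
Proof.
move=> same cov C' d Dd; rewrite encloses_lo.
move: (same _ Dd) cov C'; rewrite /encloses /covers.
have L1 := R_laminar (D_lt Dd) (y := x); have L2 := R_laminar x_lt (y := d).
have := block_le (k %/ 2); have := block_le (k' %/ 2).
case: (odd k); case: (odd k') => *; lia.
Qed.

Lemma covered_block_neq y : y <= N -> covers x y -> piece_of D y != home ->
  encloses x (piece_of D y) = false -> block y <> block x.
Proof.
move=> ly cov nh nC byx; case/negP: nh; apply/eqP/esym.
apply: piece_of_eq => //; [exact: ltnW | exact: piece_piece_of | by rewrite block_piece_of |].
move=> d Dd; rewrite -(covers_piece_of D_lt) //.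
move: (covers_piece_of D_lt y Dd) cov nC; rewrite /encloses /covers.
have := R_laminar (D_lt Dd) (y := x).
have := block_le (piece_of D y %/ 2); have := piece_of_le D y; case: (odd _); lia.
Qed.

Lemma covers_new_encloses y : y <= N -> covers x y -> piece_of D y != home ->
  encloses x (piece_of D y).
Proof.
move=> ly cov nh; apply/negPn/negP => /negbTE nC.
have byx := covered_block_neq ly cov nh nC; move: cov nC.
have bxy : block x < block y -> x < block y by apply: ltn_block.
case: (piece_ofP D y) => g bg Dg; last first.
  by rewrite /encloses !nodeE bg /covers => gy _ _ cov; have := @leq_block x y; lia.
move=> Cg _ cov; rewrite /encloses !nodeE; have := R_bound (D_lt Dg); have := block_le g.
by move: Cg cov; rewrite /covers; have := @leq_block x y; lia.
Qed.

Lemma encloses_new_covers y : encloses x (piece_of D y) ->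
  ~~ [&& end_splits, piece_of D y == end_piece & R x <= y] -> covers x y.
Proof.
have bx := block_le x; have bgy := block_gt y.
case: (piece_ofP D y) => g bg Bg Cg; rewrite /encloses !nodeE => _.
  by move=> cov _; have := R_laminar x_lt (y := g); move: Cg; rewrite /covers; lia.
move=> last cov notail; apply/negPn/negP => nC; case/negP: notail.
have bgg := block_le g; have Ry : R x <= y by move: nC; rewrite /covers; lia.
have bR : block (R x) = block y by apply: block_eq; lia.
have sp : end_splits by rewrite /end_splits last ?andbT; [apply/eqP; lia | lia].
have [g' [gE _ Bg' gR' last']] := end_pieceP sp.
rewrite sp Ry andbT gE; apply/eqP; congr (2 * _).
case: (ltngtP g g') => // lg; first by have := last g'; rewrite Bg'; lia.
by have := last' g; rewrite Bg; lia.
Qed.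

Lemma piece_of_mark y : y <= N -> piece_of mark y =
  if (piece_of D y == home) && covers x y then lo
  else if [&& end_splits, piece_of D y == end_piece & R x <= y] then hi else piece_of D y.
Proof.
move=> ly; have Py := piece_piece_of D ly; have by_ := block_piece_of D y.
have Cy := covers_piece_of D_lt y; have ltm := mark_lt.
case: ifP => [/andP[/eqP E cov]|C1].
  apply: piece_of_eq => //; first by rewrite piece_mark eqxx orbT.
  - by rewrite nodeE -by_ E block_piece_of.
  - move=> d /orP[Dd|/eqP->]; rewrite encloses_lo; last by rewrite cov -encloses_lo encloses_new_lo.
    by rewrite Cy // E encloses_home.
case: ifP => [/and3P[sp /eqP E Ry]|C2].
  apply: piece_of_eq => //; first by rewrite piece_mark sp eqxx !orbT.
  - by have [g [gE bg _ _ _]] := end_pieceP sp; rewrite nodeE -by_ E gE nodeE.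
  - move=> d /orP[Dd|/eqP->]; first by rewrite Cy // E encloses_end_piece // encloses_hi.
    by rewrite encloses_new_hi /covers; lia.
apply: piece_of_eq => //; first by rewrite piece_mark Py.
move=> d /orP[Dd|/eqP-> {d}]; first exact: Cy.
apply/idP/idP => cov; last by apply: encloses_new_covers => //; rewrite C2.
by apply: covers_new_encloses => //; rewrite cov andbT in C1; rewrite C1.
Qed.

Lemma piece_of_mark_home y : y <= N ->
  (piece_of mark y == home) = (piece_of D y == home) && ~~ covers x y.
Proof.
move=> ly; rewrite piece_of_mark //; have Ph := piece_piece_of D (ltnW x_lt).
case: (piece_of D y =P home) => [->|/eqP/negbTE ne] /=.
  case: ifP => _ /=; first by apply/eqP => E; rewrite -E lo_new in Ph.
  case: ifP => [/and3P[sp /eqP E _]|_]; last by rewrite eqxx.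
  by have := end_piece_neq_home sp; rewrite -E eqxx.
case: ifP => [/and3P[sp _ _]|_]; last exact: ne.
by apply/eqP => E; rewrite -E hi_new in Ph.
Qed.

Lemma piece_of_mark_lo y : y <= N ->
  (piece_of mark y == lo) = (piece_of D y == home) && covers x y.
Proof.
move=> ly; rewrite piece_of_mark //; case: ifP => [_|_]; first by rewrite eqxx.
case: ifP => _; first by rewrite eq_sym inner_neq_outer.
by apply/eqP => E; have := piece_piece_of D ly; rewrite E lo_new.
Qed.

Lemma piece_of_mark_end_piece y : y <= N -> end_splits ->
  (piece_of mark y == end_piece) = (piece_of D y == end_piece) && (y < R x).
Proof.
move=> ly sp; have he := end_piece_neq_home sp; have Pe := piece_end_piece sp.
rewrite piece_of_mark // sp; case: (piece_of D y =P end_piece) => [->|ne] /=.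
  rewrite (negbTE he) /= ltnNge; case: leqP => _; last by rewrite eqxx.
  by apply/eqP => E; rewrite -E hi_new in Pe.
case: ifP => _; last exact/eqP.
by apply/eqP => E; rewrite -E lo_new in Pe.
Qed.

Lemma piece_of_mark_hi y : y <= N -> end_splits ->
  (piece_of mark y == hi) = (piece_of D y == end_piece) && (R x <= y).
Proof.
move=> ly sp; have he := end_piece_neq_home sp; have Py := piece_piece_of D ly.
have nhi : piece_of D y != hi by apply: contraTneq Py => ->; rewrite hi_new.
rewrite piece_of_mark // sp; case: (piece_of D y =P home) => [E|_] /=.
  rewrite E eq_sym in nhi; rewrite E (eq_sym home) (negbTE he) /=.
  by case: ifP => _; rewrite ?inner_neq_outer // eq_sym (negbTE nhi).
by case: ifP => _; [rewrite eqxx | rewrite (negbTE nhi)].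
Qed.

Lemma piece_of_mark_other y k : y <= N -> piece D k -> k != home ->
  ~~ (end_splits && (k == end_piece)) -> (piece_of mark y == k) = (piece_of D y == k).
Proof.
move=> ly Pk kh ke; rewrite piece_of_mark //.
case: ifP => [/andP[/eqP-> _]|_].
  by rewrite [home == k]eq_sym (negbTE kh); apply/eqP => E; rewrite -E lo_new in Pk.
case: ifP => // /and3P[sp /eqP-> _]; rewrite sp /= in ke.
by rewrite [end_piece == k]eq_sym (negbTE ke); apply/eqP => E; rewrite -E hi_new in Pk.
Qed.

Lemma encloses_new_range k : piece mark k -> same_marks D k lo -> encloses x k = (lo <= k < hi).
Proof.
move=> P same; have := block_le (k %/ 2); move: P same; rewrite /piece /same_marks.
case O: (odd k) => /andP[_ P] same bk.
  rewrite /encloses O; case/orP: P => [P|/eqP P]; last by apply/idP/idP; lia.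
  have := same _ P; rewrite encloses_lo /encloses O /covers; have := R_bound (D_lt P).
  have : k %/ 2 != x by apply: contraTneq P => ->; rewrite x_new.
  lia.
rewrite /encloses O; suff xk : x < k %/ 2 -> x < block (k %/ 2) by apply/idP/idP; lia.
move=> lk; rewrite ltnNge; apply/negP => lb.
case/boundaryP: P => [/block_offset0|[d ld [/orP[Dd|/eqP dx] Rd]]]; [lia| |lia].
by have := same _ Dd; rewrite encloses_lo /encloses O /covers Rd; lia.
Qed.

Lemma home_lt_lo : home < lo.
Proof.
case: (piece_ofP D x) => g _ Dg; last lia.
have gx : g != x by apply: contraTneq Dg => ->; rewrite x_new.
by rewrite /covers; lia.
Qed.

Lemma home_lo_adjacent k : piece D k -> same_marks D k lo -> ~~ (home < k < lo).
Proof.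
move=> P same; apply/negP => lk; have Ph := piece_piece_of D (ltnW x_lt).
have bk : block (k %/ 2) = block x.
  have := block_piece_of D x => b0; apply: block_eq; have := block_le (home %/ 2); rewrite b0.
  by have := block_gt x; lia.
suff : k = home by lia.
apply: (piece_uniq D_lt) => //; first by rewrite bk block_piece_of.
by move=> d Dd; rewrite same // encloses_lo encloses_home.
Qed.

Lemma end_piece_hi_adjacent k : end_splits -> piece D k -> same_marks D k lo ->
  ~~ (end_piece < k < hi).
Proof.
move=> sp P same; apply/negP => lk; have Pe := piece_end_piece sp.
have [g [Ee bg _ _ _]] := end_pieceP sp.
have bk : block (k %/ 2) = block (R x).
  by apply: block_eq; have := block_le g; have := block_gt (R x); move: lk; rewrite Ee; lia.
suff : k = end_piece by lia.
apply: (piece_uniq D_lt) => //; first by rewrite bk Ee nodeE.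
by move=> d Dd; rewrite same // encloses_lo encloses_end_piece.
Qed.

End Cut.

(** * Locating pieces and answering queries *)

Definition block_masks (f : nat -> bool) (m : nat -> nat) : Prop :=
  forall b, b <= N -> block b = b -> m b = mask B (fun o => f (b + o)).

Definition piece_bits (D : nat -> bool) (k : nat) (f : nat -> bool) : Prop :=
  forall o, o < B -> block (k %/ 2) + o < N ->
    f o = (piece_of D (block (k %/ 2) + o) == k).

Definition piece_mask (D : nat -> bool) (k m : nat) : Prop :=
  exists2 f, m = mask B f & piece_bits D k f.

Record static_tables (s : state) : Prop := StaticTables {
  static_B : var s vB = B;
  static_end : forall x, x < N -> arr s aEnd x = R x;
  static_anc : forall x, x < N ->
    arr s aAnc x = mask B (fun o => covers (block x + o) x);
  static_top : top_table B (arr s aTop);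
  static_pop : pop_table B (arr s aPop) }.

Record mask_tables (D wt : nat -> bool) (s : state) : Prop := MaskTables {
  marks_mask : block_masks D (arr s aMark);
  bounds_mask : block_masks (boundary D) (arr s aBound);
  weights_mask : block_masks wt (arr s aBits);
  pieces_mask : forall k, piece D k -> piece_mask D k (arr s aPiece k) }.

Lemma static_unchanged c s s' : unchanged c s s' -> vB \notin assigned c ->
  ~~ has (mem (stored c)) [:: aEnd; aAnc; aTop; aPop] -> static_tables s -> static_tables s'.
Proof.
move=> U nB; rewrite /= !negb_or => /and5P[nE nA nT nP _] [sB sE sA sT sP].
by split; rewrite ?(same_var U) ?(same_arr U).
Qed.

Lemma block_masks_eq f g m : f =1 g -> block_masks f m -> block_masks g m.
Proof. by move=> fg masks b bN bb; rewrite masks //; apply: eq_mask => o _; apply: fg. Qed.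

Lemma block_masks_at f m x : block_masks f m -> x <= N ->
  m (block x) = mask B (fun o => f (block x + o)).
Proof. by move=> masks xN; apply: masks; rewrite ?block_id // (leq_trans (block_le x)). Qed.

Lemma block_masks_upd f g m x y : block_masks f m ->
  (forall z, z != x -> g z = f z) -> y = mask B (fun o => g (block x + o)) ->
  block_masks g (upd m (block x) y).
Proof.
move=> masks gf -> b bN bb; rewrite /upd; case: eqP => [->//|nb]; rewrite masks //.
apply: eq_mask => o lo; rewrite gf //; apply/eqP => E.
by apply: nb; rewrite -E -bb block_add.
Qed.

Lemma mask_block_set f x : f x = false ->
  mask B (fun o => f (block x + o)) + 2 ^ offset x =
  mask B (fun o => f (block x + o) || (block x + o == x)).
Proof.
move=> fx; rewrite mask_set ?offset_lt //; last by rewrite -block_offset.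
by apply: eq_mask => o _; rewrite eq_block_add.
Qed.

Lemma block_masks_set f m x : block_masks f m -> x <= N -> f x = false ->
  block_masks (fun y => f y || (y == x)) (upd m (block x) (m (block x) + 2 ^ offset x)).
Proof.
move=> masks xN fx; apply: (block_masks_upd masks) => [z /negbTE->|]; first by rewrite orbF.
by rewrite (block_masks_at masks) // mask_block_set.
Qed.

Variables (w : nat) (due : nat -> nat).
Hypothesis B_le : 2 ^ B <= N + 1.
Hypothesis W_ge : 1024 * (N + 2) <= 2 ^ w.
Local Notation wp := (wp w due).

Lemma expB i : i <= B -> 0 < 2 ^ i <= N + 1.
Proof. by move=> iB; rewrite expn_gt0 /=; apply: leq_trans B_le; rewrite leq_exp2l. Qed.

Lemma mask_leN f : mask B f <= N.
Proof. by have := mask_lt B f; lia. Qed.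

Lemma block_leN x : x <= N -> block x <= N.
Proof. exact: leq_trans (block_le x). Qed.

Section Locate.

Variables (D wt : nat -> bool) (s : state) (x : nat).
Hypotheses (st : static_tables s) (mt : mask_tables D wt s) (x_lt : x < N) (x_var : var s vX = x).

Local Notation inner_mask := (mask B (fun o => covers (block x + o) x && D (block x + o))).
Local Notation bound_mask := (mask (offset x).+1 (fun o => boundary D (block x + o))).

Lemma anc_land_mark : Nat.land (arr s aAnc x) (arr s aMark (block x)) = inner_mask.
Proof. by rewrite (static_anc st) // (block_masks_at (marks_mask mt) (ltnW x_lt)) mask_land. Qed.

Lemma top_inner_eq : top B (fun o => covers (block x + o) x && D (block x + o)) =
  top B (fun i => D (block x + i) && covers (block x + i) x).
Proof. by apply: eq_bigl => i; rewrite andbC. Qed.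

Lemma top_inner : arr s aTop inner_mask =
  top B (fun i => D (block x + i) && covers (block x + i) x).
Proof.
by rewrite (top_table_mask _ (static_top st)) // top_inner_eq.
Qed.

Lemma bound_mod : arr s aBound (block x) %% (1 * 2 ^ (offset x + 1)) = bound_mask.
Proof.
by rewrite (block_masks_at (bounds_mask mt) (ltnW x_lt)) mul1n addn1 mask_mod ?offset_lt.
Qed.

Lemma locate_spec : wp locate_cmd s 0 (fun s' =>
  [/\ var s' vBlock = block x, var s' vOff = offset x & var s' vPiece = piece_of D x]).
Proof.
have Ex := block_offset x; have oB := offset_lt x.
apply: wp_seq0; apply: (wp_assign (v := offset x)) => //; first by eval_simpl;
  rewrite x_var (static_B st).
apply: wp_seq0; apply: (wp_assign (v := block x)); [eval_simpl; lia | eval_simpl; lia |].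
apply: wp_seq0; apply: (wp_assign (v := inner_mask)).
- by eval_simpl; rewrite x_var; lia.
- by eval_simpl; rewrite x_var anc_land_mark.
have TI := top_inner; have lI := mask_leN (fun o => covers (block x + o) x && D (block x + o)).
have topB := top_le B (fun i => D (block x + i) && covers (block x + i) x).
have BN : B < N + 2 by have := ltn_expl B (isT : 1 < 2); lia.
apply: (wp_if (b := inner_mask != 0)) => //; rewrite mask_eq0 top_inner_eq => top_inner0.
  apply: (wp_assign (v := piece_of D x)) => //; eval_simpl; rewrite TI; first lia.
  by rewrite /piece_of; case: (top B _) top_inner0 => //= i _; lia.
have topE := top_le (offset x).+1 (fun o => boundary D (block x + o)).
have top0 : 0 < top (offset x).+1 (fun o => boundary D (block x + o)).
  by apply: (top_gt0 (i := 0)) => //; rewrite addn0 boundary_block.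
have lE := mask_lt (offset x).+1 (fun o => boundary D (block x + o)).
have expo := expB oB.
apply: (wp_assign (v := piece_of D x)) => //; eval_simpl;
  rewrite bound_mod (top_table_mask _ (static_top st) oB) ?addn1.
  by lia.
by rewrite /piece_of (eqP (negbNE top_inner0)); lia.
Qed.

End Locate.

(** * The invariant *)

Definition is_label (D : nat -> bool) (c : nat) : bool := (c == 0) || D c.

Definition classes (D : nat -> bool) (lab : nat -> nat) : Prop :=
  forall k k', piece D k -> piece D k' -> (lab k = lab k' <-> same_marks D k k').

Definition sums (D wt : nat -> bool) (lab tot : nat -> nat) : Prop :=
  forall c, is_label D c -> tot c = \sum_(0 <= y < N | lab (piece_of D y) == c) wt y.

Local Notation nnodes := (2 * N + 2).

Record data_invariant (D wt : nat -> bool) (s : state) : Prop := DataInvariant {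
  inv_D : forall d, D d -> 0 < d < N;
  inv_wt : forall y, wt y -> y < N;
  inv_static : static_tables s;
  inv_masks : mask_tables D wt s;
  inv_rings : class_rings nnodes (piece D) (arr s aLabel) (arr s aNext) (arr s aPrev);
  inv_classes : classes D (arr s aLabel);
  inv_labels : forall k, piece D k -> is_label D (arr s aLabel k);
  inv_sums : sums D wt (arr s aLabel) (arr s aSum) }.

Lemma data_invariant_unchanged c D wt s s' : unchanged c s s' -> vB \notin assigned c ->
  stored c = [::] ->
  data_invariant D wt s -> data_invariant D wt s'.
Proof.
move=> U nB noS [? ? [? ? ? ? ?] [? ? ? ?] ? ? ? ?].
have aE i : arr s' i = arr s i by rewrite (same_arr U) // noS.
by split=> //; rewrite ?aE //; split; rewrite ?aE ?(same_var U).
Qed.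

Definition same_side (D : nat -> bool) (x y : nat) : bool :=
  all (fun d => D d ==> (covers d x == covers d y)) (iota 0 N).

Lemma same_sideP (D : nat -> bool) x y : (forall d, D d -> d < N) ->
  reflect (forall d, D d -> covers d x = covers d y) (same_side D x y).
Proof.
move=> D_lt; apply: (iffP allP) => same d; last by move=> _; apply/implyP => /same->.
by move=> Dd; have := same d; rewrite mem_iota Dd (D_lt d Dd) => /(_ isT)/eqP.
Qed.

Lemma sum_pred_eq (wt P P' : nat -> bool) : (forall y, y < N -> P y = P' y) ->
  \sum_(0 <= y < N | P y) wt y = \sum_(0 <= y < N | P' y) wt y.
Proof.
move=> PP'; rewrite big_nat_cond [RHS]big_nat_cond; apply: eq_bigl => y.
by case: (ltnP y N) => ly; rewrite ?andbF //= PP'.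
Qed.

Lemma sum_wt_le (wt P : nat -> bool) : \sum_(0 <= y < N | P y) wt y <= N.
Proof.
apply: leq_trans (_ : \sum_(0 <= y < N) 1 <= N); last by rewrite sum_nat_const_nat subn0 muln1.
by rewrite big_mkcond; apply: leq_sum => y _; case: (P y); case: (wt y).
Qed.

Lemma sum_set_wt (P wt : nat -> bool) x v : x < N -> P x ->
  \sum_(0 <= y < N | P y) set_wt wt x v y + wt x = \sum_(0 <= y < N | P y) wt y + v.
Proof.
move=> lx Px; rewrite !big_mkord !(bigD1 (Ordinal lx) Px) /= /set_wt eqxx.
set S' := \sum_(i < N | _) _; set S := \sum_(i < N | _) _; suff -> : S' = S by lia.
by apply: eq_bigr => i /andP[_ /negbTE]; rewrite -val_eqE /= => ->.
Qed.

Section Queries.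

Variables (D wt : nat -> bool) (s : state) (x : nat).
Hypotheses (inv_s : data_invariant D wt s) (x_lt : x < N) (x_var : var s vX = x).

Let D_lt d : D d -> d < N. Proof. by move/(inv_D inv_s) => /andP[]. Qed.

Lemma same_label y z : y <= N -> z <= N ->
  (arr s aLabel (piece_of D y) == arr s aLabel (piece_of D z)) = same_side D y z.
Proof.
move=> ly lz; have Py := piece_piece_of D ly; have Pz := piece_piece_of D lz.
apply/eqP/same_sideP => // [/(inv_classes inv_s Py Pz) same d Dd|same].
  by rewrite !(covers_piece_of D_lt) // same.
by apply/(inv_classes inv_s Py Pz) => d Dd; rewrite -!(covers_piece_of D_lt) // same.
Qed.

Lemma label_of : is_label D (arr s aLabel (piece_of D x)) /\ arr s aLabel (piece_of D x) < N.
Proof.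
have lb := inv_labels inv_s (piece_piece_of D (ltnW x_lt)); split=> //.
by case/orP: lb => [/eqP->|/D_lt//]; apply: leq_ltn_trans x_lt.
Qed.

Lemma query_spec : wp query_cmd s 0 (fun s' => data_invariant D wt s' /\
  output s' = rcons (output s) (\sum_(0 <= y < N | same_side D y x) wt y)).
Proof.
apply: wp_then0 (locate_spec (inv_static inv_s) (inv_masks inv_s) x_lt x_var) _ => s1 U [_ _ pE].
have [lD lN] := label_of; have Px := piece_le (piece_piece_of D (ltnW x_lt)).
have aE i : arr s1 i = arr s i by rewrite (same_arr U).
apply: wp_write; first by eval_simpl; rewrite pE !aE; lia.
split; first by apply: (data_invariant_unchanged (unchanged_write #0 s1 _)) => //;
  apply: data_invariant_unchanged U _ _ inv_s.
rewrite /= (same_output U) // pE !aE (inv_sums inv_s lD); congr rcons.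
by apply: sum_pred_eq => y ly; rewrite same_label // ltnW.
Qed.

Lemma bit_weight : arr s aBits (block x) %/ (1 * 2 ^ offset x) %% 2 = wt x.
Proof.
have oB := offset_lt x.
by rewrite (block_masks_at (weights_mask (inv_masks inv_s)) (ltnW x_lt)) mul1n mask_bit //
  -block_offset.
Qed.

Lemma mask_set_wt (v : bool) : mask B (fun o => wt (block x + o)) + v * 2 ^ offset x =
  mask B (fun o => set_wt wt x v (block x + o)) + wt x * 2 ^ offset x.
Proof.
pose f0 y := wt y && (y != x); have f0x : f0 x = false by rewrite /f0 eqxx andbF.
have split_bit (u : bool) g : (forall y, g y = if y == x then u else wt y) ->
    mask B (fun o => g (block x + o)) = mask B (fun o => f0 (block x + o)) + u * 2 ^ offset x.
  move=> gE; case: u gE => gE; rewrite ?mul1n ?mul0n ?addn0 ?mask_block_set //;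
    apply: eq_mask => o _; rewrite gE /f0; by case: eqP; rewrite ?andbT ?andbF ?orbF ?orbT.
rewrite (split_bit (wt x)) => [|y]; last by case: eqP => [->|].
by rewrite (split_bit v (set_wt wt x v)) // addnAC.
Qed.

Local Notation label := (arr s aLabel (piece_of D x)).

Lemma update_effect (v : bool) : var s vRec2 = v -> wp update_cmd s 0 (fun s' =>
  arr s' aSum = upd (arr s aSum) label (arr s aSum label + v - wt x) /\
  arr s' aBits = upd (arr s aBits) (block x) (mask B (fun o => set_wt wt x v (block x + o)))).
Proof.
move=> vE; apply: wp_then0 (locate_spec (inv_static inv_s) (inv_masks inv_s) x_lt x_var) _.
move=> s1 U [bE oE pE]; have [lD lN] := label_of;
  have Px := piece_le (piece_piece_of D (ltnW x_lt)).
have aE i : arr s1 i = arr s i by rewrite (same_arr U).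
have v1 : var s1 vRec2 = v by rewrite (same_var U).
have bN := block_leN (ltnW x_lt); have oB := expB (ltnW (offset_lt x)).
have wE := block_masks_at (weights_mask (inv_masks inv_s)) (ltnW x_lt).
apply: wp_seq0; apply: (wp_assign (v := label));
  [by eval_simpl; rewrite pE; lia | by eval_simpl; rewrite pE aE |].
apply: wp_seq0; apply: (wp_assign (v := wt x)).
- by eval_simpl; rewrite bE oE; lia.
- by eval_simpl; rewrite bE oE aE bit_weight.
have tN : arr s aSum label <= N by rewrite (inv_sums inv_s lD); apply: sum_wt_le.
have tE := sum_set_wt wt v x_lt (eqxx label : (fun y => arr s aLabel (piece_of D y) == label) x).
rewrite -(inv_sums inv_s lD) in tE.
apply: wp_seq0; apply: (wp_store (a := label) (v := arr s aSum label + v - wt x)) => //.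
- by eval_simpl; rewrite !aE v1; lia.
- by eval_simpl; rewrite !aE v1.
have mE := mask_set_wt v; have mN := mask_leN (fun o => wt (block x + o)).
apply: (wp_store (a := block x) (v := mask B (fun o => set_wt wt x v (block x + o)))) => //.
- by eval_simpl; rewrite bE oE !aE v1 wE; case: (v) mE; case: (wt x); lia.
- by eval_simpl; rewrite bE oE !aE v1 wE mE addnK.
- by split; eval_simpl; rewrite aE.
Qed.

Lemma update_spec (v : bool) : var s vRec2 = v ->
  wp update_cmd s 0 (data_invariant D (set_wt wt x v)).
Proof.
move=> vE; apply: wp_mono (update_effect vE) (leqnn _) _ => s' U [sumE bitsE].
have [iD iwt ist [mm mb mw mp] ir ic il tots] := inv_s.
have labE : arr s' aLabel = arr s aLabel by rewrite (same_arr U).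
split; rewrite ?labE //.
- by move=> y; rewrite /set_wt; case: eqP => [->|_ /iwt].
- exact: static_unchanged U _ _ ist.
- split; [by rewrite (same_arr U) | by rewrite (same_arr U) | rewrite bitsE
  | by rewrite (same_arr U)].
  by apply: block_masks_upd mw _ _ => // z /negbTE; rewrite /set_wt => ->.
- by rewrite !(same_arr U).
move=> c cD; rewrite sumE /upd; case: (c =P label) => [->|/eqP nc].
  have := sum_set_wt wt v x_lt (eqxx label : (fun y => arr s aLabel (piece_of D y) == label) x).
  by rewrite -(tots _ (proj1 label_of)) => <-; rewrite addnK.
rewrite (tots _ cD) big_mkcond [RHS]big_mkcond; apply: eq_bigr => y _.
case: eqP => // cE; rewrite /set_wt ifF //; apply/eqP => yx.
by rewrite -cE yx eqxx in nc.
Qed.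

End Queries.

(** * Marking an interval *)

Lemma insert_effect p y s k k' c : p != vT -> y != vT -> var s p = k -> var s y = k' ->
  var s vClass = c -> k <= 2 * N + 1 -> k' <= 2 * N + 1 -> arr s aNext k <= 2 * N + 1 ->
  wp (insert_cmd p y) s 0 (fun s' =>
    [/\ arr s' aNext = insert_next (arr s aNext) k k',
        arr s' aPrev = insert_prev (arr s aNext) (arr s aPrev) k k' &
        arr s' aLabel = upd (arr s aLabel) k' c]).
Proof.
move=> /negbTE np /negbTE ny pE yE cE lk lk' ln.
apply: wp_seq0; apply: (wp_assign (v := arr s aNext k));
  [eval_simpl; rewrite pE; lia | by eval_simpl; rewrite pE |].
apply: wp_seq0; apply: (wp_store (a := k) (v := k')); eval_simpl; rewrite ?np ?ny //; first lia.
apply: wp_seq0; apply: (wp_store (a := k') (v := arr s aNext k)); eval_simpl; rewrite ?np ?ny //;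
  first lia.
apply: wp_seq0; apply: (wp_store (a := k') (v := k)); eval_simpl; rewrite ?np ?ny //; first lia.
apply: wp_seq0; apply: (wp_store (a := arr s aNext k) (v := k')); eval_simpl; rewrite ?np ?ny //;
  first lia.
by apply: (wp_store (a := k') (v := c)); eval_simpl; rewrite ?np ?ny //; lia.
Qed.

Section MarkInterval.

Variables (D wt : nat -> bool) (x : nat).
Hypothesis D_lt : forall d, D d -> d < N.
Hypotheses (x_lt : x < N) (x_new : D x = false).

Local Notation home := (piece_of D x).
Local Notation lo := (inner_node x).
Local Notation hi := (outer_node (R x)).
Local Notation tail := (end_piece D x).
Local Notation splits := (end_splits D x).
Local Notation D' := (mark D x).

Let x_bound := R_bound x_lt.
Let home_le : home <= 2 * N + 1 := piece_le (piece_piece_of D (ltnW x_lt)).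

Lemma piece_bits_home f : piece_bits D home f ->
  piece_bits D' home (fun o => f o && ~~ covers x (block x + o)).
Proof.
rewrite /piece_bits block_piece_of => fE o lo lN.
by rewrite (piece_of_mark_home D_lt x_lt x_new (ltnW lN)) fE.
Qed.

Lemma piece_bits_lo f : piece_bits D home f ->
  piece_bits D' lo (fun o => f o && covers x (block x + o)).
Proof.
rewrite /piece_bits block_piece_of nodeE => fE o lo lN.
by rewrite (piece_of_mark_lo D_lt x_lt x_new (ltnW lN)) fE.
Qed.

Lemma block_tail : splits -> block (tail %/ 2) = block (R x).
Proof. by move=> sp; have [g [-> bg _ _ _]] := end_pieceP x_lt x_new sp; rewrite nodeE. Qed.

Lemma lt_end_offset o : (o < offset (R x)) = (block (R x) + o < R x).
Proof. by rewrite -(ltn_add2l (block (R x))) -block_offset. Qed.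

Lemma piece_bits_tail f : splits -> piece_bits D tail f ->
  piece_bits D' tail (fun o => f o && (o < offset (R x))).
Proof.
move=> sp; rewrite /piece_bits block_tail // => fE o lo lN.
by rewrite (piece_of_mark_end_piece D_lt x_lt x_new (ltnW lN)) // fE // lt_end_offset.
Qed.

Lemma piece_bits_hi f : splits -> piece_bits D tail f ->
  piece_bits D' hi (fun o => f o && ~~ (o < offset (R x))).
Proof.
move=> sp; rewrite /piece_bits block_tail // nodeE => fE o lo lN.
by rewrite (piece_of_mark_hi D_lt x_lt x_new (ltnW lN)) // fE // lt_end_offset -leqNgt.
Qed.

Lemma piece_bits_other k f : piece D k -> k != home -> ~~ (splits && (k == tail)) ->
  piece_bits D k f -> piece_bits D' k f.
Proof.
move=> Pk kh kt fE o lo lN.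
by rewrite (piece_of_mark_other D_lt x_lt x_new (ltnW lN)) // fE.
Qed.

Lemma ends_effect s : static_tables s -> var s vX = x -> var s vPiece = home ->
  wp ends_cmd s 0 (fun s' =>
    [/\ var s' vEndBlock = block (R x), var s' vEndOff = offset (R x), var s' vLo = lo,
        var s' vHi = hi & var s' vClass = arr s aLabel home]).
Proof.
move=> st xE pE; have ER := block_offset (R x).
apply: wp_seq0; apply: (wp_assign (v := R x));
  [eval_simpl; rewrite xE; lia | by eval_simpl; rewrite xE (static_end st) |].
apply: wp_seq0; apply: (wp_assign (v := offset (R x))) => //;
  first by eval_simpl; rewrite (static_B st).
apply: wp_seq0; apply: (wp_assign (v := block (R x))); [eval_simpl; lia | eval_simpl; lia |].
apply: wp_seq0; apply: (wp_assign (v := lo));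
  [eval_simpl; rewrite xE; lia | by eval_simpl; rewrite xE |].
apply: wp_seq0; apply: (wp_assign (v := hi)); [by eval_simpl; lia | by [] |].
apply: (wp_assign (v := arr s aLabel home)); [eval_simpl; rewrite pE; lia | by eval_simpl;
  rewrite pE | by []].
Qed.

Record located (s : state) : Prop := Located {
  loc_static : static_tables s;
  loc_block : var s vBlock = block x;
  loc_off : var s vOff = offset x;
  loc_home : var s vPiece = home;
  loc_end_block : var s vEndBlock = block (R x);
  loc_end_off : var s vEndOff = offset (R x);
  loc_lo : var s vLo = lo;
  loc_hi : var s vHi = hi }.

Lemma located_unchanged c s s' : unchanged c s s' ->
  ~~ has (mem (assigned c)) [:: vB; vBlock; vOff; vPiece; vEndBlock; vEndOff; vLo; vHi] ->
  ~~ has (mem (stored c)) [:: aEnd; aAnc; aTop; aPop] -> located s -> located s'.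
Proof.
move=> U nV nA [st *]; move: nV; rewrite /= !negb_or => /and5P[nB n1 n2 n3 /and5P[n4 n5 n6 n7 _]].
split; rewrite ?(same_var U) //; exact: static_unchanged U nB nA st.
Qed.

Local Notation home_end := (if block x == block (R x) then offset (R x) else B).

Lemma home_end_bounds : offset x <= home_end <= B.
Proof.
have ER := block_offset (R x); have Ex := block_offset x.
by case: eqP => [e|_]; [have := offset_lt (R x) | have := offset_lt x]; lia.
Qed.

Lemma covers_home o : o < B -> covers x (block x + o) = (offset x <= o < home_end).
Proof.
move=> oB; rewrite /covers {1}[x]block_offset leq_add2l; congr (_ && _).
case: (altP eqP) => [->|ne]; first by rewrite lt_end_offset.
rewrite oB; apply: leq_trans (block_le (R x)); apply: ltn_block; rewrite block_add //.
by rewrite ltn_neqAle ne leq_block //; lia.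
Qed.

Local Notation carved f := (mask B (fun o => f o && covers x (block x + o))).
Local Notation kept f := (mask B (fun o => f o && ~~ covers x (block x + o))).

Lemma carve_home f : mask home_end f - mask (offset x) f = carved f /\
  mask (offset x) f <= mask home_end f.
Proof.
have he := home_end_bounds; split; last by apply: leq_mask; case/andP: he.
by rewrite (mask_range f he); apply: eq_mask => o oB; rewrite covers_home.
Qed.

Lemma home_end_effect s : located s ->
  wp (If ($vBlock == $vEndBlock) (vT <-- $vEndOff) (vT <-- $vB))%X s 0
     (fun s' => var s' vT = home_end).
Proof.
case=> st bE _ _ ebE eoE _ _; apply: (wp_if (b := block x == block (R x))) => //=.
- by rewrite bE ebE; case: (block x == _).
- by move=> bb; apply: (wp_assign (v := home_end)) => //=; rewrite eoE bb.
- by move=> bb; apply: (wp_assign (v := home_end)) => //=; rewrite (static_B st) (negbTE bb).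
Qed.

Lemma split_home_effect s f : located s -> arr s aPiece home = mask B f ->
  arr s aMark (block x) <= N ->
  wp split_home_cmd s 0 (fun s' =>
    arr s' aPiece = upd (upd (arr s aPiece) lo (carved f)) home (kept f) /\
    arr s' aMark = upd (arr s aMark) (block x) (arr s aMark (block x) + 2 ^ offset x)).
Proof.
move=> L fE mN; have he := home_end_bounds.
apply: wp_then0 (home_end_effect L) _ => s1 U tE.
have {L}[_ bE oE pE _ _ loE _] := L; have fID := maskID B f (fun o => covers x (block x + o)).
have aE i : arr s1 i = arr s i by rewrite (same_arr U).
have vE y : y != vT -> var s1 y = var s y by move=> ny; rewrite (same_var U) // !inE orbb.
have eh := expB (proj2 (andP he)); have eo := expB (ltnW (offset_lt x)).
have [cE c_le] := carve_home f; have bN := block_leN (ltnW x_lt).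
apply: wp_seq0; apply: (wp_assign (v := mask B f)).
- by eval_simpl; rewrite vE // pE; lia.
- by eval_simpl; rewrite vE // pE aE.
apply: wp_seq0; apply: (wp_assign (v := carved f)).
- eval_simpl; rewrite tE !vE // oE !mul1n !mask_mod ?offset_lt //; lia.
- by eval_simpl; rewrite tE !vE // oE !mul1n !mask_mod //; lia.
apply: wp_seq0; apply: (wp_store (a := lo) (v := carved f)) => //.
- by eval_simpl; lia.
- by eval_simpl; rewrite vE // loE.
apply: wp_seq0; apply: (wp_store (a := home) (v := kept f)) => //.
- by eval_simpl; lia.
- by eval_simpl; rewrite vE // pE.
- by eval_simpl; lia.
apply: (wp_store (a := block x) (v := arr s aMark (block x) + 2 ^ offset x)) => //.
- by eval_simpl; rewrite !vE // bE oE !aE; lia.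
- by eval_simpl; rewrite vE // bE.
- by eval_simpl; rewrite !vE // bE oE !aE mul1n.
- by split; eval_simpl; rewrite aE.
Qed.

Lemma end_splits_effect s g : splits -> located s -> block_masks (boundary D) (arr s aBound) ->
  arr s aPiece tail = mask B g ->
  wp split_end_cmd s 0 (fun s' => [/\ var s' vEndPiece = tail,
    arr s' aPiece = upd (upd (arr s aPiece) tail (mask B (fun o => g o && (o < offset (R x)))))
                        hi (mask B (fun o => g o && ~~ (o < offset (R x)))) &
    arr s' aBound = upd (arr s aBound) (block (R x))
      (arr s aBound (block (R x)) + 2 ^ offset (R x))]).
Proof.
move=> sp [st _ _ _ bE oE _ hE] bm gE; have oB := ltnW (offset_lt (R x)).
have := end_splits_block x_lt x_new sp => /andP[_ lR]; have ER := block_offset (R x).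
have mE := block_masks_at bm (proj2 (andP x_bound)); have eo := expB oB.
have mN := mask_leN (fun o => boundary D (block (R x) + o)).
have tE := top_le (offset (R x)) (fun o => boundary D (block (R x) + o)).
have t0 : 0 < top (offset (R x)) (fun o => boundary D (block (R x) + o)).
  by apply: (top_gt0 (i := 0)); rewrite ?addn0 ?boundary_block //; lia.
have lE := mask_lt (offset (R x)) (fun o => boundary D (block (R x) + o)).
apply: wp_seq0; apply: (wp_assign (v := tail)).
- by eval_simpl; rewrite bE oE mE mul1n mask_mod // (top_table_mask _ (static_top st)) //; lia.
- by eval_simpl; rewrite bE oE mE mul1n mask_mod // (top_table_mask _ (static_top st)) //
  /end_piece -subn1.
have tail_lt := end_piece_lt x_lt x_new sp.
apply: wp_seq0; apply: (wp_assign (v := mask B g)) => //; first by eval_simpl; lia.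
apply: wp_seq0; apply: (wp_assign (v := mask B (fun o => g o && (o < offset (R x))))).
- by eval_simpl; rewrite oE; lia.
- by eval_simpl; rewrite oE mul1n mask_mod // mask_lo.
apply: wp_seq0; apply: (wp_store (a := tail)) => //; first by eval_simpl; lia.
have gID := maskID B g (fun o => o < offset (R x)).
apply: wp_seq0; apply: (wp_store (a := hi)
  (v := mask B (fun o => g o && ~~ (o < offset (R x))))) => //.
- by eval_simpl; lia.
- by eval_simpl; lia.
apply: (wp_store (a := block (R x)) (v := arr s aBound (block (R x)) + 2 ^ offset (R x))) => //.
- by eval_simpl; rewrite bE oE mE; lia.
- by eval_simpl; rewrite bE oE mul1n.
Qed.

Lemma end_effect s g : located s -> block_masks (boundary D) (arr s aBound) ->
  (splits -> arr s aPiece tail = mask B g /\ arr s aNext tail <= 2 * N + 1) ->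
  wp end_cmd s 0 (fun s' => if splits then [/\
    arr s' aPiece = upd (upd (arr s aPiece) tail (mask B (fun o => g o && (o < offset (R x)))))
                        hi (mask B (fun o => g o && ~~ (o < offset (R x)))),
    arr s' aBound = upd (arr s aBound) (block (R x))
      (arr s aBound (block (R x)) + 2 ^ offset (R x)),
    arr s' aNext = insert_next (arr s aNext) tail hi,
    arr s' aPrev = insert_prev (arr s aNext) (arr s aPrev) tail hi &
    arr s' aLabel = upd (arr s aLabel) hi (var s vClass)] else forall i, arr s' i = arr s i).
Proof.
move=> L bm gE; have [_ bE _ _ ebE eoE _ hE] := L; have oB := offset_lt (R x).
have mE := block_masks_at bm (proj2 (andP x_bound)); have eo := expB (ltnW oB).
have bN := block_leN (proj2 (andP x_bound)).
apply: (wp_if (b := block x == block (R x))) => //=.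
- by rewrite bE ebE; case: (block x == _).
- by move=> bb; rewrite /end_splits bb; apply: wp_skip.
move=> nb; apply: (wp_if (b := boundary D (R x))) => [||Bd|nBd].
- by eval_simpl; rewrite ebE eoE; lia.
- by eval_simpl; rewrite ebE eoE mE mul1n mask_bit // -block_offset; case: boundary.
- by rewrite /end_splits Bd andbF; apply: wp_skip.
have sp : splits by rewrite /end_splits nb nBd.
have [tE nE] := gE sp; rewrite sp; have tl := end_piece_lt x_lt x_new sp.
apply: wp_then0 (end_splits_effect sp L bm tE) _ => s1 U [pE aP aB].
have nxE : arr s1 aNext = arr s aNext by rewrite (same_arr U).
apply: wp_mono (insert_effect (k := tail) (k' := hi) _ _ _ _ erefl _ _ _) (leqnn _) _ => //.
- by rewrite (same_var U).
- by lia.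
- by lia.
- by rewrite nxE.
by move=> s2 V [-> -> ->]; rewrite !(same_arr V) // aP aB !(same_arr U) // (same_var U).
Qed.

Definition mark_next (nx : nat -> nat) : nat -> nat :=
  let nx1 := insert_next nx home lo in if splits then insert_next nx1 tail hi else nx1.

Definition mark_prev (nx pv : nat -> nat) : nat -> nat :=
  let pv1 := insert_prev nx pv home lo in
  if splits then insert_prev (insert_next nx home lo) pv1 tail hi else pv1.

Definition mark_label (lab : nat -> nat) : nat -> nat :=
  let lab1 := upd lab lo (lab home) in if splits then upd lab1 hi (lab home) else lab1.

Section MarkClasses.

Variables (lab nx pv : nat -> nat).
Hypotheses (rings : class_rings nnodes (piece D) lab nx pv) (lab_classes : classes D lab).

Local Notation old_label := (lab home).
Local Notation lab1 := (upd lab lo (lab home)).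
Local Notation piece_or_lo := (fun k => piece D k || (k == lo)).

Let home_piece : piece D home := piece_piece_of D (ltnW x_lt).

Lemma same_marks_lo k : piece D k -> lab k = old_label -> same_marks D k lo.
Proof.
move=> Pk /(lab_classes Pk home_piece) same d Dd.
by rewrite same // encloses_lo (encloses_home _ D_lt).
Qed.

Lemma mark_label_old k : piece D k -> mark_label lab k = lab k.
Proof.
move=> Pk; have nl : k != lo by apply: contraTneq Pk => ->; rewrite lo_new.
rewrite /mark_label /upd; case: ifP => [sp|_]; last by rewrite (negbTE nl).
by rewrite (negbTE nl) ifN //; apply: contraTneq Pk => ->; rewrite hi_new.
Qed.

Lemma mark_label_lo : mark_label lab lo = old_label.
Proof. by rewrite /mark_label /upd; case: ifP => _; rewrite ?inner_neq_outer eqxx. Qed.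

Lemma mark_label_hi : splits -> mark_label lab hi = old_label.
Proof. by move=> sp; rewrite /mark_label sp /upd eqxx. Qed.

Lemma home_insertion P' : (forall k, P' k = piece_or_lo k) ->
  insertion nnodes (piece D) lab home lo P'.
Proof.
move=> PE; split=> //; [exact: piece_lt | lia | by rewrite lo_new | |].
  exact: home_lt_lo.
by move=> k Pk labk; apply: (home_lo_adjacent D_lt x_lt x_new) => //; apply: same_marks_lo.
Qed.

Section Splits.

Hypothesis sp : splits.

Let tail_piece : piece D tail := piece_end_piece x_lt x_new sp.

Lemma label_tail : lab tail = old_label.
Proof.
apply/(lab_classes tail_piece home_piece) => d Dd.
by rewrite (encloses_end_piece D_lt x_lt x_new) // (encloses_home _ D_lt).
Qed.

Lemma label1_tail : lab1 tail = old_label.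
Proof.
by rewrite /upd ifN ?label_tail //; apply: contraTneq tail_piece => ->; rewrite lo_new.
Qed.

Lemma lo_le_tail : lo <= tail.
Proof.
have : encloses x tail by apply: encloses_new_end_piece.
rewrite (encloses_new_range D_lt x_lt x_new) => [/andP[]//||d Dd].
  by rewrite piece_mark // tail_piece.
by rewrite (encloses_end_piece D_lt x_lt x_new) // encloses_lo.
Qed.

Lemma tail_gap k : piece_or_lo k -> lab1 k = lab1 tail -> ~~ (tail < k < hi).
Proof.
rewrite label1_tail => /orP[Pk|/eqP->]; last by have := lo_le_tail; lia.
rewrite /upd ifN => [labk|]; last by apply: contraTneq Pk => ->; rewrite lo_new.
by apply: (end_piece_hi_adjacent D_lt x_lt x_new) => //; apply: same_marks_lo.
Qed.

Lemma tail_insertion : insertion nnodes piece_or_lo lab1 tail hi (piece D').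
Proof.
split; first by move=> k /orP[/piece_lt//|/eqP->]; lia.
- lia.
- by rewrite tail_piece.
- by rewrite hi_new // eq_sym inner_neq_outer.
- exact: end_piece_lt.
- exact: tail_gap.
- by move=> k; rewrite piece_mark // sp orbA.
Qed.

End Splits.

Lemma no_split_insertion : ~~ splits -> insertion nnodes (piece D) lab home lo (piece D').
Proof. by move=> /negbTE sp; apply: home_insertion => k; rewrite piece_mark // sp orbF. Qed.

Lemma mark_rings : class_rings nnodes (piece D') (mark_label lab) (mark_next nx) (mark_prev nx pv).
Proof.
rewrite /mark_label /mark_next /mark_prev; case: ifP => [sp|/negbT sp].
  rewrite -[X in upd _ hi X]label1_tail //; apply: class_rings_insert (tail_insertion sp) _.
  exact: class_rings_insert (home_insertion _) rings.
exact: class_rings_insert (no_split_insertion sp) rings.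
Qed.

Lemma mark_class_list_other c : c != old_label ->
  class_list nnodes (piece D') (mark_label lab) c = class_list nnodes (piece D) lab c.
Proof.
move=> nc; rewrite /mark_label; case: ifP => [sp|/negbT sp].
  rewrite -[X in upd _ hi X]label1_tail // (class_list_insert_other (tail_insertion sp))
    ?label1_tail //.
  by rewrite (class_list_insert_other (home_insertion (fun k => erefl (piece_or_lo k))) nc).
by rewrite (class_list_insert_other (no_split_insertion sp) nc).
Qed.

Lemma size_mark_class_list : size (class_list nnodes (piece D') (mark_label lab) old_label) =
  size (class_list nnodes (piece D) lab old_label) + 1 + splits.
Proof.
rewrite /mark_label; case: ifP => [sp|/negbT sp].
  rewrite -{2 3}(label1_tail sp) (size_class_list_insert (tail_insertion sp)) label1_tail //.
  by rewrite (size_class_list_insert (home_insertion _)) // !addn1.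
by rewrite (size_class_list_insert (no_split_insertion sp)) addn0 addn1.
Qed.

End MarkClasses.

Definition mark_pieces (f g : nat -> bool) (m : nat -> nat) : nat -> nat :=
  let m1 := upd (upd m lo (carved f)) home (kept f) in
  if splits then upd (upd m1 tail (mask B (fun o => g o && (o < offset (R x)))))
                     hi (mask B (fun o => g o && ~~ (o < offset (R x)))) else m1.

Lemma mark_pieces_mask f g m : piece_bits D home f -> (splits -> piece_bits D tail g) ->
  (forall k, piece D k -> piece_mask D k (m k)) ->
  forall k, piece D' k -> piece_mask D' k (mark_pieces f g m k).
Proof.
move=> fE gE mE k; have Ph := piece_piece_of D (ltnW x_lt).
have lh : home != lo by apply: contraTneq Ph => ->; rewrite lo_new.
have old k' : piece D k' -> ~~ (splits && (k' == tail)) ->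
    piece_mask D' k' (upd (upd m lo (carved f)) home (kept f) k').
  move=> Pk kt; have kl : k' != lo by apply: contraTneq Pk => ->; rewrite lo_new.
  rewrite /upd (negbTE kl); case: (altP (k' =P home)) => [->|kh].
    by eexists; first reflexivity; apply: piece_bits_home.
  by have [f' mE' fE'] := mE k' Pk; exists f'; last exact: piece_bits_other.
have new_lo : piece_mask D' lo (upd (upd m lo (carved f)) home (kept f) lo).
  rewrite /upd eq_sym (negbTE lh) eqxx.
  by eexists; first reflexivity; apply: piece_bits_lo.
rewrite piece_mark // /mark_pieces; case sp: splits => /=; last first.
  by rewrite orbF => /orP[Pk|/eqP->] //; apply: old; rewrite ?sp.
rewrite {1 2}/upd; case: (k =P hi) => [-> _|_].
  by eexists; first reflexivity; apply: piece_bits_hi => //; apply: gE.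
case: (k =P tail) => [-> _|/eqP kt].
  by eexists; first reflexivity; apply: piece_bits_tail => //; apply: gE.
by rewrite orbF => /orP[Pk|/eqP->] //; apply: old; rewrite ?(negbTE kt) ?andbF.
Qed.

Definition mark_bounds (m : nat -> nat) : nat -> nat :=
  if splits then upd m (block (R x)) (m (block (R x)) + 2 ^ offset (R x)) else m.

Lemma mark_bounds_mask m : block_masks (boundary D) m -> block_masks (boundary D') (mark_bounds m).
Proof.
move=> bm; rewrite /mark_bounds; case: ifP => sp.
  apply: (block_masks_eq (f := fun g => boundary D g || (g == R x))) => [g|].
    by rewrite boundary_mark // sp.
  by apply: block_masks_set bm _ _; [case/andP: x_bound | case/andP: sp => _ /negbTE].
by apply: block_masks_eq bm => g; rewrite boundary_mark // sp orbF.
Qed.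

Record marked (s s' : state) : Prop := Marked {
  marked_static : static_tables s';
  marked_masks : mask_tables D' wt s';
  marked_home : var s' vPiece = home;
  marked_lo : var s' vLo = lo;
  marked_hi : var s' vHi = hi;
  marked_class : var s' vClass = arr s aLabel home;
  marked_next : arr s' aNext = mark_next (arr s aNext);
  marked_prev : arr s' aPrev = mark_prev (arr s aNext) (arr s aPrev);
  marked_label : arr s' aLabel = mark_label (arr s aLabel) }.

Lemma locate_ends_effect s : static_tables s -> mask_tables D wt s -> var s vX = x ->
  wp locate_ends_cmd s 0 (fun s' => located s' /\ var s' vClass = arr s aLabel home).
Proof.
move=> st mt xE; apply: wp_then0 (locate_spec st mt x_lt xE) _ => s1 U [bE oE hE].
have st1 := static_unchanged U isT isT st; have xE1 : var s1 vX = x by rewrite (same_var U).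
apply: wp_mono (ends_effect st1 xE1 hE) (leqnn _) _ => s2 V [ebE eoE lE rE cE].
split; last by rewrite cE (same_arr U).
by split=> //; rewrite ?(same_var V) //; apply: static_unchanged V _ _ st1.
Qed.

Lemma next_le lab nx pv k : class_rings nnodes (piece D) lab nx pv -> piece D k ->
  nx k <= 2 * N + 1.
Proof.
move=> rings Pk; have kC : k \in class_list nnodes (piece D) lab (lab k).
  by rewrite mem_filter Pk eqxx mem_iota /=; have := piece_le Pk; lia.
by have [] := ring_mem (rings _) kC; rewrite mem_filter mem_iota; lia.
Qed.

Lemma mark_effect s f g : static_tables s -> mask_tables D wt s -> var s vX = x ->
  arr s aPiece home = mask B f -> arr s aNext home <= 2 * N + 1 ->
  (splits -> arr s aPiece tail = mask B g /\ arr s aNext tail <= 2 * N + 1) ->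
  wp mark_cmd s 0 (fun s' => [/\ located s', var s' vClass = arr s aLabel home,
    arr s' aMark = upd (arr s aMark) (block x) (arr s aMark (block x) + 2 ^ offset x) &
    arr s' aBound = mark_bounds (arr s aBound)] /\ [/\
    arr s' aPiece = mark_pieces f g (arr s aPiece), arr s' aNext = mark_next (arr s aNext),
    arr s' aPrev = mark_prev (arr s aNext) (arr s aPrev) &
    arr s' aLabel = mark_label (arr s aLabel)]).
Proof.
move=> st mt xE fE nE gE.
apply: wp_then0 (locate_ends_effect st mt xE) _ => s1 U1 [L1 cE1].
have aE1 i : arr s1 i = arr s i by rewrite (same_arr U1).
have Mx := block_masks_at (marks_mask mt) (ltnW x_lt).
apply: wp_then0 (split_home_effect L1 (f := f) _ _) _; rewrite ?aE1 ?Mx ?mask_leN // -Mx.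
move=> s2 U2 [pE2 mE2]; have L2 := located_unchanged U2 isT isT L1.
have C2 : var s2 vClass = arr s aLabel home by rewrite (same_var U2).
have nx2 : arr s2 aNext = arr s aNext by rewrite (same_arr U2).
apply: wp_then0 (insert_effect (k := home) (k' := lo) _ _ _ _ C2 _ _ _) _ => //.
- exact: loc_home L2.
- exact: loc_lo L2.
- by lia.
- by rewrite nx2.
move=> s3 U3; rewrite nx2 (same_arr U2) // aE1 (same_arr U2) // aE1 => -[nE3 vE3 lE3].
have L3 := located_unchanged U3 isT isT L2.
have bE3 : arr s3 aBound = arr s aBound by rewrite (same_arr U3) // (same_arr U2).
have pE3 : arr s3 aPiece = arr s2 aPiece by rewrite (same_arr U3).
have C3 : var s3 vClass = arr s aLabel home by rewrite (same_var U3).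
apply: wp_mono (end_effect (g := g) L3 _ _) (leqnn _) _.
- by rewrite bE3; apply: bounds_mask mt.
- move=> sp; have [tE tN] := gE sp; have Pt := piece_end_piece x_lt x_new sp.
  have tl : tail != lo by apply: contraTneq Pt => ->; rewrite lo_new.
  rewrite pE3 pE2 nE3 /insert_next /upd (negbTE tl) (negbTE (end_piece_neq_home x_lt x_new sp)).
  by split.
move=> s4 U4 E; have L4 := located_unchanged U4 isT isT L3.
have mE4 : arr s4 aMark = arr s2 aMark by rewrite (same_arr U4) // (same_arr U3).
rewrite mE4 mE2 (same_var U4) //.
move: E; rewrite /mark_bounds /mark_pieces /mark_next /mark_prev /mark_label.
case: ifP => _ => [[-> -> -> -> ->]|E]; last by rewrite !E pE3 pE2 bE3 nE3 vE3 lE3.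
by rewrite pE3 pE2 bE3 nE3 vE3 lE3 C3.
Qed.

Lemma mark_spec s : data_invariant D wt s -> var s vX = x -> wp mark_cmd s 0 (marked s).
Proof.
move=> I xE; have [_ _ st mt rings _ _ _] := I; have Ph := piece_piece_of D (ltnW x_lt).
have [f fM fE] := pieces_mask mt Ph.
have [g gE] : exists g, splits -> piece_bits D tail g /\ arr s aPiece tail = mask B g.
  case sp: splits; last by exists xpredT.
  by have [g ? ?] := pieces_mask mt (piece_end_piece x_lt x_new sp); exists g.
have tE : splits -> arr s aPiece tail = mask B g /\ arr s aNext tail <= 2 * N + 1.
  move=> sp; split; first by case: (gE sp).
  exact: next_le rings (piece_end_piece x_lt x_new sp).
apply: wp_mono (mark_effect st mt xE fM (next_le rings Ph) tE) (leqnn _) _.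
move=> s' U [[L C mE bE] [pE nE vE lE]]; have [mm bm wm pm] := mt.
split=> //; [exact: loc_static L | | exact: loc_home L | exact: loc_lo L | exact: loc_hi L].
split; rewrite ?mE ?bE ?pE ?(same_arr U (i := aBits)) //.
- exact: block_masks_set mm (ltnW x_lt) x_new.
- exact: mark_bounds_mask.
- by apply: mark_pieces_mask => // sp; case: (gE sp).
Qed.

End MarkInterval.

(** * Finding the smaller side of a cut *)

Lemma eval_inside s e : eval (inside e) s = (var s vLo <= eval e s < var s vHi).
Proof. by rewrite /=; case: ltnP; case: ltnP. Qed.

Lemma safe_inside s e : safe w e s -> safe w (inside e) s.
Proof. by move=> /= ->; case: (eval e s < var s vLo); case: (eval e s < var s vHi) => /=; lia. Qed.

Section Walk.

Variables (s : state) (inner outer : seq nat).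
Local Notation lo := (var s vLo).
Local Notation hi := (var s vHi).
Local Notation nodes := (inner ++ outer).
Hypothesis rng : ring (arr s aNext) (arr s aPrev) nodes.
Hypothesis nodes_le : {in nodes, forall k, k <= 2 * N + 1}.
Hypotheses (inner_in : {in inner, forall k, lo <= k < hi}).
Hypotheses (outer_out : {in outer, forall k, (lo <= k < hi) = false}).
Hypotheses (head_lo : head 0 inner = lo) (last_home : last 0 outer = var s vPiece).
Hypotheses (inner_gt0 : 0 < size inner) (outer_gt0 : 0 < size outer).

Local Notation node i := (nth 0 nodes i).
Local Notation p := (size inner).
Local Notation q := (size outer).

Record walked (i : nat) (s' : state) : Prop := Walked {
  walked_inner : i < p;
  walked_outer : i < q;
  walked_fwd : var s' vFwd = node i;
  walked_bwd : var s' vBwd = node (p + q - i.+1) }.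

Lemma node_le i : i < p + q -> node i <= 2 * N + 1.
Proof. by move=> li; apply/nodes_le/mem_nth; rewrite size_cat. Qed.

Lemma node_inside i : i < p + q -> (lo <= node i < hi) = (i < p).
Proof.
move=> li; rewrite nth_cat; case: ltnP => ip; first by apply/inner_in/mem_nth.
by rewrite outer_out // mem_nth // ltn_subLR.
Qed.

Lemma next_node i : i < p -> arr s aNext (node i) = node i.+1.
Proof. by move=> ip; have [] := ring_nth (i := i) rng; rewrite ?size_cat //; lia. Qed.

Lemma prev_node i : i < q -> arr s aPrev (node (p + q - i.+1)) = node (p + q - i.+2).
Proof.
move=> iq; have [] := ring_nth (i := p + q - i.+2) rng; first by rewrite size_cat; lia.
by rewrite (_ : (p + q - i.+2).+1 = p + q - i.+1) //; lia.
Qed.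

Section Step.

Variables (i : nat) (s' : state).
Hypotheses (U : unchanged walk_cmd s s') (wd : walked i s').

Let fwdE : eval (aNext.[|$vFwd])%X s' = node i.+1.
Proof. by rewrite /= (same_arr U) // (walked_fwd wd) next_node //; case: wd. Qed.

Let bwdE : eval (aPrev.[|$vBwd])%X s' = node (p + q - i.+2).
Proof. by rewrite /= (same_arr U) // (walked_bwd wd) prev_node //; case: wd. Qed.

Let fwd_safe : safe w (aNext.[|$vFwd])%X s'.
Proof.
rewrite /= /addressable (walked_fwd wd).
by have := @node_le i; have := walked_inner wd; lia.
Qed.

Let bwd_safe : safe w (aPrev.[|$vBwd])%X s'.
Proof.
rewrite /= /addressable (walked_bwd wd).
by have := @node_le (p + q - i.+1); have := walked_outer wd; lia.
Qed.

Lemma next_inside : safe w (inside (aNext.[|$vFwd])%X) s' /\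
  eval (inside (aNext.[|$vFwd])%X) s' = (i.+1 < p).
Proof.
have i_lt := walked_inner wd; split; first exact: safe_inside.
by rewrite eval_inside fwdE !(same_var U) // node_inside //; lia.
Qed.

Lemma prev_inside : safe w (inside (aPrev.[|$vBwd])%X) s' /\
  eval (inside (aPrev.[|$vBwd])%X) s' = ~~ (i.+1 < q).
Proof.
split; first exact: safe_inside.
by rewrite eval_inside bwdE !(same_var U) // node_inside //; lia.
Qed.

Lemma walk_test : let e := (inside (aNext.[|$vFwd]) * (#1 - inside (aPrev.[|$vBwd])))%X in
  safe w e s' /\ eval e s' = ((i.+1 < p) && (i.+1 < q)).
Proof.
have [sn nE] := next_inside; have [sp pE] := prev_inside.
move: (inside _) (inside _) sn nE sp pE => e1 e2 /= -> -> -> ->.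
by case: (_ < p); case: (_ < q) => /=; split; lia.
Qed.

Lemma walk_step : i.+1 < p -> i.+1 < q ->
  wp (vFwd <-- aNext.[|$vFwd];; vBwd <-- aPrev.[|$vBwd])%X s' 0 (walked i.+1).
Proof.
move=> ip iq; apply: wp_seq0; apply: (wp_assign fwd_safe fwdE).
by apply: (wp_assign (v := node (p + q - i.+2))); [exact: bwd_safe | exact: bwdE | split].
Qed.

Lemma choose_spec : ~~ ((i.+1 < p) && (i.+1 < q)) ->
  wp choose_cmd s' 0 (fun s1 => exists inward : bool,
    [/\ var s1 vFirst = head 0 (if inward then inner else outer),
        var s1 vLast = last 0 (if inward then inner else outer) &
        size (if inward then inner else outer) = minn p q]).
Proof.
have [ip iq fE bE] := wd; have [sf nE] := next_inside; move=> stop.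
apply: (wp_if (b := i.+1 < p)) => // [|ip'|ip'].
- by rewrite nE; case: (_ < _).
- apply: wp_seq0; apply: (wp_assign (v := head 0 outer)) => //.
    have -> : head 0 outer = node p by rewrite nth_cat ltnn subnn nth0.
    by rewrite /= bE; congr nth; lia.
  apply: (wp_assign (v := last 0 outer)) => //.
    by rewrite last_home /= /upd /= (same_var U).
  by exists false; split=> //; lia.
apply: wp_seq0; apply: (wp_assign (v := head 0 inner)) => //.
  by rewrite head_lo /= (same_var U).
apply: (wp_assign (v := last 0 inner)) => //.
  rewrite -nth_last /= /upd /= fE nth_cat ip; congr nth; lia.
by exists true; split=> //; lia.
Qed.

End Step.

Lemma walk_spec : wp walk_cmd s (minn p q)
  (fun s' => exists2 i, walked i s' & ~~ ((i.+1 < p) && (i.+1 < q))).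
Proof.
have home_node : node (p + q - 1) = var s vPiece.
  by rewrite -last_home -nth_last nth_cat ifF; [congr nth; lia | lia].
have lo_node : node 0 = lo by rewrite nth_cat inner_gt0 nth0.
apply: wp_seq0; apply: (wp_assign (v := lo)) => //.
apply: wp_seq0; apply: (wp_assign (v := var s vPiece)) => //.
pose Inv k s' := exists2 i, walked i s' & k = minn p q - i.
apply: (wp_while (Inv := Inv)) => [k s' U [i wd kE]|]; last first.
  by exists 0; rewrite ?subn0 //; split.
have U0 : unchanged walk_cmd s s' by do 2!apply: unchanged_assign_seq; apply: U.
have [sf ->] := walk_test U0 wd; split=> // [st|].
  by exists i => //; case: (_ && _) st.
case: (altP andP) => // -[ip' iq'] _.
exists 0; apply: wp_mono (walk_step U0 wd ip' iq') (leqnn _) _ => s1 _ wd1.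
by exists (minn p q - i.+1); split; [lia | exists i.+1].
Qed.

Lemma find_side_spec : wp find_side_cmd s (minn p q) (fun s1 => exists inward : bool,
  [/\ var s1 vFirst = head 0 (if inward then inner else outer),
      var s1 vLast = last 0 (if inward then inner else outer) &
      size (if inward then inner else outer) = minn p q]).
Proof.
rewrite -[minn p q]addn0; apply: wp_then walk_spec _ => s' U [i wd stop].
by rewrite addn0; apply: choose_spec wd stop.
Qed.

End Walk.

(** * Relabelling the smaller side *)

Lemma relink_effect s x1 xn : var s vFirst = x1 -> var s vLast = xn ->
  x1 <= 2 * N + 1 -> xn <= 2 * N + 1 ->
  arr s aPrev x1 <= 2 * N + 1 -> arr s aNext xn <= 2 * N + 1 ->
  wp relink_cmd s 0 (fun s' =>
    arr s' aNext = cut_next (arr s aNext) (arr s aPrev) x1 xn /\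
    arr s' aPrev = cut_prev (arr s aNext) (arr s aPrev) x1 xn).
Proof.
move=> fE lE l1 ln lp lx.
apply: wp_seq0; apply: (wp_assign (v := arr s aPrev x1));
  [eval_simpl; rewrite fE; lia | by eval_simpl; rewrite fE |].
apply: wp_seq0; apply: (wp_assign (v := arr s aNext xn));
  [eval_simpl; rewrite lE; lia | by eval_simpl; rewrite lE |].
apply: wp_seq0; apply: (wp_store (a := arr s aPrev x1) (v := arr s aNext xn)) => //;
  first by eval_simpl; lia.
apply: wp_seq0; apply: (wp_store (a := xn) (v := x1)) => //; first by eval_simpl; lia.
apply: wp_seq0; apply: (wp_store (a := arr s aNext xn) (v := arr s aPrev x1)) => //;
  first by eval_simpl; lia.
by apply: (wp_store (a := x1) (v := xn)) => //; eval_simpl; lia.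
Qed.

Definition piece_weight (D wt : nat -> bool) (k : nat) : nat :=
  \sum_(0 <= y < N | piece_of D y == k) wt y.

Lemma sum_piece_weight D wt (t : seq nat) : uniq t ->
  \sum_(k <- t) piece_weight D wt k = \sum_(0 <= y < N | piece_of D y \in t) wt y.
Proof.
move=> ut; rewrite /piece_weight (exchange_big_dep xpredT) //= [RHS]big_mkcond.
apply: eq_bigr => y _; case: ifP => [yt|/negbT yt].
  rewrite (eq_bigl (pred1 (piece_of D y))) => [|k]; last by rewrite /= eq_sym.
  by rewrite -big_filter filter_pred1_uniq // big_seq1.
by rewrite big_seq_cond big1 // => k /andP[kt /eqP E]; rewrite E kt in yt.
Qed.

Lemma sum_block (f : nat -> bool) b : (forall y, f y -> y < N /\ block y = b) ->
  \sum_(o < B) f (b + o) = \sum_(0 <= y < N) f y.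
Proof.
move=> fb; rewrite -(big_mkord xpredT (fun o => f (b + o) : nat)).
have -> : \sum_(0 <= o < B) f (b + o) = \sum_(b <= y < b + B) f y.
  by rewrite -{2}[b]add0n big_addn addKn; apply: eq_bigr => o _; rewrite addnC.
rewrite (big_nat_widenl b 0) // (big_nat_widen 0 (b + B) (N + b + B)); last lia.
rewrite [RHS](big_nat_widen 0 N (N + b + B)) //; last lia.
rewrite big_mkcond [RHS]big_mkcond; apply: eq_bigr => y _ /=.
case fy: (f y); last by rewrite !if_same.
by have [-> yb] := fb y fy; rewrite -yb block_le block_gt.
Qed.

Section Relabel.

Variables (D wt : nat -> bool) (s : state) (x x1 : nat) (a : seq nat).
Hypotheses (st : static_tables s) (mt : mask_tables D wt s) (wt_lt : forall y, wt y -> y < N).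
Local Notation t := (x1 :: a).
Hypotheses (t_uniq : uniq t) (t_piece : {in t, forall k, piece D k}).
Hypothesis t_ring : ring (arr s aNext) (arr s aPrev) t.
Hypotheses (x_var : var s vX = x) (first_var : var s vFirst = x1).
Hypothesis last_var : var s vLast = last x1 a.

Lemma popcount_piece k : piece D k ->
  arr s aPop (Nat.land (arr s aBits (block (k %/ 2))) (arr s aPiece k)) = piece_weight D wt k.
Proof.
move=> Pk; have kN : k %/ 2 <= N by case/andP: Pk.
have [f -> fE] := pieces_mask mt Pk; rewrite (block_masks_at (weights_mask mt) kN) mask_land.
rewrite (pop_table_mask _ (static_pop st)) //; set b := block _.
pose g y := wt y && (piece_of D y == k).
transitivity (\sum_(o < B) g (b + o)).
  apply: eq_bigr => -[o oB] _; rewrite /g /=; congr nat_of_bool; case E: (wt _) => //=.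
  by rewrite fE // wt_lt.
rewrite sum_block; last first.
  by move=> y /andP[/wt_lt ? /eqP yk]; rewrite /b -yk block_piece_of.
rewrite /piece_weight [RHS]big_mkcond; apply: eq_bigr => y _.
by rewrite /g; case: (_ == k); rewrite ?andbT ?andbF.
Qed.

Lemma land_weights_le k : piece D k ->
  Nat.land (arr s aBits (block (k %/ 2))) (arr s aPiece k) <= N.
Proof.
move=> Pk; have kN : k %/ 2 <= N by case/andP: Pk.
have [f -> _] := pieces_mask mt Pk; rewrite (block_masks_at (weights_mask mt) kN) mask_land.
exact: mask_leN.
Qed.

Local Notation weight k := (piece_weight D wt k).

Record relabelled (i : nat) (s' : state) : Prop := Relabelled {
  relabelled_size : i <= size t;
  relabelled_label : forall k, arr s' aLabel k = if k \in take i t then x else arr s aLabel k;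
  relabelled_total : var s' vTotal = \sum_(k <- take i t) weight k;
  relabelled_more : var s' vMore = (i < size t);
  relabelled_cur : i < size t -> var s' vCur = nth 0 t i }.

Lemma sum_take_weight i : i < size t ->
  \sum_(k <- take i.+1 t) weight k = \sum_(k <- take i t) weight k + weight (nth 0 t i).
Proof. by move=> li; rewrite (take_nth 0) // -cats1 big_cat big_seq1. Qed.

Lemma take_weight_le i : \sum_(k <- take i t) weight k <= N.
Proof. by rewrite sum_piece_weight ?take_uniq //; apply: sum_wt_le. Qed.

Lemma relabel_step i s' : unchanged relabel_cmd s s' -> i < size t -> relabelled i s' ->
  wp (aLabel.[=$vCur] <-- $vX;;
      vT <-- ($vCur %/ #2);;
      vT <-- ($vT - $vT %% $vB);;
      vTotal <-- ($vTotal + aPop.[|aBits.[|$vT] && aPiece.[|$vCur]]);;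
      vMore <-- (#1 - ($vCur == $vLast));;
      vCur <-- aNext.[|$vCur])%X s' 0 (relabelled i.+1).
Proof.
move=> U it [_ labE totE _ /(_ it) curE]; set k := nth 0 t i in curE.
have kt : k \in t by apply: mem_nth.
have Pk := t_piece kt; have k_le := piece_le Pk.
have Eb := block_offset (k %/ 2).
have pop := popcount_piece Pk; have land := land_weights_le Pk.
have sumE : _ = _ + weight k := sum_take_weight it; have sum_le := take_weight_le i.+1.
have xv : var s' vX = x by rewrite (same_var U).
have lv : var s' vLast = last x1 a by rewrite (same_var U).
have Bv : var s' vB = B by rewrite (same_var U) // (static_B st).
apply: wp_seq0; apply: (wp_store (a := k) (v := x)) => //; first by eval_simpl; lia.
apply: wp_seq0; apply: (wp_assign (v := k %/ 2)); [by eval_simpl; lia | by rewrite /= curE |].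
apply: wp_seq0; apply: (wp_assign (v := block (k %/ 2))).
- by eval_simpl; rewrite Bv -/(offset _); lia.
- by eval_simpl; rewrite Bv -/(offset _) {1}Eb addnK.
apply: wp_seq0; apply: (wp_assign (v := \sum_(k <- take i.+1 t) weight k)).
- by eval_simpl; rewrite !(same_arr U) // curE totE pop -sumE; lia.
- by eval_simpl; rewrite !(same_arr U) // curE totE sumE pop.
apply: wp_seq0; apply: (wp_assign (v := (i.+1 < size t))).
- by eval_simpl; lia.
- eval_simpl; rewrite curE lv (last_nth 0) nth_uniq //.
  by move: it => /=; case: eqP; lia.
apply: (wp_assign (v := arr s aNext k)).
- by eval_simpl; rewrite curE; lia.
- by eval_simpl; rewrite curE (same_arr U).
split=> //.
- move=> k'; rewrite (take_nth 0) // mem_rcons inE; eval_simpl; rewrite -/k labE.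
  by case: (k' == k).
- by eval_simpl => it'; have [->] := ring_nth t_ring it'.
Qed.

Lemma relabel_spec : wp relabel_cmd s (size t) (fun s' =>
  (forall k, arr s' aLabel k = if k \in t then x else arr s aLabel k) /\
  var s' vTotal = \sum_(k <- t) weight k).
Proof.
apply: wp_seq0; apply: (wp_assign (v := 0)) => //; first by eval_simpl; lia.
apply: wp_seq0; apply: (wp_assign (v := x1)) => //.
apply: wp_seq0; apply: (wp_assign (v := 1)) => //; first by eval_simpl; lia.
pose Inv k s' := exists2 i, relabelled i s' & k = size t - i.
apply: (wp_while (Inv := Inv)) => [k s' U [i [it labE totE moreE curE] kE]|]; last first.
  exists 0; last by rewrite subn0.
  by split; rewrite ?take0 ?big_nil.
split=> //=; rewrite moreE; case: ltnP => // it' _.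
  by move: labE totE; rewrite take_oversize.
exists 0; apply: wp_mono (relabel_step (i := i) _ it' _) (leqnn _) _ => [||s1 _ re].
- by do 3!apply: unchanged_assign_seq; apply: U.
- by split.
by exists (size t - i.+1); split; [lia | exists i.+1].
Qed.

End Relabel.

Lemma move_sum_effect s x c S : var s vX = x -> var s vClass = c -> var s vTotal = S ->
  x <= N -> c <= N -> c != x -> S <= arr s aSum c ->
  wp move_sum_cmd s 0 (fun s' =>
    arr s' aSum = upd (upd (arr s aSum) x S) c (arr s aSum c - S)).
Proof.
move=> xE cE SE xN cN /negbTE cx le.
apply: wp_seq0; apply: (wp_store (a := x) (v := S)) => //; first by eval_simpl; lia.
apply: (wp_store (a := c) (v := arr s aSum c - S)) => //; eval_simpl; rewrite cE ?SE ?cx //; lia.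
Qed.

(** * Cutting *)

Section CutClasses.

Variables (D wt : nat -> bool) (lab tot : nat -> nat) (x : nat).
Hypothesis D_in : forall d, D d -> 0 < d < N.
Hypotheses (x_in : 0 < x < N) (x_new : D x = false).
Hypotheses (lab_classes : classes D lab) (lab_labels : forall k, piece D k -> is_label D (lab k)).
Hypothesis lab_sums : sums D wt lab tot.

Local Notation home := (piece_of D x).
Local Notation lo := (inner_node x).
Local Notation hi := (outer_node (R x)).
Local Notation D' := (mark D x).
Local Notation old_label := (lab home).
Local Notation lab1 := (mark_label D x lab).
Local Notation members := (class_list nnodes (piece D') lab1 old_label).

Let x_lt : x < N. Proof. by case/andP: x_in. Qed.
Let D_lt d : D d -> d < N. Proof. by case/D_in/andP. Qed.
Let home_piece : piece D home := piece_piece_of D (ltnW x_lt).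

Lemma lo_le_hi : lo <= hi.
Proof. by have := R_bound x_lt; lia. Qed.

Lemma mark_piece_origin k : piece D' k ->
  exists k', [/\ piece D k', same_marks D k k' & lab1 k = lab k'].
Proof.
rewrite piece_mark // => /or3P[Pk|/eqP->|/andP[sp /eqP->]].
- by exists k; split=> //; apply: mark_label_old.
- exists home; split=> // [d Dd|]; last exact: mark_label_lo.
  by rewrite encloses_lo (encloses_home _ D_lt).
- exists home; split=> // [d Dd|]; last exact: mark_label_hi.
  by rewrite (encloses_hi D_lt x_lt x_new) // (encloses_home _ D_lt).
Qed.

Lemma mark_label_classes k k' : piece D' k -> piece D' k' ->
  (lab1 k = lab1 k' <-> same_marks D k k').
Proof.
move=> /mark_piece_origin[i [Pi Si ->]] /mark_piece_origin[i' [Pi' Si' ->]].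
rewrite (lab_classes Pi Pi'); split=> same d Dd; first by rewrite Si // Si' // same.
by rewrite -Si // -Si' // same.
Qed.

Lemma label_new k : piece D k -> lab k != x.
Proof.
move=> /lab_labels; apply: contraTneq => ->; rewrite /is_label x_new orbF.
by case/andP: x_in; rewrite lt0n.
Qed.

Lemma mark_label_new k : piece D' k -> lab1 k != x.
Proof. by case/mark_piece_origin => k' [Pk' _ ->]; apply: label_new. Qed.

Lemma piece_lo : piece D' lo.
Proof. by rewrite piece_mark // eqxx orbT. Qed.

Lemma encloses_class k : k \in members -> encloses x k = (lo <= k < hi).
Proof.
rewrite mem_class_list; last exact: piece_lt.
case/andP=> Pk /eqP labk; apply: (encloses_new_range D_lt x_lt x_new) => //.
by apply/mark_label_classes => //; [apply: piece_lo | rewrite labk mark_label_lo].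
Qed.

Section Sides.

Variables (inward : bool) (x1 : nat) (a : seq nat) (lab' : nat -> nat).
Hypothesis left_side : side inward lo hi members = x1 :: a.
Hypothesis lab'E : forall k, lab' k = if k \in x1 :: a then x else lab1 k.

Lemma mem_left k : piece D' k ->
  (k \in x1 :: a) = (lab1 k == old_label) && (encloses x k == inward).
Proof.
move=> Pk; have kL : (k \in members) = (lab1 k == old_label).
  by rewrite mem_class_list ?Pk //; apply: piece_lt.
rewrite -left_side mem_side; last exact: lo_le_hi.
by rewrite -kL; case: (boolP (k \in members)) => //= /encloses_class->.
Qed.

Lemma cut_labels k : piece D' k -> is_label D' (lab' k).
Proof.
move=> Pk; rewrite lab'E; case: ifP => _; first by rewrite /is_label /mark eqxx !orbT.
have [k' [Pk' _ ->]] := mark_piece_origin Pk.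
by case/orP: (lab_labels Pk') => [/eqP->|Dl]; rewrite /is_label ?eqxx // /mark Dl orbT.
Qed.

Lemma old_labelP : is_label D old_label /\ old_label != x.
Proof. by split; [apply: lab_labels | apply: label_new]. Qed.

Lemma same_class_encloses k k' : piece D' k -> piece D' k' -> lab1 k = lab1 k' ->
  lab1 k != old_label -> encloses x k -> encloses x k'.
Proof.
move=> Pk Pk' E nC ek; apply/negPn/negP => ek'; case/negP: nC; apply/eqP.
rewrite -(mark_label_lo D x lab); apply/mark_label_classes => //; first exact: piece_lo.
by apply: (separated D_lt x_lt) (proj1 (mark_label_classes Pk Pk') E) ek ek'.
Qed.

Lemma cut_classes : classes D' lab'.
Proof.
move=> k k' Pk Pk'; rewrite !lab'E.
have sameE : same_marks D' k k' <-> same_marks D k k' /\ encloses x k = encloses x k'.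
  split=> [same|[same _] d /orP[|/eqP->//]]; last exact: same.
  by split=> [d Dd|]; apply: same; rewrite /mark ?Dd ?eqxx ?orbT.
rewrite sameE -(mark_label_classes Pk Pk'); split=> [|[E Ex]]; last first.
  by rewrite !mem_left // E Ex; case: ifP.
have nx := mark_label_new Pk; have nx' := mark_label_new Pk'.
rewrite !mem_left //; case: ifP => left; case: ifP => left' E.
- by case/andP: left => /eqP-> /eqP->; case/andP: left' => /eqP-> /eqP->.
- by rewrite -E eqxx in nx'.
- by rewrite E eqxx in nx.
split=> //; case: (altP (lab1 k =P old_label)) => [labk|nC].
  move: left left'; rewrite -E labk eqxx /=.
  by case: inward; case: (encloses x k); case: (encloses x k').
by apply/idP/idP; [| have nC' := nC; rewrite E in nC']; apply: same_class_encloses.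
Qed.

Lemma mark_label_piece_of y : y <= N -> lab1 (piece_of D' y) = lab (piece_of D y).
Proof.
move=> yN; have [k' [Pk' same ->]] := mark_piece_origin (piece_piece_of D' yN).
apply/(lab_classes Pk' (piece_piece_of D yN)) => d Dd; rewrite -same // -(covers_piece_of D_lt) //.
by rewrite -(covers_piece_of (mark_lt D_lt x_lt)) // /mark Dd.
Qed.

Local Notation moved := (\sum_(k <- x1 :: a) piece_weight D' wt k).

Let left_uniq : uniq (x1 :: a).
Proof.
have [n En] := side_rot lo_le_hi (sorted_class_list nnodes (piece D') lab1 old_label) inward.
have : uniq (side inward lo hi members ++ side (~~ inward) lo hi members).
  by rewrite En rot_uniq class_list_uniq.
by rewrite left_side cat_uniq => /andP[].
Qed.

Lemma left_sum : moved = \sum_(0 <= y < N | piece_of D' y \in x1 :: a) wt y.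
Proof. exact: sum_piece_weight. Qed.

Lemma label_sum : tot old_label =
  moved + \sum_(0 <= y < N | lab' (piece_of D' y) == old_label) wt y.
Proof.
have [old_is_label old_neq_x] := old_labelP;
rewrite (lab_sums old_is_label) left_sum (bigID (fun y => piece_of D' y \in x1 :: a)) /=.
congr (_ + _); apply: sum_pred_eq => y yN; have Py := piece_piece_of D' (ltnW yN);
  rewrite -mark_label_piece_of ?(ltnW yN) // ?lab'E mem_left //.
  by case: (_ == old_label).
case: (altP (lab1 _ =P old_label)) => [->|/negbTE->] //=.
by case: (_ == inward) => /=; rewrite ?eqxx // eq_sym (negbTE old_neq_x).
Qed.

Lemma cut_sums : sums D' wt lab' (upd (upd tot x moved) old_label (tot old_label - moved)).
Proof.
move=> c lc; rewrite /upd label_sum addKn.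
case: (c =P old_label) => [->//|/eqP nC]; case: (c =P x) => [->|/eqP nx].
  rewrite left_sum; apply: sum_pred_eq => y yN; rewrite lab'E.
  have Py := piece_piece_of D' (ltnW yN); case: ifP => _; rewrite ?eqxx //.
  by rewrite (negbTE (mark_label_new Py)).
have lc' : is_label D c by move: lc; rewrite /is_label /mark (negbTE nx) orbF.
rewrite (lab_sums lc'); apply: sum_pred_eq => y yN; rewrite lab'E.
have Py := piece_piece_of D' (ltnW yN); case: ifP; last by rewrite mark_label_piece_of // ltnW.
rewrite mem_left // mark_label_piece_of ?(ltnW yN) // => /andP[/eqP-> _].
by rewrite [x == c]eq_sym [old_label == c]eq_sym (negbTE nC) (negbTE nx).
Qed.

End Sides.

Lemma mem_class_lo : lo \in members.
Proof.
rewrite mem_class_list; last exact: piece_lt.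
by rewrite piece_lo mark_label_lo eqxx.
Qed.

Lemma mem_class_old k : piece D k -> lab k = old_label -> k \in members.
Proof.
move=> Pk labk; rewrite mem_class_list; last exact: piece_lt.
by rewrite piece_mark // Pk mark_label_old // labk eqxx.
Qed.

Lemma class_home_gap : {in members, forall k, ~~ (home < k < lo)}.
Proof.
move=> k; rewrite mem_class_list; last exact: piece_lt.
rewrite piece_mark // => /andP[/or3P[Pk|/eqP->|/andP[_ /eqP->]] labk]; last 2 first.
- by rewrite ltnn andbF.
- by have := R_bound x_lt; lia.
rewrite mark_label_old // in labk.
by apply: (home_lo_adjacent D_lt x_lt x_new) => //; apply: (same_marks_lo D_lt x_lt) (eqP labk).
Qed.

Lemma size_sides inward : size (side inward lo hi members) + size (side (~~ inward) lo hi members) =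
  size (class_list nnodes (piece D) lab old_label) + 1 + end_splits D x.
Proof.
have [n En] := side_rot lo_le_hi (sorted_class_list nnodes (piece D') lab1 old_label) inward.
by rewrite -size_cat En size_rot size_mark_class_list.
Qed.

Lemma side_gt0 inward : 0 < size (side inward lo hi members).
Proof.
suff [k] : exists k, k \in side inward lo hi members by case: (side _ _ _ _).
case: inward; [exists lo | exists home]; rewrite mem_side ?mem_class_lo ?mem_class_old //;
  try exact: lo_le_hi.
- by have := R_bound x_lt; lia.
- by have := home_lt_lo x_lt x_new; lia.
Qed.

Lemma side_gt1 inward : end_splits D x -> 1 < size (side inward lo hi members).
Proof.
move=> sp; have home_lo := home_lt_lo x_lt x_new; have tail_hi := end_piece_lt x_lt x_new sp.
have lo_tail := lo_le_tail D_lt x_lt x_new sp; have lo_hi := lo_le_hi.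
have hi_L : hi \in members.
  rewrite mem_class_list; last exact: piece_lt.
  by rewrite piece_mark // sp eqxx !orbT mark_label_hi // eqxx.
case: inward.
  apply: (@size_gt1 _ lo (end_piece D x)); rewrite ?mem_side ?mem_class_lo ?mem_class_old //.
  - by lia.
  - by lia.
  - exact: piece_end_piece.
  - exact: label_tail lab_classes sp.
  - by rewrite /end_piece inner_neq_outer.
apply: (@size_gt1 _ home hi); rewrite ?mem_side ?hi_L ?mem_class_old //; lia.
Qed.

Definition potential (D1 : nat -> bool) (lab2 : nat -> nat) : nat :=
  \sum_(0 <= c < N) phi (size (class_list nnodes (piece D1) lab2 c)).

Lemma cut_potential inward x1 a x2 b lab' :
  side inward lo hi members = x1 :: a -> side (~~ inward) lo hi members = x2 :: b ->
  (forall k, lab' k = if k \in x1 :: a then x else lab1 k) ->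
  minn (size (x1 :: a)) (size (x2 :: b)) + potential D' lab' <= potential D lab + 2.
Proof.
move=> left right lab'E; have [old_is_label old_neq_x] := old_labelP.
have CN : old_label < N by case/orP: old_is_label => [/eqP->|/D_lt//]; case/andP: x_in; lia.
pose f c := phi (size (class_list nnodes (piece D) lab c)).
pose f' c := phi (size (class_list nnodes (piece D') lab' c)).
have [sx sC] :=
  size_cut_class (piece_lt (D := D')) old_neq_x mark_label_new lo_le_hi left right lab'E.
have change : \sum_(0 <= c < N) f' c + (f old_label + f x) =
    \sum_(0 <= c < N) f c + (f' old_label + f' x).
  apply: sum_change2 => // c nC nx; rewrite /f /f'; congr (phi (size _)).
  rewrite (cut_class_other (piece_lt (D := D')) lo_le_hi left right lab'E) //.
  by rewrite mark_class_list_other.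
have fx : f x = 0.
  rewrite /f; case E: (class_list _ _ _ _) => [|k t] //; have := mem_head k t.
  by rewrite -E mem_filter => /andP[/andP[/label_new/negbTE->]].
have : minn (size (x1 :: a)) (size (x2 :: b)) + (phi (size (x1 :: a)) + phi (size (x2 :: b))) <=
    phi (size (class_list nnodes (piece D) lab old_label)) + 2.
  have := size_sides inward; have := @side_gt1 inward; have := @side_gt1 (~~ inward).
  rewrite left right => gt_b gt_a szE; apply: phi_split => //; move: szE gt_a gt_b.
  by case: (end_splits D x) => szE; [move=> /(_ isT) gt_a /(_ isT) gt_b | move=> _ _]; lia.
have [fC' fx'] : f' old_label = phi (size (x2 :: b)) /\ f' x = phi (size (x1 :: a)).
  by rewrite /f' sx sC.
rewrite -/(f old_label) -fC' -fx' -[potential D lab]/(\sum_(0 <= c < N) f c).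
by rewrite -[potential D' lab']/(\sum_(0 <= c < N) f' c); lia.
Qed.

End CutClasses.

Section Cutting.

Variables (D wt : nat -> bool) (s0 : state) (x : nat).
Hypotheses (inv0 : data_invariant D wt s0) (x_in : 0 < x < N) (x_new : D x = false).

Local Notation home := (piece_of D x).
Local Notation lo := (inner_node x).
Local Notation hi := (outer_node (R x)).
Local Notation D' := (mark D x).
Local Notation old_label := (arr s0 aLabel home).
Local Notation members := (class_list nnodes (piece D') (mark_label D x (arr s0 aLabel)) old_label).

Let x_lt : x < N. Proof. by case/andP: x_in. Qed.
Let D_lt d : D d -> d < N. Proof. by case/(inv_D inv0)/andP. Qed.
Let lab_classes := inv_classes inv0.
Let lab_labels := inv_labels inv0.
Let rings := mark_rings D_lt x_lt x_new (inv_rings inv0) lab_classes.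

Lemma mem_class_le : {in members, forall k, k <= 2 * N + 1}.
Proof. by move=> k; rewrite mem_filter => /andP[/andP[/piece_le]]. Qed.

Lemma find_class_side_spec s1 : marked D wt x s0 s1 ->
  wp find_side_cmd s1 (minn (size (side true lo hi members)) (size (side false lo hi members)))
    (fun s2 => exists inward, [/\ var s2 vFirst = head 0 (side inward lo hi members),
       var s2 vLast = last 0 (side inward lo hi members) &
       size (side inward lo hi members) =
         minn (size (side true lo hi members)) (size (side false lo hi members))]).
Proof.
move=> mk.
have srt := sorted_class_list nnodes (piece D') (mark_label D x (arr s0 aLabel)) old_label.
have lt : lo < hi by have := R_bound x_lt; lia.
have le := ltnW lt; have gt0 := side_gt0 (arr s0 aLabel) x_in x_new.
have rng : ring (arr s1 aNext) (arr s1 aPrev) (side true lo hi members ++ side false lo hi members).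
  have [n ->] := side_rot le srt true.
  by rewrite (marked_next mk) (marked_prev mk) /ring rot_cycle; apply: rings.
have [lo1 hi1] := (marked_lo mk, marked_hi mk).
apply: wp_mono (find_side_spec rng _ _ _ _ _ (gt0 true) (gt0 false)) (leqnn _) _.
- by move=> k; rewrite mem_cat !mem_side // => /orP[] /andP[/mem_class_le].
- by move=> k; rewrite mem_side // lo1 hi1 => /andP[_ /eqP].
- by move=> k; rewrite mem_side // lo1 hi1 => /andP[_ /eqP].
- by rewrite lo1; apply: head_range_part => //; apply: (mem_class_lo _ x_in).
- rewrite (marked_home mk); apply: last_wrapped_part => //.
  + by apply: (mem_class_old x_in) => //; apply: piece_piece_of (ltnW x_lt).
  + exact: home_lt_lo.
  + exact: class_home_gap (inv_D inv0) x_in x_new lab_classes.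
by move=> s2 _ [inward side_s2]; exists inward; case: inward side_s2.
Qed.

Section Detach.

Variables (s2 : state) (inward : bool) (x1 : nat) (a : seq nat) (x2 : nat) (b : seq nat).
Hypotheses (mk : marked D wt x s0 s2) (x_var : var s2 vX = x) (sum_s2 : arr s2 aSum = arr s0 aSum).
Hypotheses (first_var : var s2 vFirst = x1) (last_var : var s2 vLast = last x1 a).
Hypothesis left_side : side inward lo hi members = x1 :: a.
Hypothesis right_side : side (~~ inward) lo hi members = x2 :: b.

Local Notation lab' := (fun k => if k \in x1 :: a then x else mark_label D x (arr s0 aLabel) k).
Local Notation moved := (\sum_(k <- x1 :: a) piece_weight D' wt k).

Let lo_hi : lo <= hi. Proof. by have := R_bound x_lt; lia. Qed.
Let srt := sorted_class_list nnodes (piece D') (mark_label D x (arr s0 aLabel)) old_label.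

Lemma mem_sides k : k \in (x1 :: a) ++ x2 :: b -> piece D' k.
Proof.
rewrite -left_side -right_side mem_cat !mem_side // -andb_orr mem_filter.
by case/andP=> /andP[/andP[]].
Qed.

Lemma sides_ring : ring (arr s2 aNext) (arr s2 aPrev) ((x1 :: a) ++ x2 :: b) /\
  uniq ((x1 :: a) ++ x2 :: b).
Proof.
rewrite -left_side -right_side; have [n ->] := side_rot lo_hi srt inward.
rewrite rot_uniq class_list_uniq (marked_next mk) (marked_prev mk) /ring rot_cycle.
by split=> //; apply: rings.
Qed.

Lemma detach_effect : wp detach_cmd s2 (size (x1 :: a)) (fun s =>
  [/\ arr s aNext = cut_next (arr s2 aNext) (arr s2 aPrev) x1 (last x1 a),
      arr s aPrev = cut_prev (arr s2 aNext) (arr s2 aPrev) x1 (last x1 a),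
      arr s aLabel =1 lab' &
      arr s aSum = upd (upd (arr s0 aSum) x moved) old_label (arr s0 aSum old_label - moved)]).
Proof.
have [rng unq] := sides_ring; have [pvE nxE ring_a _] := ring_cut rng unq.
have a_mem k : k \in x1 :: a -> k \in (x1 :: a) ++ x2 :: b by rewrite mem_cat => ->.
have le_a k : k \in x1 :: a -> k <= 2 * N + 1 by move/a_mem/mem_sides/piece_le.
have le_b k : k \in x2 :: b -> k <= 2 * N + 1.
  by move=> kb; apply/piece_le/mem_sides; rewrite mem_cat kb orbT.
apply: wp_then0 (relink_effect first_var last_var _ _ _ _) _.
- exact: le_a (mem_head _ _).
- exact: le_a (mem_last _ _).
- by rewrite pvE; apply: le_b (mem_last _ _).
- by rewrite nxE; apply: le_b (mem_head _ _).
move=> s3 U3 [nx3 pv3]; rewrite -[size _]addn0.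
have st3 := static_unchanged U3 isT isT (marked_static mk).
have mt3 : mask_tables D' wt s3.
  by case: (marked_masks mk) => *; split; rewrite ?(same_arr U3).
apply: wp_then (relabel_spec (x := x) st3 mt3 (inv_wt inv0) _ _ _ _ _ _) _.
- by move: unq; rewrite cat_uniq => /andP[].
- by move=> k /a_mem/mem_sides.
- by rewrite nx3 pv3.
- by rewrite (same_var U3).
- by rewrite (same_var U3).
- by rewrite (same_var U3).
move=> s4 U4 [lab4 tot4]; have [old_is_label old_neq_x] := old_labelP x_in x_new lab_labels.
have sum4 : arr s4 aSum = arr s0 aSum by rewrite (same_arr U4) // (same_arr U3).
apply: wp_mono (move_sum_effect (x := x) (c := old_label) _ _ tot4 _ _ old_neq_x _) (leqnn _) _.
- by rewrite (same_var U4) // (same_var U3).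
- by rewrite (same_var U4) // (same_var U3) // (marked_class mk).
- exact: ltnW.
- by apply: ltnW; case/orP: old_is_label => [/eqP->|/D_lt//]; case/andP: x_in; lia.
- have := label_sum (inv_D inv0) x_in x_new lab_classes lab_labels (inv_sums inv0) left_side
    (fun k => erefl (lab' k)).
  by rewrite sum4 => ->; apply: leq_addr.
move=> s U sumE; split; last by rewrite sumE sum4.
- by rewrite (same_arr U) // (same_arr U4).
- by rewrite (same_arr U) // (same_arr U4).
- by move=> k; rewrite (same_arr U) // lab4 (same_arr U3) // (marked_label mk).
Qed.

Lemma detach_spec : wp detach_cmd s2 (size (x1 :: a)) (fun s =>
  data_invariant D' wt s /\ arr s aLabel =1 lab').
Proof.
have [_ old_neq_x] := old_labelP x_in x_new lab_labels.
apply: wp_mono detach_effect (leqnn _) _ => s U [nxE pvE labE sumE]; split=> //; split.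
- by move=> d /orP[/(inv_D inv0)//|/eqP->].
- exact: inv_wt inv0.
- exact: static_unchanged U isT isT (marked_static mk).
- by case: (marked_masks mk) => *; split; rewrite ?(same_arr U).
- rewrite nxE pvE (marked_next mk) (marked_prev mk).
  have fresh := mark_label_new (inv_D inv0) x_in x_new lab_labels.
  exact: (class_rings_cut (piece_lt (D := D')) old_neq_x fresh lo_hi left_side right_side
    labE rings).
- exact: (cut_classes (inv_D inv0) x_in x_new lab_classes lab_labels left_side labE).
- exact: (cut_labels (inv_D inv0) x_in x_new lab_labels labE).
- rewrite sumE.
  exact: (cut_sums (inv_D inv0) x_in x_new lab_classes lab_labels (inv_sums inv0) left_side labE).
Qed.

End Detach.

Lemma cut_spec : var s0 vX = x -> exists T s, [/\ exec w due cut_cmd s0 T s,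
  data_invariant D' wt s &
  T + 2 * potential D' (arr s aLabel) <= 2 * potential D (arr s0 aLabel) + 4].
Proof.
move=> xE; have [t1 [s1 [t1_0 X1 mk1]]] := mark_spec D_lt x_lt x_new inv0 xE.
have U1 := exec_unchanged X1.
have [t2 [s2 [le2 X2 [inward [fE lE szE]]]]] := find_class_side_spec mk1.
have U2 := exec_unchanged X2; have gt0 := side_gt0 (arr s0 aLabel) x_in x_new.
have [x1 [a left]] : exists x1 a, side inward lo hi members = x1 :: a.
  by case: (side inward lo hi members) (gt0 inward) => // x1 a; exists x1, a.
have [x2 [b right]] : exists x2 b, side (~~ inward) lo hi members = x2 :: b.
  by case: (side (~~ inward) lo hi members) (gt0 (~~ inward)) => // x2 b; exists x2, b.
have mk2 : marked D wt x s0 s2.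
  have [st mm *] := mk1; split; rewrite ?(same_var U2) ?(same_arr U2) //.
    exact: static_unchanged U2 isT isT st.
  by case: mm => *; split; rewrite ?(same_arr U2).
have xE2 : var s2 vX = x by rewrite (same_var U2) // (same_var U1).
have sum2 : arr s2 aSum = arr s0 aSum by rewrite (same_arr U2) // (same_arr U1).
rewrite left in fE lE szE.
have [t3 [s [le3 X3 [I3 labE]]]] := detach_spec mk2 xE2 sum2 fE lE left right.
exists (t1 + (t2 + t3)), s; split=> //; first exact: ExecSeq X1 (ExecSeq X2 X3).
have := cut_potential (inv_D inv0) x_in x_new lab_classes lab_labels left right labE.
have : minn (size (x1 :: a)) (size (x2 :: b)) = size (x1 :: a).
  by rewrite [RHS]szE -left -right; case: (inward); rewrite // minnC.
have {}le3 : t3 <= size (x1 :: a) := le3; rewrite -szE in le2 => -> pot; lia.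
Qed.

End Cutting.

End Forest.

(** * Preorder numberings *)

Section Tree.

Variables (n : nat) (par : nat -> option nat).
Hypothesis par_forest : forest n par.

Local Notation N := n.+1.

(* Vertex n is a virtual root above all trees. *)
Definition parent (v : nat) : nat := if v < n then odflt n (par v) else n.

Definition ancestor (u v : nat) : Prop := exists k, iter k parent v = u.

Lemma parent_le v : parent v <= n.
Proof.
rewrite /parent; case: ltnP => // lv; case E: (par v) => [u|] //=.
by apply: ltnW; case: par_forest => par_lt _; apply: par_lt E.
Qed.

Lemma parent_root : parent n = n. Proof. by rewrite /parent ltnn. Qed.

Lemma ancestor_refl u : ancestor u u. Proof. by exists 0. Qed.

Lemma ancestor_trans u v x : ancestor u v -> ancestor v x -> ancestor u x.
Proof. by move=> [k <-] [l <-]; exists (k + l); rewrite iterD. Qed.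

Lemma ancestor_parent u v : ancestor u v <-> u = v \/ ancestor u (parent v).
Proof.
split=> [[[|k] <-]|[->|[k <-]]]; [by left | right | exact: ancestor_refl | ].
  by exists k; rewrite iterSr.
by exists k.+1; rewrite iterSr.
Qed.

Lemma ancestor_of_root u : ancestor u n -> u = n.
Proof. by case=> k <-; elim: k => //= k ->; rewrite parent_root. Qed.

Lemma root_ancestor v : v <= n -> ancestor n v.
Proof.
rewrite leq_eqVlt => /orP[/eqP->|lv]; first exact: ancestor_refl.
have [par_lt /(_ v lv)[k]] := par_forest; elim: k v lv => [|k IH] v lv rootk.
  by exists 1; rewrite /= /parent lv; move: rootk => /= ->.
case E: (par v) => [u|]; last by exists 1; rewrite /= /parent lv E.
apply/ancestor_parent; right; rewrite /parent lv E; apply: IH; first exact: par_lt E.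
by move: rootk; rewrite /anc iterSr {2}/up E.
Qed.

Definition unvisited (ord : seq nat) (p : nat) : seq nat :=
  [seq v <- rev (iota 0 n) | (parent v == p) && (v \notin ord)].

Lemma mem_unvisited ord p v : (v \in unvisited ord p) = [&& v < n, parent v == p & v \notin ord].
Proof. by rewrite mem_filter mem_rev mem_iota add0n andbC. Qed.

Lemma unvisited_rcons ord c p : unvisited (rcons ord c) p = [seq v <- unvisited ord p | v != c].
Proof.
rewrite -filter_predI; apply: eq_filter => v /=.
by rewrite mem_rcons inE negb_or andbCA.
Qed.

Lemma unvisited_enter ord c p l : unvisited ord p = c :: l -> unvisited (rcons ord c) p = l.
Proof.
move=> E; have : uniq (unvisited ord p) by rewrite filter_uniq ?rev_uniq ?iota_uniq.
rewrite unvisited_rcons E /= eqxx => /andP[cl _]; apply/all_filterP/allP => v vl.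
by apply: contraTneq vl => ->.
Qed.

Lemma unvisited_enter_other ord c cur p : c \in unvisited ord cur -> p != cur ->
  unvisited (rcons ord c) p = unvisited ord p.
Proof.
rewrite mem_unvisited => /and3P[_ /eqP cp _] np; rewrite unvisited_rcons.
apply/all_filterP/allP => v; rewrite mem_unvisited => /and3P[_ /eqP vp _].
by apply: contraNneq np => vc; rewrite -vp vc cp.
Qed.

Fixpoint ancestor_path (stk : seq nat) : Prop :=
  match stk with
  | v :: (u :: _) as stk' => [/\ v < n, parent v = u & ancestor_path stk']
  | [:: v] => v = n
  | [::] => True
  end.

Lemma ancestor_pathP v stk u : ancestor_path (v :: stk) -> ancestor u v <-> u \in v :: stk.
Proof.
elim: stk v => [|x stk IH] v.
  by move=> /= ->; rewrite inE; split=> [/ancestor_of_root->//|/eqP->]; apply: ancestor_refl.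
move=> [_ vx ok]; rewrite ancestor_parent vx inE; have memx := IH x ok.
by split=> [[->|/memx->]|/orP[/eqP->|/memx]]; rewrite ?eqxx ?orbT //; [left | right].
Qed.

Definition interval_end (ord stk : seq nat) (E : nat -> nat) (u : nat) : nat :=
  if u \in stk then size ord else E (index u ord).

(* A depth-first search that has entered the vertices [ord], in this order, and
   has not yet left the vertices of [stk]. *)
Record traversal (ord stk : seq nat) (E : nat -> nat) : Prop := Traversal {
  trav_uniq : uniq ord;
  trav_le : {in ord, forall v, v <= n};
  trav_root : n \in ord /\ nth 0 ord 0 = n;
  trav_path : ancestor_path stk;
  trav_sub : {subset stk <= ord};
  trav_parent : {in ord, forall v, v != n ->
    parent v \in ord /\ index (parent v) ord < index v ord};
  trav_left : {in ord, forall v, v \notin stk -> unvisited ord v = [::]};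
  trav_interval : {in ord &, forall u v,
    ancestor u v <-> index u ord <= index v ord < interval_end ord stk E u};
  trav_end : {in ord, forall u, interval_end ord stk E u <= size ord} }.

Lemma traversal_start E : traversal [:: n] [:: n] E.
Proof.
split=> //; try by move=> v; rewrite inE => /eqP->; rewrite ?eqxx.
- by rewrite mem_head.
- move=> u v; rewrite !inE => /eqP-> /eqP->; rewrite /interval_end /= inE !eqxx.
  by split=> // _; apply: ancestor_refl.
- by move=> u; rewrite inE => /eqP->; rewrite /interval_end inE eqxx.
Qed.

Section Enter.

Variables (ord stk : seq nat) (E : nat -> nat) (cur c : nat).
Hypothesis trav : traversal ord (cur :: stk) E.
Hypothesis c_unvisited : c \in unvisited ord cur.

Lemma index_rcons_old v : v \in ord -> index v (rcons ord c) = index v ord.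
Proof. by move=> vo; rewrite -cats1 index_cat vo. Qed.

Lemma index_rcons_new : index c (rcons ord c) = size ord.
Proof.
move: c_unvisited; rewrite mem_unvisited => /and3P[_ _ c_new].
by rewrite -cats1 index_cat (negbTE c_new) /= eqxx addn0.
Qed.

Lemma ancestor_visited u v : v \in ord -> ancestor u v -> u \in ord.
Proof.
move=> vo [k <-]; elim: k => //= k IH; case: (iter k parent v =P n) => [->|/eqP nr].
  by rewrite parent_root; case: (trav_root trav).
by case: (trav_parent trav IH nr).
Qed.

Lemma enter_interval : {in rcons ord c &, forall u v, ancestor u v <->
  index u (rcons ord c) <= index v (rcons ord c)
    < interval_end (rcons ord c) (c :: cur :: stk) E u}.
Proof.
move: (c_unvisited); rewrite mem_unvisited => /and3P[_ /eqP cp c_new] u v.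
have ltv v' : v' \in ord -> index v' ord < size ord by rewrite index_mem.
rewrite !mem_rcons !inE /interval_end size_rcons [u \in c :: _]inE =>
  /orP[/eqP->|uo] /orP[/eqP->|vo].
- by rewrite eqxx leqnn index_rcons_new ltnSn; split=> // _; apply: ancestor_refl.
- rewrite index_rcons_new index_rcons_old // leqNgt ltv //=.
  by split=> // /(ancestor_visited vo); rewrite (negbTE c_new).
- have nuc : u != c by apply: contraNneq c_new => <-.
  rewrite (negbTE nuc) index_rcons_new index_rcons_old // (ltnW (ltv u uo)) /=.
  rewrite ancestor_parent cp (ancestor_pathP u (trav_path trav)).
  have := trav_end trav uo; rewrite /interval_end; case: ifP => _ le_end.
    by split=> // _; right.
  by rewrite ltnNge le_end; split=> // -[uc|//]; rewrite uc eqxx in nuc.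
- have nuc : u != c by apply: contraNneq c_new => <-.
  rewrite (negbTE nuc) !index_rcons_old // (trav_interval trav uo vo) /interval_end.
  by case: ifP => // _; have := ltv v vo; rewrite ltnS => lt; rewrite lt (ltnW lt).
Qed.

Lemma traversal_enter : traversal (rcons ord c) (c :: cur :: stk) E.
Proof.
move: (c_unvisited); rewrite mem_unvisited => /and3P[c_lt /eqP cp c_new].
have curo : cur \in ord by apply: (trav_sub trav); apply: mem_head.
have [root0 root_nth] := trav_root trav.
split.
- by rewrite rcons_uniq c_new (trav_uniq trav).
- by move=> v; rewrite mem_rcons inE => /orP[/eqP->|/(trav_le trav)//]; apply: ltnW.
- by rewrite mem_rcons inE root0 orbT nth_rcons; case: (ord) root0 root_nth.
- by split=> //; apply: trav_path trav.
- by move=> v; rewrite inE mem_rcons inE => /orP[->//|/(trav_sub trav)->]; rewrite orbT.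
- move=> v; rewrite mem_rcons inE => /orP[/eqP-> _|vo nr].
    by rewrite cp mem_rcons inE curo orbT index_rcons_new index_rcons_old // index_mem.
  have [po lt] := trav_parent trav vo nr.
  by rewrite mem_rcons inE po orbT !index_rcons_old.
- move=> v; rewrite mem_rcons inE [v \in c :: _]inE negb_or => /orP[/eqP->|vo] /andP[nc ns].
    by rewrite eqxx in nc.
  by rewrite unvisited_rcons (trav_left trav vo).
- exact: enter_interval.
- move=> u; rewrite mem_rcons inE /interval_end size_rcons.
  case: ifP => // us /orP[/eqP uc|uo]; first by rewrite uc mem_head in us.
  have := trav_end trav uo; rewrite /interval_end ifF ?index_rcons_old //; first exact: leqW.
  by move/negbT: us; rewrite inE => /norP[_ /negbTE].
Qed.

End Enter.

Section Leave.

Variables (ord stk : seq nat) (E : nat -> nat) (cur : nat).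
Hypothesis trav : traversal ord (cur :: stk) E.
Hypothesis no_child : unvisited ord cur = [::].

Let curo : cur \in ord. Proof. by apply: (trav_sub trav); apply: mem_head. Qed.

Lemma path_head_notin : cur \notin stk.
Proof.
apply/negP => curs; have := trav_path trav; case: stk curs => // u stk' curs [lc cu ok].
have [uo lt] : u \in ord /\ index u ord < index cur ord.
  by rewrite -cu; apply: (trav_parent trav) => //; rewrite neq_ltn lc.
have [below _] := trav_interval trav curo uo.
by have := below (proj2 (ancestor_pathP _ ok) curs); rewrite leqNgt lt.
Qed.

Lemma leave_interval_end u : u \in ord ->
  interval_end ord stk (upd E (index cur ord) (size ord)) u = interval_end ord (cur :: stk) E u.
Proof.
move=> uo; rewrite /interval_end inE /upd (inj_in_eq (@index_inj _ 0 ord)) //;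
  case: (u =P cur) => [->|_] //=.
by rewrite (negbTE path_head_notin).
Qed.

Lemma traversal_leave : traversal ord stk (upd E (index cur ord) (size ord)).
Proof.
have [uo le root path sub prev left int fin] := trav; split=> //.
- by case: (stk) path => // u stk' [].
- by move=> v vs; apply: sub; rewrite inE vs orbT.
- by move=> v vo vs; case: (v =P cur) => [->//|/eqP nc]; apply: left; rewrite // inE negb_or nc.
- by move=> u v uo' vo; rewrite leave_interval_end //; apply: int.
- by move=> u uo'; rewrite leave_interval_end //; apply: fin.
Qed.

End Leave.

(* [E] maps the position of a vertex to the end of the interval of its subtree. *)
Record preorder (ord : seq nat) (E : nat -> nat) : Prop := Preorder {
  pre_uniq : uniq ord;
  pre_size : size ord = N;
  pre_mem : forall v, (v \in ord) = (v <= n);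
  pre_root : nth 0 ord 0 = n;
  pre_parent : forall v, v < n -> index (parent v) ord < index v ord;
  pre_interval : forall u v, u <= n -> v <= n ->
    (ancestor u v <-> index u ord <= index v ord < E (index u ord));
  pre_end : forall u, u <= n -> E (index u ord) <= N }.

Lemma traversal_finish ord E : traversal ord [::] E -> preorder ord E.
Proof.
move=> [uo le [root0 root_nth] _ _ prev left int fin].
have visited v : v <= n -> v \in ord.
  move=> lv; have [k] := root_ancestor lv; elim: k v lv => [|k IH] v lv; first by move=> /= ->.
  rewrite iterSr => root_k; have po := IH _ (parent_le v) root_k.
  move: lv; rewrite leq_eqVlt => /orP[/eqP->//|lv]; apply/negPn/negP => vo.
  have := left _ po isT; apply/eqP; rewrite -has_filter; apply/hasP; exists v.
    by rewrite mem_rev mem_iota.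
  by rewrite eqxx.
have mem v : (v \in ord) = (v <= n) by apply/idP/idP; [apply: le | apply: visited].
have szo : size ord = N.
  rewrite -(size_iota 0 N); apply: perm_size; apply: uniq_perm; rewrite ?iota_uniq //.
  by move=> v; rewrite mem mem_iota.
split=> //.
- by move=> v lv; case: (prev v) => //; rewrite ?mem ?neq_ltn ?lv // ltnW.
- by move=> u v lu lv; apply: int; rewrite mem.
- by move=> u lu; rewrite -szo; apply: fin; rewrite mem.
Qed.

Section Preorder.

Variables (ord : seq nat) (R : nat -> nat).
Hypothesis pre : preorder ord R.

Lemma index_nth_pre x : x < N -> index (nth 0 ord x) ord = x.
Proof. by move=> lx; rewrite index_uniq ?(pre_uniq pre) ?(pre_size pre). Qed.

Lemma nth_pre_le x : x < N -> nth 0 ord x <= n.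
Proof. by move=> lx; rewrite -(pre_mem pre) mem_nth // (pre_size pre). Qed.

Lemma nth_index_pre v : v <= n -> nth 0 ord (index v ord) = v.
Proof. by move=> vn; rewrite nth_index ?(pre_mem pre). Qed.

Lemma index_lt_pre v : v <= n -> index v ord < N.
Proof. by move=> vn; rewrite -(pre_size pre) index_mem (pre_mem pre). Qed.

Lemma index_gt0_pre v : v < n -> 0 < index v ord.
Proof.
move=> vn; rewrite lt0n; apply/eqP => v0.
by have := nth_index_pre (ltnW vn); rewrite v0 (pre_root pre) => nv; rewrite nv ltnn in vn.
Qed.

Lemma preorder_ancestor x y : x < N -> y < N ->
  (ancestor (nth 0 ord x) (nth 0 ord y) <-> x <= y < R x).
Proof.
by move=> lx ly; rewrite (pre_interval pre) ?nth_pre_le // !index_nth_pre.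
Qed.

Lemma preorder_bound x : x < N -> x < R x <= N.
Proof.
move=> lx; have := pre_end pre (nth_pre_le lx); rewrite index_nth_pre // => ->.
by have := proj1 (preorder_ancestor lx lx) (ancestor_refl _); rewrite leqnn andbT.
Qed.

Lemma preorder_laminar x y : x < N -> x <= y < R x -> R y <= R x.
Proof.
move=> lx xy; have bx := preorder_bound lx; have ly : y < N by lia.
have by_ := preorder_bound ly; have lz : (R y).-1 < N by lia.
have anc_yz : ancestor (nth 0 ord y) (nth 0 ord (R y).-1) by apply/preorder_ancestor => //; lia.
have anc_xy : ancestor (nth 0 ord x) (nth 0 ord y) by apply/preorder_ancestor.
by have := proj1 (preorder_ancestor lx lz) (ancestor_trans anc_xy anc_yz); lia.
Qed.

End Preorder.

End Tree.

(** * Reading the forest *)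

Section Init.

Variables (w : nat) (due : nat -> nat) (n : nat) (par : nat -> option nat) (wt : nat -> bool).
Hypothesis W_ge : 1024 * (n + 3) <= 2 ^ w.
Hypothesis par_forest : forest n par.

Local Notation wp := (wp w due).
Local Notation N := n.+1.
Local Notation parent := (parent n par).
Local Notation unvisited := (unvisited n par).

Definition vertex_record (v : nat) : nat * nat * nat := (odflt n (par v), nat_of_bool (wt v), 0).

Definition start_state (ops : seq (nat * nat * nat)) : state :=
  State (fun _ => 0) (fun _ _ => 0) ((n, 0, 0) :: map vertex_record (iota 0 n) ++ ops) 0 [::].

Fixpoint chained (sibling : nat -> nat) (h : nat) (l : seq nat) : bool :=
  if l is v :: l' then (h == v.+1) && chained sibling (sibling v) l' else h == 0.

Lemma chained_upd sibling v y h l : v \notin l ->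
  chained (upd sibling v y) h l = chained sibling h l.
Proof.
elim: l h => //= u l IH h; rewrite inE negb_or => /andP[uv vl].
by rewrite IH // /upd (eq_sym u v) (negbTE uv).
Qed.

Record read_upto (ops : seq (nat * nat * nat)) (i : nat) (s : state) : Prop := ReadUpto {
  read_parent : forall v, v < i -> arr s aParent v = parent v;
  read_weight : forall v, v < i -> arr s aWeight v = wt v;
  read_children : forall p,
    chained (arr s aSibling) (arr s aChild p) [seq v <- rev (iota 0 i) | parent v == p];
  read_pending : pending s = map vertex_record (iota i (n - i)) ++ ops;
  read_count : nread s = i.+1 }.

Lemma rev_iotaS i : rev (iota 0 i.+1) = i :: rev (iota 0 i).
Proof. by rewrite -addn1 iotaD rev_cat add0n. Qed.

Lemma read_vertex ops i s : (forall c, c <= N -> due c = 0) -> i < n ->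
  var s vI = i -> read_upto ops i s ->
  wp (Read vRec0;;
      aParent.[=$vI] <-- $vRec0;;
      aSibling.[=$vI] <-- aChild.[|$vRec0];;
      aChild.[=$vRec0] <-- ($vI + #1);;
      aWeight.[=$vI] <-- $vRec1)%X s 0 (read_upto ops i.+1).
Proof.
move=> due0 i_lt iE [parE wtE chE inE' cnt]; have pi := parent_le par_forest i.
have recE : odflt n (par i) = parent i by rewrite /parent i_lt.
apply: wp_seq0; apply: wp_read.
  by rewrite /timely /read_record; case: (head _ _) => [[? ?] ?]; rewrite /= cnt due0.
have -> : read_record s vRec0 = State (upd (upd (upd (var s) vRec0 (parent i)) vRec0.+1 (wt i))
  vRec0.+2 0)
    (arr s) (map vertex_record (iota i.+1 (n - i.+1)) ++ ops) i.+2 (output s).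
  by rewrite /read_record inE' cnt -(subnSK i_lt) /= recE.
apply: wp_seq0; apply: (wp_store (a := i) (v := parent i)) => //; first by eval_simpl; lia.
apply: wp_seq0; apply: (wp_store (a := i) (v := arr s aChild (parent i))) => //;
  first by eval_simpl; lia.
apply: wp_seq0; apply: (wp_store (a := parent i) (v := i.+1)) => //;
  [by eval_simpl; lia | by eval_simpl; rewrite iE addn1 |].
apply: (wp_store (a := i) (v := wt i)) => //; first by eval_simpl; lia.
split=> //.
- by move=> v lv; eval_simpl; case: eqP => [->//|ne]; apply: parE; lia.
- by move=> v lv; eval_simpl; case: eqP => [->//|ne]; apply: wtE; lia.
move=> p; rewrite /= /upd_array [filter _ _]/= rev_iotaS /=.
have notin : i \notin [seq v <- rev (iota 0 i) | parent v == p].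
  by rewrite mem_filter mem_rev mem_iota add0n ltnn !andbF.
case: eqP => [pE|/eqP ne] /=; rewrite chained_upd // /upd; last by rewrite eq_sym (negbTE ne).
by rewrite -pE !eqxx; apply: chE.
Qed.

Record read_done (ops : seq (nat * nat * nat)) (s : state) : Prop := ReadDone {
  done_n : var s vn = n;
  done_N : var s vN = N;
  done_upto : read_upto ops n s;
  done_root : arr s aParent n = N;
  done_zero : forall i, i \notin [:: aParent; aSibling; aChild; aWeight] -> arr s i = fun _ => 0;
  done_output : output s = [::] }.

Lemma read_spec ops : (forall c, c <= N -> due c = 0) ->
  wp read_cmd (start_state ops) n (read_done ops).
Proof.
move=> due0; apply: wp_seq0; apply: wp_read; first by rewrite /timely /= due0.
apply: wp_seq0; apply: (wp_assign (v := n)) => //.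
apply: wp_seq0; apply: (wp_assign (v := N)); [by eval_simpl; lia | by eval_simpl; rewrite addn1 |].
set s0 := set_var _ _ _.
rewrite -[X in wp _ _ X]addn0;
  apply: wp_then (wp_for (m := n) (Inv := read_upto ops) _ _ _ _ _ _ _ _ _) _ => //.
- by lia.
- by move=> k s x [*]; split.
- by rewrite subn0.
- by split=> //; rewrite subn0.
- by move=> k s U kE /andP[_ lk] upto; apply: read_vertex.
move=> s U [parE wtE chE inE' cnt]; apply: (wp_store (a := n) (v := N)).
- by eval_simpl; lia.
- by rewrite /= (same_var U).
- by rewrite /= (same_var U).
split=> //; try by rewrite /= (same_var U).
- split=> // v lv; rewrite /= /upd_array /= /upd ltn_eqF //; exact: parE.
- by eval_simpl; rewrite eqxx.
- move=> i; rewrite !inE !negb_or => /and4P[n0 n1 n2 n3].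
  rewrite /= /upd_array (negbTE n0) (same_arr U) //= !inE !negb_or n0 n1 n2 n3 //.
- by rewrite /= (same_output U).
Qed.

(** * Numbering the vertices *)

Record searching (ord stk : seq nat) (s : state) : Prop := Searching {
  search_trav : traversal n par ord stk (arr s aEnd);
  search_pos : {in ord, forall v, arr s aPos v = index v ord};
  search_up : forall k, k < size ord -> arr s aUp k =
    if k == 0 then 0 else index (parent (nth 0 ord k)) ord;
  search_child : forall p, chained (arr s aSibling) (arr s aChild p) (unvisited ord p);
  search_next : var s vT = size ord;
  search_cur : var s vCur = head N stk }.

Lemma trav_size ord stk E : traversal n par ord stk E -> size ord <= N.
Proof.
move=> trav; rewrite -(size_iota 0 N); apply: uniq_leq_size (trav_uniq trav) _ => v.
by move/(trav_le trav); rewrite mem_iota.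
Qed.

Section Step.

Variables (ord stk : seq nat) (cur : nat) (s : state).
Hypothesis sr : searching ord (cur :: stk) s.

Let trav := search_trav sr.
Let cur_ord : cur \in ord. Proof. by apply: (trav_sub trav); apply: mem_head. Qed.
Let cur_le : cur <= n. Proof. exact: (trav_le trav). Qed.
Let curE : var s vCur = cur := search_cur sr.

Lemma enter_child_spec c l : unvisited ord cur = c :: l -> var s vU = c.+1 ->
  wp enter_child_cmd s 0 (searching (rcons ord c) (c :: cur :: stk)).
Proof.
move=> chE cE; have c_un : c \in unvisited ord cur by rewrite chE mem_head.
have := c_un; rewrite mem_unvisited => /and3P[c_lt /eqP cp c_new].
have travc := traversal_enter trav c_un; have := trav_size travc; rewrite size_rcons => sz.
have cur_ne : cur != c by apply: contraNneq c_new => <-.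
have := search_child sr cur; rewrite chE /= => /andP[_ chl].
have up0 : index cur ord < size ord by rewrite index_mem.
apply: wp_seq0; apply: (wp_assign (v := c)); [by eval_simpl; lia | by rewrite /= cE subn1 |].
apply: wp_seq0; apply: (wp_store (a := cur) (v := arr s aSibling c)) => //.
- by eval_simpl; lia.
apply: wp_seq0; apply: (wp_store (a := c) (v := size ord)) => //.
- by eval_simpl; lia.
- by eval_simpl; rewrite (search_next sr).
apply: wp_seq0; apply: (wp_store (a := size ord) (v := index cur ord)).
- by eval_simpl; rewrite curE; lia.
- by eval_simpl; rewrite (search_next sr).
- by eval_simpl; rewrite curE (negbTE cur_ne) (search_pos sr).
apply: wp_seq0; apply: (wp_assign (v := (size ord).+1)).
- by eval_simpl; rewrite (search_next sr); lia.
- by eval_simpl; rewrite (search_next sr) addn1.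
apply: (wp_assign (v := c)) => //; split=> //=.
- move=> v; rewrite mem_rcons inE /upd_array /= /upd => /orP[/eqP->|vo].
    by rewrite eqxx (index_rcons_new c_un).
  by rewrite index_rcons_old // (search_pos sr vo) ifN //; apply: contraTneq vo => ->.
- move=> k; rewrite size_rcons ltnS /upd_array /= /upd nth_rcons leq_eqVlt.
  case: (k =P size ord) => [-> _|_ /= lk].
    by rewrite ltnn cp index_rcons_old // ifN // -lt0n; apply: leq_ltn_trans up0.
  rewrite lk (search_up sr lk); case: eqP => // /eqP k0; rewrite index_rcons_old //.
  have ko : nth 0 ord k \in ord by apply: mem_nth.
  have [root_ord root_nth] := trav_root trav.
  case: (trav_parent trav ko) => //; rewrite -root_nth nth_uniq ?(trav_uniq trav) //.
  by case: (ord) root_ord.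
- move=> p; rewrite /upd_array /= /upd; case: (p =P cur) => [->|/eqP np].
    by rewrite (unvisited_enter chE).
  by rewrite (unvisited_enter_other c_un np); apply: search_child sr p.
- by rewrite /upd /= size_rcons.
Qed.

Lemma leave_spec : unvisited ord cur = [::] ->
  (forall v, v < n -> arr s aParent v = parent v) -> arr s aParent n = N ->
  wp leave_cmd s 0 (searching ord stk).
Proof.
move=> no_child parE rootE; have sz := trav_size trav.
have pos_le : index cur ord <= size ord by apply: index_size.
apply: wp_seq0; apply: (wp_store (a := index cur ord) (v := size ord)).
- by eval_simpl; rewrite curE; lia.
- by rewrite /= curE (search_pos sr).
- by eval_simpl; rewrite (search_next sr).
have path := trav_path trav.
apply: (wp_assign (v := head N stk)).
- by eval_simpl; rewrite curE; lia.
- rewrite /= curE /upd_array /=.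
  by case: (stk) path => [/= ->|u stk' [lc <- _]] //=; apply: parE.
have [_ pos up_ ch next _] := sr; split=> //.
by rewrite /= /upd_array /=; apply: traversal_leave.
Qed.

End Step.

Lemma searching_set_var ord stk s x y : x != vT -> x != vCur ->
  searching ord stk s -> searching ord stk (set_var s x y).
Proof. by move=> xT xC [*]; split=> //=; rewrite /upd ifN // eq_sym. Qed.

Lemma searching_start ops s s' : read_done ops s -> arr s' = arr s -> var s' vT = 1 ->
  var s' vCur = n -> searching [:: n] [:: n] s'.
Proof.
move=> [_ _ [_ _ ch _ _] _ zero _] aE tE cE; split; rewrite ?aE //.
- exact: traversal_start.
- by move=> v; rewrite inE => /eqP->; rewrite zero //= eqxx.
- by case=> // _; rewrite zero.
- move=> p; rewrite (_ : unvisited _ _ = [seq v <- rev (iota 0 n) | parent v == p]) //.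
  apply: eq_in_filter => v; rewrite mem_rev mem_iota add0n inE => /andP[_ lv].
  by rewrite neq_ltn lv andbT.
Qed.

Lemma preorder_spec ops s0 : read_done ops s0 ->
  wp preorder_cmd s0 (2 * n + 1) (fun s => exists ord, searching ord [::] s).
Proof.
move=> rd; have [nE NE [parE _ _ _ _] rootE _ _] := rd.
apply: wp_seq0; apply: (wp_assign (v := 1)) => //; first by eval_simpl; lia.
apply: wp_seq0; apply: (wp_assign (v := n)) => //.
pose Inv k s := exists ord stk, searching ord stk s /\ k = 2 * (N - size ord) + size stk.
apply: (wp_while (Inv := Inv)) => [k s U [ord [stk [sr kE]]]|]; last first.
  exists [:: n], [:: n]; split; last by rewrite /=; lia.
  exact: searching_start rd _ _ _.
have U0 : unchanged preorder_cmd s0 s by do 2!apply: unchanged_assign_seq; apply: U.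
have trav := search_trav sr; have curE := search_cur sr.
have stk_le v : v \in stk -> v <= n by move=> vs; apply: (trav_le trav); apply: (trav_sub trav).
split; rewrite //= curE (same_var U0) // NE.
  by case: stk sr stk_le {trav curE kE} => [|cur stk] sr le /=;
    [exists ord | rewrite ltnS le ?mem_head].
case: stk sr trav curE kE stk_le => [|cur stk] sr trav curE kE stk_le; first by rewrite /= ltnn.
move=> _; exists 0; have chE := search_child sr cur; have cur_le := stk_le _ (mem_head _ _).
apply: wp_seq0; apply: (wp_assign (v := arr s aChild cur)).
- by eval_simpl; rewrite curE /=; lia.
- by rewrite /= curE.
have sr' : searching ord (cur :: stk) (set_var s vU (arr s aChild cur)).
  exact: searching_set_var.
apply: (wp_if (b := arr s aChild cur != 0)) => // [ch|/negPn/eqP ch].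
  case E: (unvisited ord cur) chE ch => [|c l] /=; first by move/eqP->.
  move=> /andP[/eqP ch _] _; apply: wp_mono (enter_child_spec sr' E _) (leqnn _) _;
    first by rewrite /= /upd ch.
  move=> s1 _ sr1; have := trav_size (search_trav sr1); rewrite size_rcons => sz.
  exists (2 * (N - (size ord).+1) + (size stk).+2); split; first by rewrite kE /=; lia.
  by exists (rcons ord c), [:: c, cur & stk]; rewrite size_rcons.
case E: (unvisited ord cur) chE ch => [|c l] /=; last by case/andP => /eqP->.
move=> _ _; apply: wp_mono (leave_spec sr' E _ _) (leqnn _) _.
- by move=> v lv; rewrite /= (same_arr U0) // parE.
- by rewrite /= (same_arr U0).
move=> s1 _ sr1; exists (2 * (N - size ord) + size stk); split; first by rewrite kE /=; lia.
by exists ord, stk.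
Qed.

End Init.

(** * Initial tables *)

Section Tables.

Variables (w : nat) (due : nat -> nat) (N : nat).
Hypothesis W_ge : 1024 * (N + 2) <= 2 ^ w.
Hypothesis N_gt0 : 0 < N.
Local Notation wp := (wp w due).

Record block_size (B : nat) (s : state) : Prop := BlockSize {
  size_gt0 : 0 < B;
  size_le : 2 ^ B <= N + 1;
  size_var : var s vB = B;
  size_pow : var s vPow = 2 ^ B }.

Lemma block_size_spec s : var s vN = N ->
  wp block_size_cmd s N (fun s' => exists2 B, block_size B s' & N < 2 ^ B.+1).
Proof.
move=> NE; apply: wp_seq0; apply: (wp_assign (v := 1)) => //; first by eval_simpl; lia.
apply: wp_seq0; apply: (wp_assign (v := 2)) => //; first by eval_simpl; lia.
pose Inv k s' := exists2 B, block_size B s' & N - B <= k.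
apply: (wp_while (Inv := Inv)) => [k s' U [B [B0 B_le BE PE] kE]|]; last first.
  by exists 1; [split=> //; rewrite expn1; lia | rewrite leq_subr].
have NE' : var s' vN = N by rewrite (same_var U).
have pow2 : 2 * 2 ^ B = 2 ^ B.+1 by rewrite expnS.
have ltB := ltn_expl B (isT : 1 < 2).
split.
- by eval_simpl; rewrite NE' PE; case: (N < _); lia.
- by eval_simpl; rewrite NE' PE pow2; case: ltnP => // lt _; exists B.
eval_simpl; rewrite NE' PE pow2; case: ltnP => // le _; exists 0.
apply: wp_seq0; apply: (wp_assign (v := 2 ^ B.+1)).
- by eval_simpl; rewrite PE; lia.
- by eval_simpl; rewrite PE.
apply: (wp_assign (v := B.+1));
  [by eval_simpl; rewrite BE; lia | by eval_simpl; rewrite BE addn1 |].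
exists (N - B.+1); split; first by lia.
by exists B.+1 => //; split=> //; lia.
Qed.

Section Blocks.

Variables (B : nat).
Hypotheses (B_gt0 : 0 < B) (B_le : 2 ^ B <= N + 1).

Record filled (k : nat) (s : state) : Prop := Filled {
  filled_top : forall i, 0 < i < k -> arr s aTop i = (arr s aTop (i %/ 2)).+1;
  filled_pop : forall i, 0 < i < k -> arr s aPop i = arr s aPop (i %/ 2) + i %% 2;
  filled_zero : arr s aTop 0 = 0 /\ arr s aPop 0 = 0;
  filled_le : forall i, i < k -> arr s aTop i <= i /\ arr s aPop i <= i }.

Lemma upd_half (t : nat -> nat) k v i : 0 < i <= k -> upd t k v (i %/ 2) = t (i %/ 2).
Proof. by move=> ik; rewrite /upd ltn_eqF //; lia. Qed.

Lemma fill_spec k s : 0 < k < 2 ^ B -> var s vI = k -> filled k s ->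
  wp (aTop.[=$vI] <-- (aTop.[|$vI %/ #2] + #1);;
      aPop.[=$vI] <-- (aPop.[|$vI %/ #2] + $vI %% #2))%X s 0 (filled k.+1).
Proof.
move=> kB kE [topE popE [top0 pop0] le]; have [|le_t le_p] := le (k %/ 2); first by lia.
apply: wp_seq0; apply: (wp_store (a := k) (v := (arr s aTop (k %/ 2)).+1)) => //.
- by eval_simpl; rewrite kE; have := le_t; lia.
- by eval_simpl; rewrite kE addn1.
apply: (wp_store (a := k) (v := arr s aPop (k %/ 2) + k %% 2)) => //.
- by eval_simpl; rewrite kE; have := le_p; lia.
- by eval_simpl; rewrite kE.
split; rewrite /= /upd_array /=.
- move=> i; rewrite ltnS => ik; rewrite upd_half // /upd; case: eqP => [->//|ne].
  by apply: topE; lia.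
- move=> i; rewrite ltnS => ik; rewrite upd_half // /upd; case: eqP => [->//|ne].
  by apply: popE; lia.
- by rewrite /upd !ifN // neq_ltn; case/andP: kB => ->.
move=> i; rewrite ltnS /upd; case: eqP => [-> _|ne ik]; last by apply: le; lia.
by have := le_t; have := le_p; lia.
Qed.

Lemma tables_spec s : var s vPow = 2 ^ B -> (forall i, arr s aTop i = 0) ->
  (forall i, arr s aPop i = 0) ->
  wp tables_cmd s N (fun s' => top_table B (arr s' aTop) /\ pop_table B (arr s' aPop)).
Proof.
move=> PE top0 pop0; have pow0 := expn_gt0 2 B.
apply: wp_mono (wp_for (Inv := filled) _ _ PE _ _ _ (leqnn _) _ _) _ _ => //.
- by lia.
- by move=> k s' x [*]; split.
- by split=> // [i|i|[|i]]; rewrite ?top0 ?pop0 //; lia.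
- by move=> k s' U kE lk; apply: fill_spec.
- by lia.
by move=> s' _ [topE popE [t0 p0] _]; split; split.
Qed.

Definition block_nodes : seq nat := [seq 2 * (i * B) | i <- iota 0 (N %/ B).+1].

Local Notation nblocks := (N %/ B).+1.
Local Notation next_block i := (i.+1 %% nblocks).

Record linked_blocks (k : nat) (s : state) : Prop := LinkedBlocks {
  linked_bound : forall i, i < k -> arr s aBound (i * B) = 1;
  linked_piece : forall i, i < k -> arr s aPiece (2 * (i * B)) = 2 ^ B - 1;
  linked_next : forall i, i < k -> arr s aNext (2 * (i * B)) = 2 * (next_block i * B);
  linked_prev : forall i, i < k -> arr s aPrev (2 * (next_block i * B)) = 2 * (i * B) }.

Lemma block_start_le i : i < nblocks -> i * B <= N.
Proof. by rewrite ltnS => le; rewrite -leq_divRL. Qed.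

Lemma block_start_eq i j : (i * B == j * B) = (i == j).
Proof. by rewrite eqn_pmul2r. Qed.

Lemma next_block_eq i j : i < nblocks -> j < nblocks -> (next_block i == next_block j) = (i == j).
Proof. by move=> li lj; rewrite -(addn1 i) -(addn1 j) eqn_modDr !modn_small. Qed.

Lemma link_block_spec k s : k < nblocks -> var s vI = k -> var s vBlocks = nblocks ->
  var s vB = B -> var s vPow = 2 ^ B -> linked_blocks k s ->
  wp (vT <-- ($vI * $vB);;
      vU <-- (#2 * ((($vI + #1) %% $vBlocks) * $vB));;
      aBound.[=$vT] <-- #1;;
      aPiece.[=#2 * $vT] <-- ($vPow - #1);;
      aNext.[=#2 * $vT] <-- $vU;;
      aPrev.[=$vU] <-- (#2 * $vT))%X s 0 (linked_blocks k.+1).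
Proof.
move=> k_lt kE nbE BE PE [boundE pieceE nextE prevE].
have kN := block_start_le k_lt; have nN := block_start_le (ltn_pmod k.+1 (ltn0Sn (N %/ B))).
have nb_le : nblocks <= N + 1 by rewrite addn1 ltnS leq_div.
apply: wp_seq0; apply: (wp_assign (v := k * B));
  [by eval_simpl; rewrite kE BE; lia | by eval_simpl; rewrite kE BE |].
apply: wp_seq0; apply: (wp_assign (v := 2 * (next_block k * B))).
- by eval_simpl; rewrite kE BE nbE addn1; lia.
- by eval_simpl; rewrite kE BE nbE addn1.
apply: wp_seq0; apply: (wp_store (a := k * B) (v := 1)) => //; first by eval_simpl; lia.
apply: wp_seq0; apply: (wp_store (a := 2 * (k * B)) (v := 2 ^ B - 1)).
- by eval_simpl; rewrite PE; lia.
- by [].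
- by eval_simpl; rewrite PE.
apply: wp_seq0; apply: (wp_store (a := 2 * (k * B)) (v := 2 * (next_block k * B))) => //.
- by eval_simpl; lia.
apply: (wp_store (a := 2 * (next_block k * B)) (v := 2 * (k * B))) => //.
- by eval_simpl; lia.
split=> i; rewrite ltnS /= /upd_array /= /upd => ik; have iN := leq_ltn_trans ik k_lt;
  rewrite ?eqn_pmul2l // ?block_start_eq ?next_block_eq //; case: eqP => [E|ne]; rewrite ?E //.
- by apply: boundE; lia.
- by apply: pieceE; lia.
- by apply: nextE; lia.
- by apply: prevE; lia.
Qed.

Lemma blocks_spec s : var s vN = N -> var s vB = B -> var s vPow = 2 ^ B ->
  wp blocks_cmd s (N + 1) (fun s' =>
    (forall b, b <= N -> block B b = b ->
       arr s' aBound b = 1 /\ arr s' aPiece (2 * b) = 2 ^ B - 1) /\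
    ring (arr s' aNext) (arr s' aPrev) block_nodes).
Proof.
move=> NE BE PE; have nb_le : nblocks <= N + 1 by rewrite addn1 ltnS leq_div.
apply: wp_seq0; apply: (wp_assign (v := nblocks)).
- by eval_simpl; rewrite NE BE; lia.
- by eval_simpl; rewrite NE BE addn1.
apply: wp_mono (wp_for (m := nblocks) (Inv := linked_blocks) _ _ _ _ _ _ (leqnn _) _ _) _ _ => //.
- by lia.
- by move=> k s' x [*]; split.
- by move=> k s' U kE /andP[_ lk]; apply: link_block_spec; rewrite // (same_var U).
move=> s' _ [boundE pieceE nextE prevE]; split.
  move=> b bN <-; have lt : b %/ B < nblocks by rewrite ltnS leq_div2r.
  by rewrite boundE ?pieceE.
have nthE i : i < nblocks -> nth 0 block_nodes i = 2 * (i * B).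
  by move=> li; rewrite (nth_map 0) ?size_iota // nth_iota.
apply: ringP; rewrite size_map size_iota => i li.
by rewrite !nthE ?ltn_mod // nextE ?prevE.
Qed.

Local Notation block := (block B).
Local Notation offset := (offset B).

Section Ancestors.

Variable R : nat -> nat.
Hypothesis R_bound : forall x, x < N -> x < R x <= N.

Local Notation covers := (covers R).
Local Notation ancestor_mask k := (mask B (fun o => covers (block k + o) k)).

Lemma ancestor_mask0 : ancestor_mask 0 = 2 ^ offset 0.
Proof.
rewrite /block /offset div0n mul0n mod0n -(mask1 B_gt0); apply: eq_mask => o _.
by rewrite add0n /covers leqn0; case: eqP => // ->; case/andP: (R_bound N_gt0).
Qed.

Lemma ancestor_mask_step k p : k < N -> p < k ->
  (forall y, y < N -> y != k -> covers y k = covers y p) ->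
  2 ^ offset k + (block p == block k) * ancestor_mask p = ancestor_mask k.
Proof.
move=> kN pk same; have kk : covers k k by rewrite /covers leqnn; case/andP: (R_bound kN).
have coversE y : covers y k = (y == k) || covers y p.
  case: (y =P k) => [->//|/eqP yk] /=; case: (ltnP y N) => yN; first exact: same.
  by rewrite /covers; lia.
have kp : covers k p = false by rewrite /covers; lia.
case: (altP eqP) => [bE|/eqP bN]; rewrite ?mul1n ?mul0n ?addn0.
  rewrite bE addnC mask_set ?offset_lt // -?block_offset //.
  by apply: eq_mask => o _; rewrite coversE eq_block_add orbC.
rewrite -(mask1 (offset_lt B_gt0 k)); apply: eq_mask => o _.
rewrite coversE eq_block_add; case: (o =P _) => //= _; apply/esym/negbTE/negP => /andP[le _].
by apply: bN; apply: (block_eq B_gt0); have := block_gt B_gt0 k; lia.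
Qed.

Lemma ancestor_mask_le k : ancestor_mask k <= N.
Proof. by have := mask_lt B (fun o => covers (block k + o) k); lia. Qed.

Lemma ancestors_spec s : var s vN = N -> var s vB = B ->
  (forall k, arr s aAnc k = 0) -> arr s aUp 0 = 0 ->
  (forall k, 0 < k < N -> arr s aUp k < k /\
     forall y, y < N -> y != k -> covers y k = covers y (arr s aUp k)) ->
  wp ancestors_cmd s N (fun s' => forall k, k < N -> arr s' aAnc k = ancestor_mask k).
Proof.
move=> NE BE anc0 up0 upE.
pose Inv k s' := forall j, arr s' aAnc j = if j < k then ancestor_mask j else 0.
apply: wp_mono (wp_for (Inv := Inv) _ _ NE _ _ _ (leqnn _) _ _) _ _ => //.
- by lia.
- move=> k s' U kE /andP[_ kN] anc; set p := arr s aUp k.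
  have pE : arr s' aUp k = p by rewrite (same_arr U).
  have BE' : var s' vB = B by rewrite (same_var U).
  have pk : p <= k by rewrite /p; case: (posnP k) => [->|k0];
    [rewrite up0 | case: (upE k) => //; lia].
  have val : 2 ^ offset k + (p %/ B == k %/ B) * arr s' aAnc p = ancestor_mask k.
    have -> : (p %/ B == k %/ B) = (block p == block k) by rewrite /block eqn_pmul2r.
    rewrite anc; case: (posnP k) => [k0|k0]; first by rewrite k0 ltn0 muln0 addn0 ancestor_mask0.
    have [|lt same] := upE k; first by rewrite k0.
    by rewrite lt ancestor_mask_step.
  have := ancestor_mask_le k; rewrite -val => mN.
  apply: (wp_store (a := k) (v := ancestor_mask k)) => //.
  + by eval_simpl; rewrite kE BE' pE mul1n -/(offset k); lia.
  + by eval_simpl; rewrite kE BE' pE mul1n -/(offset k).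
  + move=> j; rewrite /= /upd_array /= /upd ltnS leq_eqVlt.
    by case: (j =P k) => [->|_] //=; apply: anc.
- by rewrite subn0.
by move=> s' _ anc k kN; rewrite anc kN.
Qed.

End Ancestors.

Section Weights.

Variables (n : nat) (ord : seq nat) (wt : nat -> bool).
Hypotheses (N_n : N = n.+1) (ord_uniq : uniq ord) (ord_size : size ord = N).
Hypothesis ord_mem : forall v, v < n -> v \in ord.

Definition weight_below (i y : nat) : bool := [&& y < N, nth 0 ord y < i & wt (nth 0 ord y)].

Lemma weight_belowS i y : i < n ->
  weight_below i.+1 y = weight_below i y || (wt i && (y == index i ord)).
Proof.
move=> li; have lx : index i ord < N by rewrite -ord_size index_mem ord_mem.
rewrite /weight_below ltnS [nth 0 ord y <= i]leq_eqVlt; case: (ltnP y N) => yN /=; last first.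
  by rewrite andbC; case: eqP => // E; rewrite E leqNgt lx in yN.
have -> : (nth 0 ord y == i) = (y == index i ord).
  by rewrite -{1}(nth_index 0 (ord_mem li)) nth_uniq ?ord_size.
case: (y =P _) => [->|_] /=; last by rewrite andbF orbF.
by rewrite nth_index ?ord_mem // ltnn /= andbT.
Qed.

Lemma weight_belowC i : i < n -> weight_below i (index i ord) = false.
Proof. by move=> li; rewrite /weight_below nth_index ?ord_mem // ltnn andbF. Qed.

Lemma weight_mask i (x := index i ord) : i < n ->
  mask B (fun o => weight_below i (block x + o)) + wt i * 2 ^ offset x =
  mask B (fun o => weight_below i.+1 (block x + o)).
Proof.
move=> li; case wi: (wt i).
  rewrite mul1n mask_block_set //; last exact: weight_belowC.
  by apply: eq_mask => o _; rewrite weight_belowS // wi.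
by rewrite addn0; apply: eq_mask => o _; rewrite weight_belowS // wi orbF.
Qed.

Definition weights_upto (i : nat) (s : state) : Prop :=
  block_masks N B (weight_below i) (arr s aBits) /\ arr s aSum 0 = \sum_(0 <= v < i) wt v.

Lemma weight_spec i s : i < n -> var s vI = i -> var s vB = B ->
  arr s aPos i = index i ord -> arr s aWeight i = wt i -> weights_upto i s ->
  wp (vX <-- aPos.[|$vI];;
      vOff <-- ($vX %% $vB);;
      vBlock <-- ($vX - $vOff);;
      aBits.[=$vBlock] <-- (aBits.[|$vBlock] + (aWeight.[|$vI] <<< $vOff));;
      aSum.[=#0] <-- (aSum.[|#0] + aWeight.[|$vI]))%X s 0 (weights_upto i.+1).
Proof.
move=> li iE BE posE wtE [masks sumE]; set x := index i ord in posE.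
have lx : x < N by rewrite -ord_size index_mem ord_mem.
have Ex := block_offset B x; have bx := block_masks_at B_gt0 masks (ltnW lx).
have wm := weight_mask li; rewrite -/x -bx in wm.
have mN := mask_lt B (fun o => weight_below i.+1 (block x + o)).
have sN := sum_wt_le i.+1 wt xpredT; rewrite big_nat_recr //= in sN.
apply: wp_seq0; apply: (wp_assign (v := x));
  [by eval_simpl; rewrite iE; lia | by eval_simpl; rewrite iE |].
apply: wp_seq0; apply: (wp_assign (v := offset x)) => //; first by eval_simpl; rewrite BE.
apply: wp_seq0; apply: (wp_assign (v := block x)); [by eval_simpl; lia | by eval_simpl; lia |].
apply: wp_seq0; apply: (wp_store (a := block x)
  (v := mask B (fun o => weight_below i.+1 (block x + o)))) => //.
- by eval_simpl; rewrite iE wtE; lia.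
- by eval_simpl; rewrite iE wtE.
apply: (wp_store (a := 0) (v := \sum_(0 <= v < i.+1) wt v)) => //.
- by eval_simpl; rewrite iE wtE sumE; lia.
- by eval_simpl; rewrite iE wtE sumE big_nat_recr.
split=> //; rewrite /= /upd_array /=; apply: (block_masks_upd B_gt0 masks) => // z zx.
by rewrite weight_belowS // (negbTE zx) andbF orbF.
Qed.

Lemma weights_spec s : var s vn = n -> var s vB = B ->
  (forall v, v < n -> arr s aPos v = index v ord) -> (forall v, v < n -> arr s aWeight v = wt v) ->
  (forall b, arr s aBits b = 0) -> arr s aSum 0 = 0 -> wp weights_cmd s n (weights_upto n).
Proof.
move=> nE BE posE wtE bits0 sum0.
apply: (wp_for (Inv := weights_upto) _ _ nE) => //.
- by lia.
- by rewrite subn0.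
- split; last by rewrite sum0 big_nil.
  by move=> b _ _; rewrite bits0 mask0 // => o _; rewrite /weight_below ltn0 andbF.
- move=> i s' U iE /andP[_ li]; apply: weight_spec; rewrite ?(same_arr U) ?posE ?wtE //.
  by rewrite (same_var U).
Qed.

End Weights.

End Blocks.

End Tables.

(** * The initial invariant *)

Section Initial.

Variables (N B : nat) (R : nat -> nat) (wt : nat -> bool).
Hypothesis B_gt0 : 0 < B.

Local Notation block := (block B).
Local Notation offset := (offset B).
Local Notation nnodes := (2 * N + 2).

Lemma boundary_unmarked g : boundary B R xpred0 g = (offset g == 0).
Proof. by rewrite /boundary has_pred0 orbF. Qed.

Lemma offset_block b o : block b = b -> o < B -> offset (b + o) = o.
Proof.
by move=> bb oB; have := block_offset B (b + o); rewrite -{2}bb block_add // bb => /addnI.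
Qed.

Lemma piece_of_unmarked y : piece_of B R xpred0 y = 2 * block y.
Proof.
case: (piece_ofP R B_gt0 xpred0 y) => // g bg; rewrite boundary_unmarked => /eqP/block_offset0 bb *.
by rewrite -bg bb.
Qed.

Lemma piece_unmarked k : piece N B R xpred0 k = (k \in block_nodes N B).
Proof.
rewrite /piece boundary_unmarked; apply/andP/mapP => [[kN]|[i]].
  case O: (odd k) => // /eqP/block_offset0 bb; exists (k %/ 2 %/ B).
    by rewrite mem_iota /= add0n ltnS leq_div2r.
  by rewrite -[_ * B]/(block (k %/ 2)) bb; lia.
rewrite mem_iota /= add0n => iN ->; rewrite !nodeE /offset modnMl eqxx.
by split=> //; apply: (block_start_le B_gt0).
Qed.

Lemma class_list_unmarked c : class_list nnodes (piece N B R xpred0) (fun _ => 0) c =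
  if c == 0 then block_nodes N B else [::].
Proof.
case: (posnP c) => [->|c_gt0]; last first.
  rewrite /class_list (eq_filter (a2 := pred0)) ?filter_pred0 // => k.
  by rewrite ltn_eqF ?andbF.
apply: irr_sorted_eq ltn_trans ltnn _ _ (sorted_class_list _ _ _ _) _ _ => [|k].
  rewrite sorted_map; apply: sub_sorted (iota_ltn_sorted 0 _) => i j /=.
  by rewrite ltn_mul2l ltn_mul2r B_gt0.
by rewrite mem_class_list ?andbT ?piece_unmarked //; apply: piece_lt.
Qed.

Lemma potential_unmarked : N < 2 ^ B.+1 -> potential N B R xpred0 (fun _ => 0) <= N.
Proof.
move=> N_lt; rewrite /potential
  (eq_bigr (fun c => if c == 0 then phi (size (block_nodes N B)) else 0)); last first.
  by move=> c _; rewrite class_list_unmarked; case: (c == 0).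
case: (posnP N) => [->|N_gt0]; first by rewrite big_geq.
rewrite big_ltn // big_nat big1 ?addn0 => [|[]//]; rewrite /= size_map size_iota /phi.
have le : (N %/ B).+1 - 2 <= N %/ B by rewrite subSS leq_subr.
apply: leq_trans (leq_divM N B); apply: (leq_mul le).
rewrite -ltnS -(ltn_exp2l _ _ (isT : 1 < 2)); apply: leq_ltn_trans _ N_lt.
case: (posnP ((N %/ B).+1 - 2)) => [->|pos]; first by rewrite trunc_log0.
exact: leq_trans (trunc_logP (isT : 1 < 2) pos) (leq_trans le (leq_div N B)).
Qed.

Lemma initial_inv s : (forall y, wt y -> y < N) -> static_tables N B R s ->
  (forall b, b <= N -> block b = b -> arr s aBound b = 1 /\ arr s aPiece (2 * b) = 2 ^ B - 1) ->
  ring (arr s aNext) (arr s aPrev) (block_nodes N B) -> block_masks N B wt (arr s aBits) ->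
  arr s aSum 0 = \sum_(0 <= y < N) wt y ->
  arr s aMark = (fun _ => 0) -> arr s aLabel = (fun _ => 0) -> data_invariant N B R xpred0 wt s.
Proof.
move=> wt_lt st blocks rng bits sum0 mark0 lab0; split; rewrite ?lab0 //.
- split=> //; rewrite ?mark0.
  + by move=> b _ _; rewrite mask0.
  + move=> b bN bb; have [-> _] := blocks b bN bb.
    rewrite -[LHS](mask1 B_gt0); apply: eq_mask => o oB.
    by rewrite boundary_unmarked offset_block.
  + move=> k; rewrite piece_unmarked => /mapP[i]; rewrite mem_iota => /= iN ->.
    have bb : block (i * B) = i * B by rewrite /block mulnK.
    have [_ ->] := blocks (i * B) (block_start_le B_gt0 iN) bb.
    by exists xpredT; rewrite ?maskT // => o oB _;
      rewrite piece_of_unmarked nodeE block_add ?bb ?eqxx.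
- by move=> c; rewrite class_list_unmarked; case: ifP.
- by move=> c; rewrite /is_label orbF => /eqP->; rewrite sum0; apply: eq_bigl => y; rewrite eqxx.
Qed.

End Initial.

(** * Initialization *)

Section Initialization.

Variables (w : nat) (due : nat -> nat) (n : nat) (par : nat -> option nat) (wt : nat -> bool).
Hypothesis W_ge : 1024 * (n + 3) <= 2 ^ w.
Hypothesis par_forest : forest n par.

Local Notation wp := (wp w due).
Local Notation N := n.+1.
Local Notation parent := (parent n par).

Definition at_position (ord : seq nat) (wt' : nat -> bool) : nat -> bool :=
  weight_below N ord wt' n.

Record initialized (ops : seq (nat * nat * nat)) (ord : seq nat) (B : nat) (R : nat -> nat)
    (s : state) : Prop := Initialized {
  init_pre : preorder n par ord R;
  init_B : 0 < B;
  init_B_le : 2 ^ B <= N + 1;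
  init_n : var s vn = n;
  init_pos : forall v, v < n -> arr s aPos v = index v ord;
  init_parent : forall v, v < n -> arr s aParent v = parent v;
  init_inv : data_invariant N B R xpred0 (at_position ord wt) s;
  init_potential : potential N B R xpred0 (arr s aLabel) <= N;
  init_pending : pending s = ops;
  init_nread : nread s = n.+1;
  init_output : output s = [::] }.

Lemma W_geN : 1024 * (N + 2) <= 2 ^ w.
Proof. by apply: leq_trans W_ge; rewrite leq_mul2l; lia. Qed.

Lemma covers_parent ord R k : preorder n par ord R -> 0 < k < N ->
  index (parent (nth 0 ord k)) ord < k /\
  forall y, y < N -> y != k -> covers R y k = covers R y (index (parent (nth 0 ord k)) ord).
Proof.
move=> pre /andP[k0 kN]; have idx := index_nth_pre pre; have le := nth_pre_le pre.
have k_lt : nth 0 ord k < n.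
  rewrite ltn_neqAle le // andbT -(pre_root pre) nth_uniq ?(pre_size pre) ?(pre_uniq pre) //.
  by rewrite -lt0n.
have := pre_parent pre k_lt; rewrite idx // => p_lt; split=> // y yN yk.
have pN := ltn_trans p_lt kN; have pE := nth_index 0 (_ : parent (nth 0 ord k) \in ord).
have anc_k := preorder_ancestor pre yN kN; have anc_p := preorder_ancestor pre yN pN.
rewrite pE ?(pre_mem pre) ?parent_le // in anc_p.
apply/idP/idP => [/anc_k/ancestor_parent[yk'|]|/anc_p y_anc]; [|by move/anc_p|].
  by rewrite -(idx y yN) yk' idx // eqxx in yk.
by apply/anc_k/ancestor_parent; right.
Qed.

Lemma sum_preorder ord R (f : nat -> nat) (P : pred nat) : preorder n par ord R ->
  \sum_(0 <= y < N | P y) f (nth 0 ord y) = \sum_(0 <= v < N | P (index v ord)) f v.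
Proof.
move=> pre; have perm : perm_eq ord (index_iota 0 N).
  apply: uniq_perm; rewrite ?(pre_uniq pre) ?iota_uniq // => v.
  by rewrite (pre_mem pre) mem_index_iota.
rewrite -[RHS](perm_big _ perm) /= [RHS](big_nth 0) (pre_size pre).
rewrite big_nat_cond [RHS]big_nat_cond; apply: eq_bigl => y.
by case: (ltnP y N) => yN; rewrite ?andbF //= (index_nth_pre pre).
Qed.

Lemma sum_at_position ord R wt' (P : pred nat) : preorder n par ord R ->
  \sum_(0 <= y < N | P y) at_position ord wt' y = \sum_(0 <= v < n | P (index v ord)) wt' v.
Proof.
move=> pre; pose f v : nat := (v < n) && wt' v.
transitivity (\sum_(0 <= y < N | P y) f (nth 0 ord y)).
  rewrite big_nat_cond [RHS]big_nat_cond; apply: eq_bigr => y /andP[/andP[_ yN] _].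
  by rewrite /at_position /weight_below yN.
rewrite (sum_preorder f P pre) big_mkcond big_nat_recr //= {2}/f ltnn if_same addn0 -big_mkcond /=.
by rewrite big_nat_cond [RHS]big_nat_cond; apply: eq_bigr => v /andP[/andP[_ vn] _]; rewrite /f vn.
Qed.

Record numbered (ord : seq nat) (R : nat -> nat) (s : state) : Prop := Numbered {
  num_n : var s vn = n;
  num_N : var s vN = N;
  num_pos : forall v, v < n -> arr s aPos v = index v ord;
  num_end : arr s aEnd = R;
  num_up : forall k, k < N -> arr s aUp k = if k == 0 then 0 else index (parent (nth 0 ord k)) ord;
  num_weight : forall v, v < n -> arr s aWeight v = wt v;
  num_zero : {in [:: aAnc; aMark; aBits; aLabel; aSum], forall i, arr s i = fun _ => 0} }.

Lemma numbered_unchanged c ord R s s' : unchanged c s s' -> vn \notin assigned c ->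
  vN \notin assigned c ->
  ~~ has (mem (stored c)) [:: aPos; aEnd; aUp; aWeight; aAnc; aMark; aBits; aLabel; aSum] ->
  numbered ord R s -> numbered ord R s'.
Proof.
move=> U nn nN; rewrite -all_predC => /allP keep [nE NE posE endE upE wtE zero].
have same i : i \in [:: aPos; aEnd; aUp; aWeight; aAnc; aMark; aBits; aLabel; aSum] ->
  arr s' i = arr s i by move/keep => ni; apply: (same_arr U).
split; rewrite ?(same_var U) ?same // => i ni; rewrite same ?zero //.
by move: ni; rewrite !inE => /or4P[|||/orP[|]] /eqP->.
Qed.

Section Setup.

Variables (ord : seq nat) (R : nat -> nat).
Hypothesis pre : preorder n par ord R.

Lemma structures_spec B s : 0 < B -> 2 ^ B <= N + 1 -> numbered ord R s ->
  var s vB = B -> var s vPow = 2 ^ B -> top_table B (arr s aTop) -> pop_table B (arr s aPop) ->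
  wp (blocks_cmd;; ancestors_cmd;; weights_cmd) s (N + 1 + (N + n)) (fun s' =>
    data_invariant N B R xpred0 (at_position ord wt) s' /\ arr s' aLabel = fun _ => 0).
Proof.
move=> B0 B_le [nE NE posE endE upE wtE zero] BE PE top_s pop_s; have N0 : 0 < N by [].
apply: wp_then (blocks_spec due W_geN N0 B0 B_le NE BE PE) _ => s1 U1 [blocks1 ring1].
apply: wp_then (ancestors_spec due W_geN N0 B0 B_le (preorder_bound pre) _ _ _ _ _) _ =>
  [|||||s2 U2 anc2];
  rewrite ?(same_var U1) ?(same_arr U1) ?upE //.
- by move=> k; rewrite zero.
- by move=> k k_in; have /andP[k0 kN] := k_in; rewrite upE // ifN -?lt0n //; apply: covers_parent.
apply: wp_mono (weights_spec (ord := ord) (wt := wt) due W_geN N0 B0 B_le erefl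
  (pre_uniq pre) (pre_size pre) _ _ _ _ _ _ _) (leqnn _) _;
  rewrite ?(same_var U2) ?(same_var U1) ?(same_arr U2) ?(same_arr U1) //; try by rewrite zero.
- by move=> v vn; rewrite (pre_mem pre) ltnW.
move=> s3 U3 [bits3 sum3]; have U := unchanged_seq U1 (unchanged_seq U2 U3).
split; last by rewrite (same_arr U) ?zero.
apply: (initial_inv B0); try by rewrite (same_arr U) ?zero.
- by move=> y /and3P[].
- split; rewrite ?(same_var U3) ?(same_arr U3) // ?(same_var U2) ?(same_arr U2) //;
    by rewrite ?(same_var U1) ?(same_arr U1) ?endE.
- by rewrite !(same_arr U3) ?(same_arr U2).
- by rewrite !(same_arr U3) ?(same_arr U2).
- exact: bits3.
- by rewrite sum3 (sum_at_position wt xpredT pre).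
Qed.

Lemma setup_spec s : numbered ord R s -> arr s aTop = (fun _ => 0) -> arr s aPop = (fun _ => 0) ->
  wp setup_cmd s (5 * N) (fun s' => exists B,
    [/\ 0 < B, 2 ^ B <= N + 1, data_invariant N B R xpred0 (at_position ord wt) s' &
        potential N B R xpred0 (arr s' aLabel) <= N]).
Proof.
move=> num top0 pop0; have N0 : 0 < N by [].
have le5 : N + (N + (N + 1 + (N + n))) <= 5 * N by lia.
apply: wp_mono le5 (fun _ _ h => h).
apply: wp_then (block_size_spec due W_geN N0 (num_N num)) _ => s1 U1 [B [B0 B_le BE PE] N_lt].
apply: wp_then (tables_spec due W_geN N0 B0 B_le PE _ _) _ => [i|i|s2 U2 [top2 pop2]];
  rewrite ?(same_arr U1) ?top0 ?pop0 //.
have num2 : numbered ord R s2.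
  by apply: (numbered_unchanged U2) => //; apply: (numbered_unchanged U1).
apply: wp_mono (structures_spec B0 B_le num2 _ _ top2 pop2) (leqnn _) _; rewrite ?(same_var U2) //.
move=> s3 _ [inv lab0]; exists B; split=> //.
by rewrite lab0; apply: potential_unmarked.
Qed.

End Setup.

Lemma init_spec ops : (forall c, c <= N -> due c = 0) ->
  wp init_cmd (start_state n par wt ops) (10 * N) (fun s => exists ord B R,
    initialized ops ord B R s).
Proof.
move=> due0; have le10 : n + ((2 * n + 1) + 5 * N) <= 10 * N by lia.
apply: wp_mono le10 (fun _ _ h => h).
apply: wp_then (read_spec wt W_ge par_forest ops due0) _ => s1 _ rd.
apply: wp_then (preorder_spec due W_ge rd) _ => s2 U2 [ord [trav pos up _ _ _]].
have pre := traversal_finish par_forest trav; have [nE NE [parE wtE _ pnd cnt] _ zero out] := rd.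
have num : numbered ord (arr s2 aEnd) s2.
  split; rewrite ?(same_var U2) //.
  - by move=> v vn; apply: pos; rewrite (pre_mem pre) ltnW.
  - by rewrite -(pre_size pre).
  - by move=> v vn; rewrite (same_arr U2) ?wtE.
  - by move=> i ni; rewrite (same_arr U2) ?zero //; move: i ni; apply/allP.
apply: wp_mono (setup_spec pre num _ _) (leqnn _) _; try by rewrite (same_arr U2) ?zero.
move=> s3 U3 [B [B0 B_le inv pot]]; exists ord, B, (arr s2 aEnd).
have [pend nr] := same_input U3 isT; have [pend2 nr2] := same_input U2 isT.
split; rewrite ?(same_var U3) ?(same_var U2) ?(same_output U3) ?(same_output U2) //.
- by move=> v vn; rewrite (same_arr U3) // pos // (pre_mem pre) ltnW.
- by move=> v vn; rewrite (same_arr U3) // (same_arr U2) // parE.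
- by rewrite pend pend2 pnd subnn.
- by rewrite nr nr2.
Qed.

End Initialization.

(** * Serving the operations *)

Section Roots.

Variables (n : nat) (par : nat -> option nat) (ord : seq nat) (R : nat -> nat).
Hypotheses (par_forest : forest n par) (pre : preorder n par ord R).

Local Notation N := n.+1.
Local Notation parent := (parent n par).
Local Notation ancestor := (ancestor n par).
Local Notation at_position := (at_position n ord).

Lemma at_position_index P v : v < n -> at_position P (index v ord) = P v.
Proof.
move=> vn; rewrite /at_position /weight_below (index_lt_pre pre (ltnW vn)).
by rewrite (nth_index_pre pre (ltnW vn)) vn.
Qed.

Lemma eq_at_position P P' : (forall v, v < n -> P v = P' v) -> at_position P =1 at_position P'.
Proof.
by move=> PP' x; rewrite /at_position /weight_below; case: ltnP => //= _; case: ltnP => //= /PP'->.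
Qed.

Lemma at_position_upd P Q v : v < n -> (forall u, u != v -> P u = Q u) ->
  at_position P =1 fun x => if x == index v ord then P v else at_position Q x.
Proof.
move=> vn PQ x; case: eqP => [->|xv]; first exact: at_position_index.
rewrite /at_position /weight_below; case: ltnP => //= xN; rewrite PQ //.
by apply/eqP => xE; apply: xv; rewrite -xE (index_nth_pre pre).
Qed.

Lemma at_position_mark P v : v < n -> at_position (mark P v) =1 mark (at_position P) (index v ord).
Proof.
move=> vn x; rewrite (at_position_upd (Q := P) vn) => [|u /negbTE uv];
  last by rewrite /mark uv orbF.
by rewrite /mark; case: eqP => _; rewrite ?eqxx ?orbT ?orbF.
Qed.

Lemma at_position_set_wt P v b :
  v < n -> at_position (set_wt P v b) =1 set_wt (at_position P) (index v ord) b.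
Proof.
move=> vn x; rewrite (at_position_upd (Q := P) vn) => [|u /negbTE uv]; last by rewrite /set_wt uv.
by rewrite /set_wt eqxx.
Qed.

Definition is_root (par' : nat -> option nat) (v : nat) : bool := ~~ par' v.

Definition subforest (par' : nat -> option nat) : Prop := forall v, par' v = None \/ par' v = par v.

Lemma subforest_cut par' v : subforest par' -> subforest (cut_par par' v).
Proof. by move=> sub u; rewrite /cut_par; case: eqP => // _; left. Qed.

Variable par' : nat -> option nat.
Hypothesis sub : subforest par'.

Local Notation root := (root_of n par').

Lemma up_cases v : v < n -> is_root par' v /\ up par' v = v \/
  ~~ is_root par' v /\ up par' v = parent v /\ parent v < n.
Proof.
rewrite /is_root /up /parent => vn; case E: (par' v) => [u|]; [right | by left].
case: (sub v) => Ev; rewrite Ev // in E; rewrite vn E /=; split=> //; split=> //.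
by case: par_forest => par_lt _; apply: par_lt E.
Qed.

Lemma anc_lt k v : v < n -> anc par' k v < n.
Proof. by move=> vn; elim: k => //= k IH; case: (up_cases IH) => [[_ ->]|[_ [-> ]]]. Qed.

Lemma ancestor_anc k v : v < n -> ancestor (anc par' k v) v.
Proof.
move=> vn; elim: k => [|k IH]; first exact: ancestor_refl.
rewrite /anc iterS; case: (up_cases (anc_lt k vn)) => [[_ ->]|[_ [-> _]]] //.
by apply: ancestor_trans IH; apply/ancestor_parent; right; apply: ancestor_refl.
Qed.

Lemma root_is_root v : v < n -> is_root par' (root v).
Proof.
move=> vn; suff climb k : is_root par' (anc par' k v) ||
  (index (anc par' k v) ord + k <= index v ord).
  have := index_gt0_pre pre (anc_lt n vn); have := index_lt_pre pre (ltnW vn).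
  by case/orP: (climb n) => //; rewrite -/(root v); lia.
elim: k => [|k IH]; first by rewrite addn0 leqnn orbT.
have an := anc_lt k vn; rewrite /anc iterS -/(anc par' k v).
case: (up_cases an) => [[top ->]|[/negbTE nroot [-> _]]]; first by rewrite top.
by apply/orP; right; move: IH (pre_parent pre an); rewrite nroot /=; lia.
Qed.

Lemma ancestor_root d v : v < n -> is_root par' d -> ancestor d v -> ancestor d (root v).
Proof.
move=> vn droot dv; rewrite /root_of; elim: {2}n => // k IH.
rewrite /anc iterS -/(anc par' k v); case: (up_cases (anc_lt k vn)) => [[_ ->]|[nroot [-> _]]] //.
by case/ancestor_parent: IH => // dE; rewrite -dE droot in nroot.
Qed.

Variable D : nat -> bool.
Hypothesis D_roots : D =1 at_position (is_root par').

Let D_lt d : D d -> d < N. Proof. by rewrite D_roots => /and3P[]. Qed.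

Lemma covers_root d v : D d -> v < n -> covers R d (index (root v) ord) = covers R d (index v ord).
Proof.
rewrite D_roots => /and3P[dN dn droot] vn; have rn := anc_lt n vn.
have pos u (un : u < n) := preorder_ancestor pre dN (index_lt_pre pre (ltnW un)).
have := pos _ rn; have := pos _ vn; rewrite !(nth_index_pre pre) ?(ltnW vn) ?(ltnW rn) //.
move=> [to_v from_v] [to_r from_r]; apply/idP/idP => [/from_r|/from_v] anc_d.
  by apply: to_v; apply: ancestor_trans anc_d (ancestor_anc n vn).
by apply: to_r; apply: ancestor_root.
Qed.

Lemma root_position v : v < n -> D (index (root v) ord).
Proof. by move=> vn; rewrite D_roots at_position_index ?anc_lt // root_is_root. Qed.

Lemma root_position_le u v : u < n -> v < n -> same_side N R D (index u ord) (index v ord) ->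
  index (root u) ord <= index (root v) ord.
Proof.
move=> un vn /(same_sideP R _ _ D_lt) same; have Dr := root_position un.
have : covers R (index (root u) ord) (index (root v) ord).
  rewrite covers_root // -same // -covers_root // /covers leqnn.
  by case/andP: (preorder_bound pre (D_lt Dr)).
by case/andP.
Qed.

Lemma root_eq u v : u < n -> v < n ->
  (root u == root v) = same_side N R D (index u ord) (index v ord).
Proof.
move=> un vn; apply/eqP/idP => [E|same].
  by apply/(same_sideP R _ _ D_lt) => d Dd; rewrite -(covers_root Dd un) -(covers_root Dd vn) E.
rewrite -[root u](nth_index_pre pre (ltnW (anc_lt n un))).
rewrite -[root v](nth_index_pre pre (ltnW (anc_lt n vn))); congr nth; apply/eqP;
  rewrite eqn_leq !root_position_le //.
by apply/(same_sideP R _ _ D_lt) => d Dd; rewrite (same_sideP R _ _ D_lt same).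
Qed.

Lemma tree_sum_positions wf wt v : wf =1 at_position wt -> v < n ->
  \sum_(0 <= y < N | same_side N R D y (index v ord)) wf y = tree_sum n par' wt v.
Proof.
move=> wfE vn; under eq_bigr => y _ do rewrite wfE.
rewrite (sum_at_position wt (fun y => same_side N R D y (index v ord)) pre) /tree_sum big_mkord.
by apply: eq_bigl => u; rewrite root_eq.
Qed.

End Roots.

Lemma eq_potential N B R D D' lab : D =1 D' -> potential N B R D lab = potential N B R D' lab.
Proof.
move=> DD'; apply: eq_bigr => c _; congr (phi (size _)); apply: eq_filter => k.
by rewrite /piece /boundary DD'; congr ((_ && (if _ then _ else _ || _)) && _);
  apply: eq_has => d; rewrite DD'.
Qed.

Definition op_par (o : op) (par : nat -> option nat) : nat -> option nat :=
  if o is Cut v then cut_par par v else par.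

Definition op_weight (o : op) (wt : nat -> bool) : nat -> bool :=
  if o is UpdateWeight v b then set_wt wt v b else wt.

Definition op_answers (n : nat) (par : nat -> option nat) (wt : nat -> bool) (o : op) : seq nat :=
  if o is TreeSum v then [:: tree_sum n par wt v] else [::].

Definition legal_op (n : nat) (par : nat -> option nat) (o : op) : Prop :=
  match o with Cut v => v < n /\ par v <> None | UpdateWeight v _ | TreeSum v => v < n end.

Lemma legal_cons n par o ops : legal_seq n par (o :: ops) ->
  legal_op n par o /\ legal_seq n (op_par o par) ops.
Proof. by case: o => [v|v b|v] /= => [[vn [pv]]|[]|[]]. Qed.

Lemma answers_cons n par wt o ops : answers n par wt (o :: ops) =
  op_answers n par wt o ++ answers n (op_par o par) (op_weight o wt) ops.
Proof. by case: o. Qed.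

Lemma size_op_answers n par wt o : size (op_answers n par wt o) = is_query o.
Proof. by case: o. Qed.

Definition op_records (ops : seq op) : seq (nat * nat * nat) := map enc_op ops ++ [:: end_rec].

Section Service.

Variables (w : nat) (due : nat -> nat) (n : nat) (par : nat -> option nat).
Variables (ord : seq nat) (R : nat -> nat) (B : nat).
Hypotheses (W_ge : 1024 * (n + 3) <= 2 ^ w) (par_forest : forest n par).
Hypotheses (pre : preorder n par ord R) (B_gt0 : 0 < B) (B_le : 2 ^ B <= n.+1 + 1).

Local Notation N := n.+1.
Local Notation wp := (wp w due).
Local Notation at_position := (at_position n ord).

Let R_bound := preorder_bound pre.
Let R_laminar := preorder_laminar pre.
Let W_geN := W_geN W_ge.

(* [roots] and [wt] are predicates on vertices. *)
Record ready (roots wt : nat -> bool) (s : state) : Prop := Ready {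
  ready_n : var s vn = n;
  ready_pos : forall v, v < n -> arr s aPos v = index v ord;
  ready_parent : forall v, v < n -> arr s aParent v = parent n par v;
  ready_inv : exists D wf, [/\ D =1 at_position roots, wf =1 at_position wt
    & data_invariant N B R D wf s] }.

Definition budget (roots : nat -> bool) (s : state) : nat :=
  2 * potential N B R (at_position roots) (arr s aLabel).

Lemma ready_unchanged c roots wt s s' : unchanged c s s' -> vn \notin assigned c ->
  vB \notin assigned c -> stored c = [::] -> ready roots wt s -> ready roots wt s'.
Proof.
move=> U nn nB no_store [nE posE parE [D [wf [DE wfE inv]]]].
split; rewrite ?(same_var U) ?(same_arr U) ?no_store //; exists D, wf; split=> //.
exact: data_invariant_unchanged U nB no_store inv.
Qed.

Lemma ready_eq roots roots' wt s : (forall v, v < n -> roots v = roots' v) ->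
  ready roots wt s -> ready roots' wt s.
Proof.
move=> /(eq_at_position ord) E [nE posE parE [D [wf [DE wfE inv]]]].
by split=> //; exists D, wf; split=> // x; rewrite DE.
Qed.

Lemma budget_eq roots roots' s : (forall v, v < n -> roots v = roots' v) ->
  budget roots s = budget roots' s.
Proof. by move=> /(eq_at_position ord) E; rewrite /budget (eq_potential _ _ _ _ E). Qed.

Lemma cut_ready roots wt s v : ready roots wt s -> v < n -> ~~ roots v ->
  var s vX = index v ord -> exists t, wp cut_cmd s t (fun s' =>
    ready (mark roots v) wt s' /\ t + budget (mark roots v) s' <= budget roots s + 4).
Proof.
move=> [nE posE parE [D [wf [DE wfE inv]]]] vn /negbTE not_root xE.
have x_in : 0 < index v ord < N by rewrite (index_gt0_pre pre vn) (index_lt_pre pre (ltnW vn)).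
have Dx : D (index v ord) = false by rewrite DE (at_position_index pre).
have [t [s' [X inv' le]]] := cut_spec B_gt0 R_bound R_laminar due B_le W_geN inv x_in Dx xE.
have markE : mark D (index v ord) =1 at_position (mark roots v).
  by move=> x; rewrite (at_position_mark pre) // /mark DE.
have U := exec_unchanged X; exists t, t, s'; split=> //; split.
  split; rewrite ?(same_var U) ?(same_arr U) //.
  by exists (mark D (index v ord)), wf.
by rewrite /budget -(eq_potential _ _ _ _ markE) -(eq_potential _ _ _ _ DE).
Qed.

Lemma is_root_parent v : v < n -> (parent n par v == n) = is_root par v.
Proof.
move=> vn; rewrite /parent vn /is_root; case E: (par v) => [u|] /=; last by rewrite eqxx.
by case: par_forest => par_lt _; rewrite ltn_eqF // (par_lt _ _ vn E).
Qed.

Definition roots_below (i v : nat) : bool := (v < i) && is_root par v.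

Lemma roots_belowS i :
  roots_below i.+1 =1 if is_root par i then mark (roots_below i) i else roots_below i.
Proof.
move=> v; rewrite /roots_below ltnS leq_eqVlt.
case: (v =P i) => [->|/eqP vi]; case: ifP => root; rewrite /mark /= ?eqxx ?root ?orbT ?andbF //.
by rewrite (negbTE vi) orbF.
Qed.

Lemma cut_root_spec wt i s : ready (roots_below i) wt s -> i < n -> var s vI = i ->
  exists t, wp (If (aParent.[|$vI] == $vn) (vX <-- aPos.[|$vI];; cut_cmd) Skip)%X s t (fun s' =>
    ready (roots_below i.+1) wt s' /\
    t + budget (roots_below i.+1) s' <= budget (roots_below i) s + 4).
Proof.
move=> rd lt iE; have [nE posE parE _] := rd.
have cond : (eval (aParent.[|$vI] == $vn)%X s != 0) = is_root par i.
  by rewrite /= iE nE parE // is_root_parent //; case: is_root.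
have below := roots_belowS i; case root: (is_root par i) cond below => cond below.
  pose s1 := set_var s vX (index i ord).
  have rd1 : ready (roots_below i) wt s1.
    exact: ready_unchanged (unchanged_assign vX #0 s _) _ _ _ rd.
  have [|t X] := cut_ready rd1 lt _ (erefl : var s1 vX = index i ord);
    first by rewrite /roots_below ltnn.
  exists t; apply: wp_if cond _ _ => //; first by eval_simpl; rewrite iE; lia.
  move=> _; apply: wp_seq0; apply: (wp_assign (v := index i ord)).
  - by eval_simpl; rewrite iE; lia.
  - by eval_simpl; rewrite iE posE.
  apply: wp_mono X (leqnn _) _ => s2 _ [rd2 le]; split; first by apply: ready_eq rd2.
  by rewrite (budget_eq _ (fun v _ => below v)).
exists 0; apply: wp_if cond _ _ => // [|_]; first by eval_simpl; rewrite iE; lia.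
apply: wp_skip; split; first by apply: ready_eq rd.
by rewrite (budget_eq _ (fun v _ => below v)) leq_addr.
Qed.

Lemma cut_roots_spec wt s : ready xpred0 wt s ->
  wp cut_roots_cmd s (5 * n + budget xpred0 s) (fun s' =>
    ready (is_root par) wt s' /\ budget (is_root par) s' <= budget xpred0 s + 4 * n).
Proof.
move=> rd; pose Inv i s' := ready (roots_below i) wt s' /\
  budget (roots_below i) s' <= budget xpred0 s + 4 * i.
pose Phi i s' := budget (roots_below i) s' + 4 * (n - i).
have below0 v : v < n -> xpred0 v = roots_below 0 v by [].
have belowN v : v < n -> roots_below n v = is_root par v by rewrite /roots_below => ->.
apply: wp_mono (wp_for_amortized (T := 5 * n + budget xpred0 s) (Inv := Inv) (Phi := Phi)
  _ _ (ready_n rd) _ _ _ _ _ _ _) (leqnn _) _ => //.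
- by lia.
- move=> i s' x [rd' le]; split=> //.
  exact: ready_unchanged (unchanged_assign vI #0 s' x) _ _ _ rd'.
- by rewrite /Phi -(budget_eq _ below0); lia.
- by split; [apply: ready_eq rd | rewrite -(budget_eq _ below0) addn0].
- move=> i s' _ iE /andP[_ lt] [rd' le]; have [t X] := cut_root_spec rd' lt iE.
  exists t; apply: wp_mono X (leqnn _) _ => s2 _ [rd2 le2].
  by split; [split=> //; lia | rewrite /Phi; lia].
by move=> s' _ [rd' le]; rewrite -(budget_eq _ belowN); split=> //; apply: ready_eq rd'.
Qed.

Lemma update_ready roots wt s v (b : bool) : ready roots wt s -> v < n ->
  var s vX = index v ord -> var s vRec2 = b ->
  wp update_cmd s 0 (fun s' => ready roots (set_wt wt v b) s' /\ budget roots s' = budget roots s).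
Proof.
move=> [nE posE parE [D [wf [DE wfE inv]]]] vn xE bE.
have X := update_spec B_gt0 due B_le W_geN inv (index_lt_pre pre (ltnW vn)) xE bE.
apply: wp_mono X (leqnn _) _ => s' U inv'; split; last by rewrite /budget (same_arr U).
split; rewrite ?(same_var U) ?(same_arr U) //.
exists D, (set_wt wf (index v ord) b); split=> // x.
by rewrite (at_position_set_wt pre) // /set_wt wfE.
Qed.

Lemma query_ready par' wt s v : subforest par par' -> ready (is_root par') wt s -> v < n ->
  var s vX = index v ord -> wp query_cmd s 0 (fun s' =>
    [/\ ready (is_root par') wt s', output s' = rcons (output s) (tree_sum n par' wt v) &
        budget (is_root par') s' = budget (is_root par') s]).
Proof.
move=> sub [nE posE parE [D [wf [DE wfE inv]]]] vn xE.
have X := query_spec B_gt0 R_laminar due B_le W_geN inv (index_lt_pre pre (ltnW vn)) xE.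
apply: wp_mono X (leqnn _) _ => s' U [inv' out].
rewrite (tree_sum_positions par_forest pre sub DE wfE vn) in out.
split=> //; last by rewrite /budget (same_arr U).
by split; rewrite ?(same_var U) ?(same_arr U) //; exists D, wf.
Qed.

Lemma is_root_cut par' v : is_root (cut_par par' v) =1 mark (is_root par') v.
Proof. by move=> u; rewrite /is_root /cut_par /mark; case: eqP; rewrite ?orbT ?orbF. Qed.

Record served (o : op) (par' : nat -> option nat) (wt : nat -> bool) (s : state) (t : nat)
    (s' : state) : Prop := Served {
  served_ready : ready (is_root (op_par o par')) (op_weight o wt) s';
  served_output : output s' = output s ++ op_answers n par' wt o;
  served_budget : t + budget (is_root (op_par o par')) s' <= budget (is_root par') s + 4 }.

Section Operation.

Variables (o : op) (par' : nat -> option nat) (wt : nat -> bool) (s : state).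
Hypotheses (sub : subforest par par') (legal : legal_op n par' o).
Hypothesis rd : ready (is_root par') wt s.

Local Notation v := (enc_op o).1.2.

Lemma op_vertex_lt : v < n.
Proof. by move: legal; case: (o) => [u []|u b|u]. Qed.

Lemma dispatch_spec : var s vX = index v ord -> var s vRec0 = (enc_op o).1.1 ->
  var s vRec2 = (enc_op o).2 -> exists t, wp dispatch_cmd s t (served o par' wt s t).
Proof.
have W1 : 1 < 2 ^ w by lia.
have vn := op_vertex_lt; case: o legal vn => [u [_ not_root]|u b _|u _] /= vn xE r0 r2.
- have [|t X] := cut_ready rd vn _ xE; first by rewrite /is_root; case: (par' u) not_root.
  exists t; apply: wp_if; rewrite /= ?r0 ?(ltnW W1) ?W1 //= => _;
    apply: wp_mono X (leqnn _) _ => s' U [rd' le].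
  split; rewrite ?cats0 ?(same_output U) //.
    by apply: ready_eq rd' => x _; rewrite is_root_cut.
  by rewrite (budget_eq _ (fun x _ => is_root_cut par' u x)).
- exists 0; apply: wp_if; rewrite /= ?r0 ?(ltnW W1) ?W1 //= => _.
  apply: wp_if; rewrite /= ?r0 ?(ltnW W1) ?W1 //= => _.
  apply: wp_mono (update_ready rd vn xE r2) (leqnn _) _ => s' U [rd' le].
  by split; rewrite ?cats0 ?(same_output U) //= le leq_addr.
exists 0; apply: wp_if; rewrite /= ?r0 ?(ltnW W1) ?W1 //= => _.
  apply: wp_if; rewrite /= ?r0 ?(ltnW W1) ?W1 //= => _.
apply: wp_mono (query_ready sub rd vn xE) (leqnn _) _ => s' U [rd' out le].
by split; rewrite ?out ?cats1 //= le leq_addr.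
Qed.

End Operation.

Lemma operation_spec o par' wt s : subforest par par' -> legal_op n par' o ->
  ready (is_root par') wt s -> (var s vRec0, var s vRec1, var s vRec2) = enc_op o ->
  exists t, wp operation_cmd s t (served o par' wt s t).
Proof.
move=> sub legal rd recE; have [_ posE _ _] := rd; have vn := op_vertex_lt legal.
have v1 : var s vRec1 = (enc_op o).1.2 by rewrite -recE.
have rd1 := ready_unchanged (unchanged_assign vX #0 s (index (enc_op o).1.2 ord)) isT isT erefl rd.
have [||| t X] := dispatch_spec sub legal rd1; rewrite /= -?recE //.
exists t; apply: wp_seq0; apply: (wp_assign (v := index (enc_op o).1.2 ord)).
- by eval_simpl; rewrite v1; lia.
- by eval_simpl; rewrite v1 posE.
by apply: wp_mono X (leqnn _) _ => s' _ [].
Qed.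

End Service.

(* The records are the header, the n vertices and the operations; when one operation
   is read, all earlier ones must have been answered. *)
Definition required (n : nat) (ops : seq op) (c : nat) : nat :=
  count is_query (take (c - n.+2) ops).

Section Main.

Variables (w n : nat) (par : nat -> option nat) (wt : nat -> bool) (ops : seq op).
Variables (ord : seq nat) (R : nat -> nat) (B : nat).
Hypotheses (W_ge : 1024 * (n + 3) <= 2 ^ w) (par_forest : forest n par).
Hypotheses (pre : preorder n par ord R) (B_gt0 : 0 < B) (B_le : 2 ^ B <= n.+1 + 1).

Local Notation due := (required n ops).
Local Notation wp := (wp w due).
Local Notation ready := (ready n par ord R B).
Local Notation budget := (budget n ord R B).

Record serving (done rest : seq op) (par' : nat -> option nat) (wt' : nat -> bool) (s : state) :
    Prop := Serving {
  serve_ops : ops = done ++ rest;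
  serve_sub : subforest par par';
  serve_legal : legal_seq n par' rest;
  serve_ready : ready (is_root par') wt' s;
  serve_answers : output s ++ answers n par' wt' rest = answers n par wt ops;
  serve_count : size (output s) = count is_query done;
  serve_pending : pending s = op_records rest;
  serve_nread : nread s = n.+1 + size done }.

Lemma serving_timely done rest par' wt' s x : serving done rest par' wt' s ->
  timely due (read_record s x).
Proof.
move=> sv; rewrite /timely /read_record; case: (head _ _) => [[a b] c] /=.
rewrite (serve_nread sv) -addSn /required addKn (serve_ops sv) take_size_cat //.
by rewrite (serve_count sv).
Qed.

Lemma serve_spec done o rest par' wt' s : serving done (o :: rest) par' wt' s ->
  exists t, wp operation_cmd (read_record s vRec0) t (fun s' =>
    serving (rcons done o) rest (op_par o par') (op_weight o wt') s' /\
    t + budget (is_root (op_par o par')) s' <= budget (is_root par') s + 4).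
Proof.
move=> [opsE sub /legal_cons[legal legals] rd ans cnt pend nr].
have rd1 := ready_unchanged (unchanged_read vRec0 s) isT isT erefl rd.
have U1 := unchanged_read vRec0 s.
have [|t X] := operation_spec due W_ge par_forest pre B_gt0 B_le sub legal rd1.
  by rewrite /read_record pend /=; case: (enc_op o) => [[a b] c].
exists t; apply: wp_mono X (leqnn _) _ => s' U [rd' out le].
have [pend' nr'] := same_input U isT.
rewrite (same_output U1) // in out; rewrite /budget (same_arr U1) // in le; split=> //; split=> //.
- by rewrite cat_rcons.
- by case: (o) => *; rewrite //=; apply: subforest_cut.
- by rewrite out -catA -answers_cons.
- by rewrite out size_cat cnt size_op_answers -cats1 count_cat /= addn0.
- by rewrite pend' /read_record pend /=; case: (enc_op o) => [[a b] c].
- by rewrite nr' size_rcons addnS -nr /read_record; case: (head _ _) => [[a b] c].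
Qed.

Lemma main_spec s : serving [::] ops par wt s ->
  wp main_cmd s (5 * size ops + budget (is_root par) s) (fun s' =>
    output s' = answers n par wt ops).
Proof.
move=> sv0; apply: wp_seq0; apply: wp_read; first exact: serving_timely sv0.
pose Inv k s1 := exists done rest par' wt' s, [/\ serving done rest par' wt' s,
  s1 = read_record s vRec0 & k = 5 * size rest + budget (is_root par') s].
apply: (wp_while (Inv := Inv)) => [k s1 _ [done [[|o rest] [par' [wt' [s2 [sv -> kE]]]]]]|].
- have [_ _ _ _ ans _ pend _] := sv.
  rewrite /read_record pend /=; split=> //; [by lia | by move=> _; rewrite -ans cats0].
- have rec0 : var (read_record s2 vRec0) vRec0 < 3.
    by rewrite /read_record (serve_pending sv); case: (o).
  split; rewrite /= ?rec0 //; first by lia.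
  move=> _; have [t X] := serve_spec sv; exists t; rewrite -[t]addn0.
  apply: wp_then X _ => s3 _ [sv3 le]; apply: wp_read; first exact: serving_timely sv3.
  exists (5 * size rest + budget (is_root (op_par o par')) s3); split; first by rewrite kE /=; lia.
  by exists (rcons done o), rest, (op_par o par'), (op_weight o wt'), s3.
by exists [::], ops, par, wt, s.
Qed.

End Main.

Lemma required_init n ops c : c <= n.+1 -> required n ops c = 0.
Proof. by move=> le; rewrite /required (_ : c - n.+2 = 0) ?take0 //; lia. Qed.

Lemma forest_spec w n par wt ops : 1024 * (n + 3) <= 2 ^ w -> forest n par -> legal_seq n par ops ->
  wp w (required n ops) forest_cmd (start_state n par wt (op_records ops)) (30 * (size ops + n + 1))
    (fun s => output s = answers n par wt ops).
Proof.
move=> W_ge par_forest legal.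
have total : 10 * n.+1 + ((5 * n + 2 * n.+1) + (5 * size ops + (2 * n.+1 + 4 * n))) <=
  30 * (size ops + n + 1) by lia.
apply: wp_mono total (fun _ _ h => h).
apply: wp_then (init_spec wt W_ge par_forest _ (@required_init n ops)) _.
move=> s1 _ [ord [B [R [pre B_gt0 B_le nE posE parE inv pot pend nr out]]]].
have no_root : xpred0 =1 at_position n ord xpred0.
  by move=> x; rewrite /at_position /weight_below !andbF.
have rd1 : ready n par ord R B xpred0 wt s1.
  by split=> //; exists xpred0, (at_position n ord wt).
rewrite (eq_potential _ _ _ _ no_root) in pot.
have roots := cut_roots_spec (required n ops) W_ge par_forest pre B_gt0 B_le rd1.
apply: wp_then (wp_mono roots _ (fun _ _ h => h)) _; first by rewrite /budget; lia.
move=> s2 U2 [rd2 le2]; have [pend2 nr2] := same_input U2 isT.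
have sv : serving n par wt ops ord R B [::] ops par wt s2.
  by split; rewrite ?pend2 ?nr2 ?(same_output U2) ?out ?addn0 //; right.
apply: wp_mono (main_spec W_ge par_forest pre B_gt0 B_le sv) _ (fun _ _ h => h).
by move: le2; rewrite /budget; lia.
Qed.

Lemma op_record_bound n par ops r : legal_seq n par ops -> r \in map enc_op ops ->
  [/\ r.1.1 < 3, r.1.2 < n & r.2 < 2].
Proof.
elim: ops par => // o ops IH par /legal_cons[legal /IH{}IH]; rewrite inE => /orP[/eqP->|/IH//].
by case: o legal => [v []|v b|v] //= *; split=> //; case: (b).
Qed.

Lemma start_represents w n par wt ops : 1024 * (n + 3) <= 2 ^ w -> forest n par ->
  legal_seq n par ops -> represents w (start_state n par wt (op_records ops)) (fun _ => 0).
Proof.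
move=> W_ge [par_lt _] legal; split=> //=; first by move=> a; lia.
move=> r; rewrite inE mem_cat => /or3P[/eqP->|/mapP[v]|].
- by split=> /=; lia.
- rewrite mem_iota add0n => /andP[_ vn] ->; split=> /=; [|by case: (wt v); lia | by lia].
  by case E: (par v) => [u|] /=; [have := par_lt v u vn E; lia | lia].
rewrite mem_cat mem_seq1 => /orP[/(op_record_bound legal)[r0 r1 r2]|/eqP->].
  by split; [apply: leq_trans r0 _ | apply: leq_trans r1 _ | apply: leq_trans r2 _]; lia.
by split=> /=; lia.
Qed.

Lemma required_ge n ops j c : n.+1 + j < c -> count is_query (take j ops) <= required n ops c.
Proof.
move=> lt; have le : j <= c - n.+2 by lia.
rewrite /required -[X in _ <= count _ X](cat_take_drop j) count_cat.
by rewrite take_takel // leq_addr.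
Qed.

Lemma word_size_ge w n : (n + 2) ^ 12 <= 2 ^ w -> 1024 * (n + 3) <= 2 ^ w.
Proof.
apply: leq_trans; rewrite (_ : 12 = 11 + 1) // expnD expn1.
have : 2 ^ 11 <= (n + 2) ^ 11 by rewrite leq_exp2r //; lia.
by rewrite (_ : 2 ^ 11 = 2048) // => le; nia.
Qed.

Theorem theorem2 :
  exists (P : seq instr) (c K : nat),
    forall (w n : nat) (par : nat -> option nat) (wt : nat -> bool)
           (ops : seq op),
      (n + 2) ^ K <= 2 ^ w ->
      forest n par ->
      legal_seq n par ops ->
      let c0 := init_config (encode n par wt ops) in
      (exists T, T <= c * (size ops + n + 1) /\
                 halted w P (run w P T c0) /\
                 out (run w P T c0) = answers n par wt ops) /\
      (forall t j, j <= size ops ->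
         n.+1 + j < consumed (run w P t c0) ->
         count is_query (take j ops) <= size (out (run w P t c0))).
Proof.
exists (compile forest_cmd 0), (code_size forest_cmd * 31), 12.
move=> w n par wt ops big par_forest legal c0; have W_ge := word_size_ge big.
have [tau [s [tau_le X answered]]] := forest_spec wt W_ge par_forest legal.
have word_gt : 128 < 2 ^ w by lia.
have start : timely (required n ops) (start_state n par wt (op_records ops)).
  by rewrite /timely required_init.
have [t [t_le stop outE on_time]] :=
  compile_correct word_gt wf_forest_cmd X (start_represents wt W_ge par_forest legal) start.
split=> [|t' j _ read]; last exact: leq_trans (required_ge ops read) (on_time t').
exists t; split; last by rewrite outE.
by apply: leq_trans t_le _; rewrite -mulnA leq_mul2l; apply/orP; right; lia.
Qed.
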